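(* Let $W$ be a finite Coxeter group, $\mathbb{K}$ a field of characteristic $0$, and $w\in W$. Let $\mathcal{H}W^{(w)}\subseteq\operatorname{End}(T_w)$ be the $w$-biHecke algebra. Then: (1) $\mathcal{H}W^{(w)}$ is the maximal algebra stabilizing all the modules $P^{(w)}_J$ for $J\in\mathcal{RB_L}(w)$: $$\mathcal{H}W^{(w)}=\{f\in\operatorname{End}(T_w)\mid f(P^{(w)}_J)\subseteq P^{(w)}_J\ \text{ for all } J\in\mathcal{RB_L}(w)\}.$$ (2) For each pair $(u,v)\in[1,w]_R^2$ with $J^{(w)}(u)\subseteq J^{(w)}(v)$ there is a $(u,v)$-triangular element $f_{u,v}$ of $F$, and such elements $f_{u,v}$ form a basis of $\mathcal{H}W^{(w)}$; in particular $$\dim\mathcal{H}W^{(w)}=|\{(u,v)\in[1,w]_R^2\mid J^{(w)}(u)\subseteq J^{(w)}(v)\}|.$$ (3) $\mathcal{H}W^{(w)}$ is (isomorphic to) the digraph algebra of the graph $G^{(w)}$. (4) The family $(P^{(w)}_J)_{J\in\mathcal{RB_L}(w)}$ is a complete system of representatives of the indecomposable projective modules of $\mathcal{H}W^{(w)}$. (5) The family $(S^{(w)}_J)_{J\in\mathcal{RB_L}(w)}$ is a complete system of representatives of the simple modules of $\mathcal{H}W^{(w)}$, and $\dim S^{(w)}_J=|\{u\in[1,w]_R\mid J^{(w)}(u)=J\}|$. (6) $\mathcal{H}W^{(w)}$ is Morita equivalent to the poset algebra (incidence algebra) of the lattice $[1,w]_{\sqsubseteq}$. In particular, its Cartan matrix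 is the incidence matrix of this lattice and its quiver is the Hasse diagram of this lattice.
   Context: $W=\langle s_i\mid i\in I\rangle$ is a finite Coxeter group with identity $1$ and length $\ell$; $D_R(w)=\{i\in I:\ell(ws_i)<\ell(w)\}$; $W_J=\langle s_j\mid j\in J\rangle$. $u\le_R w$ iff $\ell(w)=\ell(u)+\ell(u^{-1}w)$, with intervals $[1,w]_R$; $\le_B$ is Bruhat order. Translation module and algebra: $T_w$ is the $\mathbb{K}$-vector space with basis $[1,w]_R$, with right operators, for $u\in[1,w]_R$ and $i\in I$: $u.\pi_i=u$ if $i\in D_R(u)$; $us_i$ if $i\notin D_R(u)$ and $us_i\in[1,w]_R$; $0$ otherwise; and $u.\overline\pi_i=us_i$ if $i\in D_R(u)$; $u$ if $i\notin D_R(u)$ and $us_i\in[1,w]_R$; $0$ otherwise. $\mathcal{H}W^{(w)}$ is the subalgebra of $\operatorname{End}(T_w)$ generated by all $\pi_i,\overline\pi_i$; modules are right modules. Put $s_i:=\pi_i+\overline\pi_i-1\in\mathcal{H}W^{(w)}$, so $u.s_i=us_i$ if $us_i\in[1,w]_R$, and $-u$ otherwise. $F$ is the submonoid of $\mathcal{H}W^{(w)}$ generated by the $\pi_i,\overline\pi_i,s_i$, $i\in I$. Each $f\in F$ sends each $u\in[1,w]_R$ to $0$ or to $\pm v$ with $v\in[1,w]_R$; signs are ignored and $0$ is disregarded when speaking of $\operatorname{im}(f)\subseteq[1,w]_R$ and of $f^{-1}(v)\subseteq[1,w]_R$. An $f\in F$ is $(u,v)$-triangular if, for Bruhat order, $v$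 is the unique minimal element of $\operatorname{im}(f)$ and $u$ is the unique maximal element of $f^{-1}(v)$. Blocks: write uniquely $w=w_J\,{}^Jw$ with $w_J\in W_J$ and ${}^Jw$ having no left descent in $J$. $J\subseteq I$ is a left block of $w$ if $W_Jw=wW_K$ for some $K\subseteq I$; it is reduced if each $j\in J$ appears in some (hence every) reduced word of $w_J$. $\mathcal{RB_L}(w)$ is the set of reduced left blocks. Cutting points of $w$: the elements ${}^Jw$, $J$ a left block; $v\sqsubseteq w$ means $v$ is a cutting point of $w$; this is a partial order and $[1,w]_{\sqsubseteq}$ (the set of cutting points of $w$) is a lattice, with $J\mapsto{}^Jw$ a bijection $\mathcal{RB_L}(w)\to[1,w]_\sqsubseteq$ reversing order. For $u\in[1,w]_R$, $J^{(w)}(u)$ is the $J\in\mathcal{RB_L}(w)$ such that ${}^Jw$ is the lowest cutting point with $u\in[1,{}^Jw]_R$. Modules: $\overleftarrow{s_i}.u=s_iu$ if $s_iu\in[1,w]_R$, and $-u$ otherwise (linear operator on $T_w$). $P^{(w)}_J:=\{x\in T_w\mid\overleftarrow{s_i}.x=-x\ \forall i\in J\}$ and $S^{(w)}_J:=P^{(w)}_J/\sum_{J'\supsetneq J,\,J'\in\mathcal{RB_L}(w)}P^{(w)}_{J'}$ for $J\in\mathcal{RB_L}(w)$. $G^{(w)}$ is the digraph on $[1,w]_R$ with an edge $u\to v$ whenever $u=vs_i$ for some $i\in I$ and $J^{(w)}(u)\subseteq J^{(w)}(v)$. The digraph algebra of a digraph has basis $e_{u,v}$, one for each pair $(u,v)$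 joined by a (possibly empty) directed path from $u$ to $v$, with $e_{u,v}e_{v',t}=\delta_{v,v'}e_{u,t}$.
   Formalization: P_J is defined by antisymmetry under all reflections of W_J, not only the s_i with i in J; with the s_i alone (1) and (5) fail for w=s_1s_2 in S_3, J={1,2}. The poset algebra has basis e_{x,y}, x⊑y, multiplied as composition of maps. *)

(* Defs.v *)
From HB Require Import structures.
From mathcomp Require Import all_boot all_order all_fingroup all_algebra all_field.
From mathcomp Require Import generic_quotient ring_quotient.
From mathcomp Require Import boolp.

Set Implicit Arguments.
Unset Strict Implicit.
Unset Printing Implicit Defensive.

Import GRing.Theory.

(** Throughout, a right module over [A] is an [lmodType A^c], with [A^c] the
    converse ring. *)

Section Modules.
Local Open Scope ring_scope.
Variable R : pzRingType.
Implicit Types M N Q : lmodType R.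

Definition mod_iso M N : Prop := exists f : {linear M -> N}, bijective f.

Definition mod_zero M : Prop := forall x : M, x = 0.

Definition short_exact N M Q (f : {linear N -> M}) (g : {linear M -> Q}) : Prop :=
  [/\ injective f,
      forall q, exists x, g x = q
    & forall x, g x = 0 <-> exists y, f y = x].

Definition simple_mod M : Prop :=
  ~ mod_zero M /\
  forall U : {pred M}, submod_closed U ->
    (forall x, x \in U -> x = 0) \/ (forall x, x \in U).

Definition indecomposable_mod M : Prop :=
  ~ mod_zero M /\
  forall N1 N2, mod_iso M (N1 * N2)%type -> mod_zero N1 \/ mod_zero N2.

Definition projective_mod M : Prop :=
  forall N Q (g : {linear N -> Q}) (f : {linear M -> Q}),
    (forall q, exists x, g x = q) ->
    exists h : {linear M -> N}, forall x, g (h x) = f x.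

Definition complete_representatives (X : Type) (P : lmodType R -> Prop)
    (F : X -> lmodType R) : Prop :=
  [/\ forall i, P (F i),
      forall i j, mod_iso (F i) (F j) -> i = j
    & forall M, P M -> exists i, mod_iso M (F i)].

(** [composition_mult S M n]: [M] has a composition series in which exactly
    [n] factors are isomorphic to [S]; by Jordan-Hoelder, [n] is then [[M : S]]. *)
Inductive composition_mult (S : lmodType R) : lmodType R -> nat -> Prop :=
| CompositionNil M : mod_zero M -> composition_mult S M 0
| CompositionIso N M Q (f : {linear N -> M}) (g : {linear M -> Q}) n :
    short_exact f g -> simple_mod Q -> mod_iso Q S ->
    composition_mult S N n -> composition_mult S M n.+1
| CompositionOther N M Q (f : {linear N -> M}) (g : {linear M -> Q}) n :
    short_exact f g -> simple_mod Q -> ~ mod_iso Q S ->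
    composition_mult S N n -> composition_mult S M n.

End Modules.

Definition submod (R : pzRingType) (M : lmodType R) (U : {pred M})
  of submod_closed U : Type := {x : M | x \in U}.

Section Submodule.
Local Open Scope ring_scope.
Variables (R : pzRingType) (M : lmodType R) (U : {pred M}).
Variable hU : submod_closed U.

HB.instance Definition _ := SubChoice.on (submod hU).
HB.instance Definition _ := GRing.SubChoice_isSubLmodule.Build R M U (submod hU)
  (GRing.submod_closed_semi hU).

End Submodule.

Definition submod_zclosed (R : pzRingType) (M : lmodType R) (U : {pred M})
    (hU : submod_closed U) : zmodClosed M :=
  HB.pack U (GRing.isZmodClosed.Build M U (GRing.submod_closedB hU)).

Definition quotmod (R : pzRingType) (M : lmodType R) (U : {pred M})
    (hU : submod_closed U) : Type := Quotient.quot (submod_zclosed hU).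

Section QuotientModule.
Local Open Scope ring_scope.
Local Open Scope quotient_scope.
Variables (R : pzRingType) (M : lmodType R) (U : {pred M}).
Variable hU : submod_closed U.
Local Notation Q := (quotmod hU).

HB.instance Definition _ := GRing.Zmodule.copy Q (Quotient.quot (submod_zclosed hU)).
HB.instance Definition _ := Quotient.copy Q (Quotient.quot (submod_zclosed hU)).

Definition quotmod_scale (a : R) (x : Q) : Q := \pi_Q (a *: repr x).

Lemma quotmod_piE (x y : M) : (\pi_Q x == \pi_Q y) = (x - y \in U).
Proof. exact: (esym (Quotient.idealrBE (submod_zclosed hU) x y)). Qed.

Lemma quotmod_scaleE a (x : M) : quotmod_scale a (\pi_Q x) = \pi_Q (a *: x).
Proof.
apply/eqP; rewrite quotmod_piE -scalerBr.
have xU : repr (\pi_Q x) - x \in U by rewrite -quotmod_piE reprK.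
have [U0 Ulin] := hU; rewrite -[a *: _]addr0.
exact: Ulin.
Qed.

Fact quotmod_scaleA a b (x : Q) :
  quotmod_scale a (quotmod_scale b x) = quotmod_scale (a * b) x.
Proof.
by rewrite -[x]reprK [quotmod_scale b _]quotmod_scaleE !quotmod_scaleE scalerA.
Qed.

Fact quotmod_scale1 : left_id 1 quotmod_scale.
Proof. by move=> x; rewrite -[x]reprK quotmod_scaleE scale1r. Qed.

Lemma quotmod_piD (x y : M) : \pi_Q (x + y) = \pi_Q x + \pi_Q y.
Proof. exact: (Quotient.pi_add (submod_zclosed hU)). Qed.

Fact quotmod_scaleDr : right_distributive quotmod_scale +%R.
Proof.
move=> a x y; rewrite -[x]reprK -[y]reprK.
by rewrite -quotmod_piD !quotmod_scaleE scalerDr quotmod_piD.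
Qed.

Fact quotmod_scaleDl x : {morph quotmod_scale^~ x : a b / a + b}.
Proof.
by move=> a b; rewrite -[x]reprK !quotmod_scaleE scalerDl quotmod_piD.
Qed.

HB.instance Definition _ := GRing.Zmodule_isLmodule.Build R Q
  quotmod_scaleA quotmod_scale1 quotmod_scaleDr quotmod_scaleDl.

End QuotientModule.

Section Radical.
Local Open Scope ring_scope.
Variables (R : pzRingType) (M : lmodType R).

Definition maximal_submod (U : {pred M}) : Prop :=
  [/\ submod_closed U,
      exists x, x \notin U
    & forall V : {pred M}, submod_closed V -> {subset U <= V} ->
        {subset V <= U} \/ (forall x, x \in V)].

Definition radical : {pred M} :=
  [pred x | `[< forall U : {pred M}, maximal_submod U -> x \in U >]].

Lemma radical_closed : submod_closed radical.
Proof.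
split=> [|a x y /asboolP xR /asboolP yR].
  by apply/asboolP=> U [[]].
apply/asboolP=> U maxU; case: (maxU) => [[_ Ulin] _ _].
by apply: Ulin; [apply: xR | apply: yR].
Qed.

End Radical.

Definition radical_mod (R : pzRingType) (M : lmodType R) : lmodType R :=
  submod (radical_closed M).

(** [rad M / rad^2 M] *)
Definition radical_layer (R : pzRingType) (M : lmodType R) : lmodType R :=
  quotmod (radical_closed (radical_mod M)).

Section RightModules.
Local Open Scope ring_scope.
Variables (K : fieldType) (A : algType K).

Definition kscale (M : lmodType A^c) (k : K) (x : M) : M := ((k%:A : A) : A^c) *: x.

Definition has_kdim (M : lmodType A^c) (n : nat) : Prop :=
  exists b : 'I_n -> M, forall x : M,
    exists! c : {ffun 'I_n -> K}, x = \sum_i kscale (c i) (b i).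

End RightModules.

(** Morita equivalence is a [K]-linear equivalence between the categories of all
    right modules: a full, faithful, essentially surjective functor. Morphisms
    are compared extensionally. *)

Section Morita.
Local Open Scope ring_scope.
Variables (K : fieldType) (A B : algType K).

Record modFunctor := ModFunctor {
  fobj :> lmodType A^c -> lmodType B^c;
  fmap : forall M N : lmodType A^c, {linear M -> N} -> {linear fobj M -> fobj N};
  _ : forall (M N : lmodType A^c) (f g : {linear M -> N}),
        f =1 g -> fmap f =1 fmap g;
  _ : forall (M : lmodType A^c) (f : {linear M -> M}), f =1 id -> fmap f =1 id;
  _ : forall (M N Q : lmodType A^c) (f : {linear M -> N}) (g : {linear N -> Q})
        (h : {linear M -> Q}), h =1 g \o f -> fmap h =1 fmap g \o fmap f
}.

Definition morita_equivalent : Prop :=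
  exists F : modFunctor,
    [/\ forall (M N : lmodType A^c) (k : K) (f g h : {linear M -> N}),
          (forall x, h x = kscale k (f x) + g x) ->
          forall y, fmap F h y = kscale k (fmap F f y) + fmap F g y,
        forall (M N : lmodType A^c) (f g : {linear M -> N}),
          fmap F f =1 fmap F g -> f =1 g,
        forall (M N : lmodType A^c) (h : {linear F M -> F N}),
          exists f : {linear M -> N}, fmap F f =1 h
      & forall N : lmodType B^c, exists M : lmodType A^c, mod_iso (F M) N].

End Morita.

(** The algebra of the digraph [e] on [V] has basis [e_{u,v}], [(u, v)] ranging
    over the pairs with a path from [u] to [v]; an element is given by its
    coordinates. The vertex [x0] only witnesses that the algebra is not zero, as
    [algType] requires. *)

Definition digraph_alg (K : fieldType) (V : finType) (e : rel V) (x0 : V) : Type :=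
  {ffun {p : V * V | connect e p.1 p.2} -> K^o}.

Section DigraphAlgebra.
Local Open Scope ring_scope.
Variables (K : fieldType) (V : finType) (e : rel V) (x0 : V).
Local Notation D := (digraph_alg K e x0).
Implicit Types f g h : D.

HB.instance Definition _ := GRing.Lmodule.on D.

Definition dg_coef f (u v : V) : K := if insub (u, v) is Some p then f p else 0.

Lemma dg_coefE f p : dg_coef f (val p).1 (val p).2 = f p.
Proof. by rewrite /dg_coef -surjective_pairing valK. Qed.

Lemma dg_coefP f g : (forall u v, dg_coef f u v = dg_coef g u v) -> f = g.
Proof. by move=> fg; apply/ffunP=> p; rewrite -!dg_coefE. Qed.

Lemma dg_coef_out f u v : ~~ connect e u v -> dg_coef f u v = 0.
Proof. by move=> uv; rewrite /dg_coef insubN. Qed.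

Definition dg_of (c : V -> V -> K) : D := [ffun p => c (val p).1 (val p).2].

Lemma dg_ofE c u v : dg_coef (dg_of c) u v = if connect e u v then c u v else 0.
Proof.
rewrite /dg_coef; case: insubP => [p uv puv|/negbTE-> //].
by rewrite ffunE puv ifT.
Qed.

(* The bilinear extension of e_{u,v} e_{v',t} = delta_{v,v'} e_{u,t}. *)
Definition dg_mul f g : D :=
  dg_of (fun u t => \sum_v dg_coef f u v * dg_coef g v t).

Definition dg_one : D := dg_of (fun u v => (u == v)%:R).

Lemma dg_mulE f g u t :
  dg_coef (dg_mul f g) u t = \sum_v dg_coef f u v * dg_coef g v t.
Proof.
rewrite dg_ofE; case: ifPn => // ut; rewrite big1 // => v _.
have [uv|uv] := boolP (connect e u v); last by rewrite dg_coef_out ?mul0r.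
rewrite [dg_coef g v t]dg_coef_out ?mulr0 //.
by apply: contra ut; apply: connect_trans.
Qed.

Lemma dg_oneE u v : dg_coef dg_one u v = (u == v)%:R.
Proof. by rewrite dg_ofE; case: eqVneq => [->|_]; rewrite ?connect0 ?if_same. Qed.

Lemma dg_coefD f g u v : dg_coef (f + g) u v = dg_coef f u v + dg_coef g u v.
Proof. by rewrite /dg_coef; case: insubP => [p _ _|_]; rewrite ?ffunE ?addr0. Qed.

Lemma dg_coefZ k f u v : dg_coef (k *: f) u v = k * dg_coef f u v.
Proof. by rewrite /dg_coef; case: insubP => [p _ _|_]; rewrite ?ffunE ?mulr0. Qed.

Fact dg_mulA : associative dg_mul.
Proof.
move=> f g h; apply: dg_coefP => u t; rewrite !dg_mulE.
under eq_bigr do rewrite dg_mulE big_distrr /=.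
rewrite exchange_big /=; apply: eq_bigr => v _.
by rewrite dg_mulE big_distrl /=; apply: eq_bigr => v' _; rewrite mulrA.
Qed.

Fact dg_mul1l : left_id dg_one dg_mul.
Proof.
move=> f; apply: dg_coefP => u t; rewrite dg_mulE (bigD1 u) //= dg_oneE eqxx.
by rewrite mul1r big1 ?addr0 // => v; rewrite dg_oneE eq_sym => /negbTE->; rewrite mul0r.
Qed.

Fact dg_mul1r : right_id dg_one dg_mul.
Proof.
move=> f; apply: dg_coefP => u t; rewrite dg_mulE (bigD1 t) //= dg_oneE eqxx.
by rewrite mulr1 big1 ?addr0 // => v; rewrite dg_oneE => /negbTE->; rewrite mulr0.
Qed.

Fact dg_mulDl : left_distributive dg_mul +%R.
Proof.
move=> f g h; apply: dg_coefP => u t; rewrite dg_coefD !dg_mulE -big_split /=.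
by apply: eq_bigr => v _; rewrite dg_coefD mulrDl.
Qed.

Fact dg_mulDr : right_distributive dg_mul +%R.
Proof.
move=> f g h; apply: dg_coefP => u t; rewrite dg_coefD !dg_mulE -big_split /=.
by apply: eq_bigr => v _; rewrite dg_coefD mulrDr.
Qed.

Fact dg_one_neq0 : dg_one != 0.
Proof.
apply/eqP=> /(congr1 (fun f => dg_coef f x0 x0)); rewrite dg_oneE eqxx.
by rewrite -[0](scale0r 0) dg_coefZ mul0r => /eqP; rewrite oner_eq0.
Qed.

HB.instance Definition _ := GRing.Zmodule_isNzRing.Build D
  dg_mulA dg_mul1l dg_mul1r dg_mulDl dg_mulDr dg_one_neq0.

Fact dg_scaleAl k (f g : D) : k *: (f * g) = (k *: f) * g.
Proof.
apply: dg_coefP => u t; rewrite dg_coefZ !dg_mulE big_distrr /=.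
by apply: eq_bigr => v _; rewrite dg_coefZ mulrA.
Qed.

Fact dg_scaleAr k (f g : D) : k *: (f * g) = f * (k *: g).
Proof.
apply: dg_coefP => u t; rewrite dg_coefZ !dg_mulE big_distrr /=.
by apply: eq_bigr => v _; rewrite dg_coefZ mulrCA.
Qed.

HB.instance Definition _ := GRing.Lmodule_isLalgebra.Build K D dg_scaleAl.
HB.instance Definition _ := GRing.Lalgebra_isAlgebra.Build K D dg_scaleAr.

End DigraphAlgebra.

(** The incidence algebra, with basis [e_{x,y}] for [x <= y] and arrows composed
    as maps: [e_{y,z} e_{x,y} = e_{x,z}]. In the left-to-right convention of
    [digraph_alg] this is the digraph algebra of the opposite relation. *)
Definition poset_alg (K : fieldType) (V : finType) (le : rel V) (x0 : V) :
    algType K :=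
  digraph_alg K (fun x y => le y x) x0.

(* A zero entry of the Coxeter matrix encodes an infinite bond, as x ^+ 0 = 1;
   finiteness of the group excludes it. *)
Definition coxeter_matrix (I : finType) (m : I -> I -> nat) : Prop :=
  [/\ forall i, m i i = 1%N, forall i j, m i j = m j i
    & forall i j, i != j -> m i j != 1%N].

Definition coxeter_relations (I : finType) (m : I -> I -> nat) (G : groupType)
    (f : I -> G) : Prop :=
  forall i j, ((f i * f j) ^+ m i j = 1)%g.

(* The last two fields say that the group is presented by the s_i subject to the
   Coxeter relations. *)
Record coxeterSystem := CoxeterSystem {
  cox_group :> finGroupType;
  cox_index : finType;
  cox_gen : cox_index -> cox_group;
  cox_matrix : cox_index -> cox_index -> nat;
  cox_matrixP : coxeter_matrix cox_matrix;
  cox_genP : <<[set cox_gen i | i : cox_index]>>%g = [set: cox_group];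
  cox_relP : coxeter_relations cox_matrix cox_gen;
  cox_presP : forall (G : groupType) (f : cox_index -> G),
    coxeter_relations cox_matrix f ->
    exists2 phi : cox_group -> G,
      {morph phi : x y / (x * y)%g} & forall i, phi (cox_gen i) = f i
}.

Notation "''s_' i" := (cox_gen i) (at level 8, i at level 2, format "''s_' i").

Section CoxeterCombinatorics.
Local Open Scope group_scope.
Variable C : coxeterSystem.
Local Notation I := (cox_index C).
Implicit Types (u v w x y : C) (i j : I) (J : {set I}).

Definition has_word w : pred nat :=
  [pred n | [exists r : n.-tuple I, \prod_(i <- r) 's_i == w]].

Lemma has_word_ex w : exists n, has_word w n.
Proof.
have /gen_prodgP[n [c Ac ->]] : w \in <<[set 's_i | i : I]>> by rewrite cox_genP inE.
have Ac' k : exists i, c k == 's_i by have /imsetP[i _ ->] := Ac k; exists i.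
exists n; apply/existsP; exists [tuple xchoose (Ac' k) | k < n].
rewrite big_tuple; apply/eqP/eq_bigr => k _.
by rewrite tnth_mktuple -(eqP (xchooseP (Ac' k))).
Qed.

Definition ell w : nat := ex_minn (has_word_ex w).

Lemma ell1 : ell 1 = 0%N.
Proof.
rewrite /ell; case: ex_minnP => n _ /(_ 0%N); rewrite leqn0 => le0; apply/eqP/le0.
by apply/existsP; exists [tuple]; rewrite big_nil.
Qed.

Definition right_descent w i : bool := (ell (w * 's_i) < ell w)%N.
Definition left_descent w i : bool := (ell ('s_i * w) < ell w)%N.

Definition rle u w : bool := ell w == (ell u + ell (u^-1 * w))%N.

Lemma rle1 w : rle 1 w. Proof. by rewrite /rle ell1 invg1 mul1g. Qed.

Definition parabolic J : {set C} := <<[set 's_j | j in J]>>.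

Definition reflections J : {set C} := [set 's_j ^ y | j in J, y in parabolic J].

Definition bruhat : rel C :=
  connect [rel u v | (ell u < ell v)%N && (u^-1 * v \in reflections [set: I])].

(** [w = w_J * (lquo J w)] with [w_J] in [W_J] and [lquo J w] without left
    descent in [J]. *)
Definition lquo J w : C :=
  odflt w [pick x in parabolic J :* w | [forall j in J, ~~ left_descent x j]].

Definition lpart J w : C := w * (lquo J w)^-1.

Definition left_block w J : bool :=
  [exists K : {set I}, parabolic J :* w == w *: parabolic K].

Definition in_reduced_word x j : bool :=
  [exists r : (ell x).-tuple I, (\prod_(i <- r) 's_i == x) && (j \in r)].

Definition reduced_left_block w J : bool :=
  left_block w J && [forall j in J, in_reduced_word (lpart J w) j].

Definition cut_le v w : bool := [exists J, left_block w J && (v == lquo J w)].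

Lemma cut_le_refl w : cut_le w w.
Proof.
have p0 : parabolic set0 = 1.
  by rewrite /parabolic imset0 gen0.
apply/existsP; exists set0; apply/andP; split.
  by apply/existsP; exists set0; rewrite p0 mul1g mulg1.
rewrite /lquo; case: pickP => [x|/(_ w)] /=; rewrite p0 mul1g inE.
  by case/andP => /eqP->.
by rewrite eqxx /= => /negP[]; apply/forallP=> j; rewrite inE.
Qed.

Definition cut_cover w v v' : bool :=
  [&& cut_le v v', v != v'
    & [forall x, [&& cut_le x w, cut_le v x & cut_le x v'] ==>
                 (x == v) || (x == v')]].

Definition rinterval w : finType := {u : C | rle u w}.
Definition rinterval1 w : rinterval w := exist _ 1 (rle1 w).

Definition RBL w : finType := {J : {set I} | reduced_left_block w J}.

Definition cutpoints w : finType := {v : C | cut_le v w}.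
Definition cuttop w : cutpoints w := exist _ w (cut_le_refl w).

Definition Jblock w (u : rinterval w) : {set I} :=
  odflt set0 [pick J | [&& reduced_left_block w J, rle (val u) (lquo J w)
    & [forall v, cut_le v w && rle (val u) v ==> cut_le (lquo J w) v]]].

Definition Jpairs w : {set rinterval w * rinterval w} :=
  [set p | Jblock p.1 \subset Jblock p.2].

Definition Ggraph w : rel (rinterval w) :=
  [rel u v | [exists i, val u == val v * 's_i] && (Jblock u \subset Jblock v)].

End CoxeterCombinatorics.

Section BiHecke.
Local Open Scope ring_scope.
Variables (C : coxeterSystem) (K : fieldType) (w : C).
Local Notation I := (cox_index C).
Implicit Types (i j : I) (J : {set I}).

Definition transmod : Type := {ffun rinterval w -> K^o}.
HB.instance Definition _ := Vector.on transmod.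

(* The basis vector x if x is in the interval, and 0 otherwise. *)
Definition tvec (x : C) : transmod := [ffun u => (val u == x)%:R].

Definition transEnd : Type := 'End(transmod).
HB.instance Definition _ := Vector.on transEnd.

Lemma transmod_proper : (0 < dim transmod)%N.
Proof.
rewrite -[dim _]/(#|rinterval w| * 1)%N muln1.
by apply/card_gt0P; exists (rinterval1 w).
Qed.

(* In this ring structure the product f * g is f followed by g, as befits
   operators acting on the right. *)
HB.instance Definition _ :=
  GRing.Algebra.copy transEnd (lfun_algType transmod_proper).
HB.instance Definition _ := Algebra_isFalgebra.Build K transEnd.

Definition basis_op (g : C -> transmod) : transEnd :=
  linfun (fun x : transmod => \sum_u x u *: g (val u)).

Definition pi_op i : transEnd :=
  basis_op (fun u => if right_descent u i then tvec u else tvec (u * 's_i)%g).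

Definition pibar_op i : transEnd :=
  basis_op (fun u => if right_descent u i then tvec (u * 's_i)%g
                     else if rle (u * 's_i)%g w then tvec u else 0).

Definition s_op i : transEnd := pi_op i + pibar_op i - 1.

Definition biHecke : {aspace transEnd} :=
  <<<<[seq pi_op i | i : I] ++ [seq pibar_op i | i : I]>>>>%AS.

Definition HW : falgType K := subvs_of biHecke.

Definition biHecke_monoid (f : transEnd) : Prop :=
  exists2 r : seq transEnd,
    {subset r <= [seq pi_op i | i : I] ++ [seq pibar_op i | i : I]
                 ++ [seq s_op i | i : I]}
    & f = \prod_(g <- r) g.

(* The fibre and the image of an f sending each u to 0 or to plus or minus
   some v. *)
Definition op_fiber (f : transEnd) (v : rinterval w) : {set rinterval w} :=
  [set u | ((f : 'End(transmod)) (tvec (val u)) == tvec (val v))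
        || ((f : 'End(transmod)) (tvec (val u)) == - tvec (val v))].

Definition op_im (f : transEnd) : {set rinterval w} :=
  [set v | op_fiber f v != set0].

Definition triangular (f : transEnd) (u v : rinterval w) : Prop :=
  [set x in op_im f | [forall y in op_im f, bruhat (val y) (val x) ==> (y == x)]]
    = [set v] /\
  [set x in op_fiber f v |
    [forall y in op_fiber f v, bruhat (val x) (val y) ==> (y == x)]]
    = [set u].

Definition left_op (t : C) : 'End(transmod) :=
  basis_op (fun u => if rle (t * u)%g w then tvec (t * u)%g else - tvec u).

(** Antisymmetry is imposed for all the reflections of [W_J], not only for the
    [s_j], [j \in J]: the partial operators [left_op 's_j] do not generate the
    [left_op t], and alone they do not cut out a submodule. For [w = s_1 s_2] in
    the symmetric group on three letters and [J = {1, 2}], the vector [1 - s_1]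
    is killed by [left_op 's_j + 1] for both [j], but [pibar_op 2] sends it to
    [- s_1], which is not. *)
Definition antisym J : {vspace transmod} :=
  (\bigcap_(t in reflections J) lker (left_op t + \1%VF)%R)%VS.

Definition transmodR : Type := transmod.
HB.instance Definition _ := GRing.Zmodule.copy transmodR transmod.

Definition transmod_act (a : HW^c) (x : transmodR) : transmodR :=
  (vsval (a : HW) : 'End(transmod)) x.

Fact transmod_actA a b x :
  transmod_act a (transmod_act b x) = transmod_act (a * b) x.
Proof. by rewrite /transmod_act -comp_lfunE. Qed.

Fact transmod_act1 : left_id 1 transmod_act.
Proof.
have /eqP id1 : algid biHecke == 1 by rewrite algid_eq1 memvE sub1_agenv.
by move=> x; rewrite /transmod_act -[vsval _]/(algid biHecke) id1 id_lfunE.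
Qed.

Fact transmod_actDr : right_distributive transmod_act +%R.
Proof. by move=> a x y; rewrite /transmod_act linearD. Qed.

Fact transmod_actDl x : {morph transmod_act^~ x : a b / a + b}.
Proof. by move=> a b; rewrite /transmod_act linearD /= add_lfunE. Qed.

HB.instance Definition _ := GRing.Zmodule_isLmodule.Build HW^c transmodR
  transmod_actA transmod_act1 transmod_actDr transmod_actDl.

Definition Ppred (J : RBL w) : {pred transmodR} :=
  [pred x : transmodR | (x : transmod) \in antisym (val J)].

Hypothesis hP : forall J : RBL w, submod_closed (Ppred J).

Definition Pmod (J : RBL w) : lmodType HW^c := submod (hP J).

Definition Psum (J : RBL w) : {vspace transmod} :=
  (\sum_(J' : RBL w | val J \proper val J') antisym (val J'))%VS.

Definition Spred (J : RBL w) : {pred Pmod J} :=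
  [pred x : Pmod J | (val x : transmod) \in Psum J].

Lemma Psum_act (J : RBL w) (a : HW^c) (x : transmod) :
  x \in Psum J -> (transmod_act a x : transmod) \in Psum J.
Proof.
move=> xP; rewrite -[transmod_act a x]/((vsval (a : HW) : 'End(transmod)) x).
have /subvP : ((vsval (a : HW) : 'End(transmod)) @: Psum J <= Psum J)%VS.
  rewrite limg_sum; apply/subv_sumP => J' JJ'.
  apply: subv_trans (sumv_sup J' JJ' (subvv _)).
  apply/subvP => _ /memv_imgP[y yP ->].
  have [P0 Plin] := hP J'.
  have := Plin a y 0; rewrite addr0; apply=> //.
by apply; apply: memv_img.
Qed.

Fact Spred_closed (J : RBL w) : submod_closed (@Spred J).
Proof.
split=> [|a x y xS yS]; first exact: mem0v.
apply: memvD; [exact: Psum_act | exact: yS].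
Qed.

Definition Smod (J : RBL w) : lmodType HW^c := quotmod (@Spred_closed J).

End BiHecke.

Arguments Ppred {C} K {w} J.
Arguments Ggraph {C} w.

(* Main.v *)
Require Import Defs.
From HB Require Import structures.
From mathcomp Require Import all_boot all_order all_fingroup all_algebra all_field.
From mathcomp Require Import all_solvable boolp zify ring.
From mathcomp Require classical_sets.

Set Implicit Arguments.
Unset Strict Implicit.
Unset Printing Implicit Defensive.

Import GRing.Theory.
Local Open Scope ring_scope.

(** Write [J(u)] for [Jblock u]. The reduced left blocks are closed under union,
    so [J <= J(u)] iff [u] lies below the cutting point of [J]. If [r] is a
    reduced word of [m], the product of the [pibar] along [rev r] and of the [pi]
    along [r] is [(m, m)]-triangular, and triangular elements compose. Multiplying
    such products by one more generator, or by a [pibar] conjugated by a word in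
    the [s_i], moves [u] up to the cutting point of [J(u)] and then down to any
    [v] below it; so there is an [(u, v)]-triangular element as soon as
    [J(u) <= J(v)], and triangularity makes these elements linearly independent.

    The antisymmetric vectors [b_u], supported on [W_{J(u)} u], are a basis of
    the module adapted to all the [P_J] at once: the [b_u] with [J <= J(u)] span
    [P_J]. The stabiliser of the [P_J] thus consists of the matrices supported on
    the pairs with [J(u) <= J(v)]. It contains the algebra, and the triangular
    elements already fill its dimension. This is the digraph algebra of the
    preorder [J(u) <= J(v)], for which (3)-(6) are general facts: its
    projectives, simples and radical layers are read off matrix units, and
    cutting down by the idempotent of one vertex per class is a Morita
    equivalence with the incidence algebra of the quotient poset. *)

(** * The generators are pairwise distinct *)

(** The record [coxeterSystem] supplies only a presentation. Distinctness of the generators and the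
    exchange property are therefore extracted from its universal property, by a representation over
    a finite field and by a cocycle with values in signs. From there on, weak order is inclusion of
    inversion sets ([rleE]), and most facts about blocks become facts about which inversions lie in
    [W_J].

    The hard step is the climb from [u] to a cutting point. Let [m] be a longest reachable element
    above [u], and let [B] index the ascents of [m] that normalise its right inversion set.
    Multiplying by these keeps [m] as a suffix, which is what defeats the direct construction of a
    triangular element. If [w] lies in [m W_B], then [m] is a cutting point. Otherwise the interval
    contains some [m a s_k] with [a] in [W_B] and [k] outside [B]; a shortest such [a] yields a
    triangular element from [m] to a longer element, against the choice of [m].

    No finiteness is imposed on the modules, so the classification of indecomposable projectives
    rests on Zorn's lemma. *)

Lemma exists_finField_prim_root (N : nat) : (0 < N)%N ->
  exists (F : finFieldType) (z : F), N.-primitive_root z /\ (- 1 != 1 :> F).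
Proof.
(* A prime above [N + 2] is prime to [N] and odd. By Euler's theorem [N] divides
   [p ^ totient N - 1], so the field with [p ^ totient N] elements contains a primitive [N]-th root
   of unity. *)
move=> N_gt0; have [p ltp prp] := prime_above N.+2.
have k_gt0 : (0 < totient N)%N by rewrite totient_gt0.
have [F charF cardF] := pPrimePowerField prp k_gt0.
have coNp : coprime p N.
  rewrite prime_coprime //; apply/negP => /(dvdn_leq N_gt0); lia.
have dvN : (N %| #|F|.-1)%N.
  rewrite cardF -subn1 -eqn_mod_dvd ?expn_gt0 ?prime_gt0 //.
  by apply/eqP; apply: Euler_exp_totient.
have F1 : (0 < #|F|.-1)%N.
  have : (1 < #|F|)%N by rewrite cardF -{1}(expn0 p) ltn_exp2l ?prime_gt1.
  by case: #|F| => [|[]].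
have /hasP[z _ zP] : has #|F|.-1.-primitive_root (enum [pred x : F | x != 0]).
  apply: has_prim_root => //; last 2 first.
  - exact: enum_uniq.
  - by rewrite -cardE; have := cardC1 (0 : F) => /= ->.
  apply/allP => x; rewrite mem_enum inE => x0; rewrite unity_rootE.
  apply/eqP/(mulfI x0); rewrite mulr1 -exprS prednK ?expf_card //.
  exact: leq_trans F1 (leq_pred _).
exists F, (z ^+ (#|F|.-1 %/ N)); split; first exact: dvdn_prim_root.
rewrite -subr_eq0 -opprD oppr_eq0 -(natrD _ 1 1) -(dvdn_pcharf charF).
by apply/negP => /dvdn_leq; lia.
Qed.

(** Measured from the fixed point [r / (1 - theta)], the recursion is multiplication by [theta]. *)
Lemma affine_iter_periodic (F : fieldType) (theta r : F) (m : nat) (u : nat -> F) :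
    theta ^+ m = 1 -> theta != 1 -> (forall n, u n.+1 = theta * u n + r) ->
  u m = u 0%N.
Proof.
move=> thm th1 urec; have d0 : 1 - theta != 0 by rewrite subr_eq0 eq_sym.
pose c := r / (1 - theta).
have rE : r = c - theta * c by rewrite /c; field.
suff E n : u n - c = theta ^+ n * (u 0%N - c).
  by have := E m; rewrite thm mul1r => /addIr.
elim: n => [|n IH]; first by rewrite expr0 mul1r.
by rewrite urec exprS -mulrA -IH rE; ring.
Qed.

Section GeometricRepresentation.
Variables (F : finFieldType) (I : finType) (a : I -> I -> F).
Local Notation V := {ffun I -> F}.

(** The simple reflection of the geometric representation with Cartan matrix [a], in coordinates:
    [v k] becomes [v k - \sum_j a k j * v j], the diagonal entry [a k k] being read as 2. *)
Definition refl_fun (k : I) (v : V) : V :=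
  [ffun l => if l == k then - v k - \sum_(j | j != k) a k j * v j else v l].

Lemma refl_funK k : involutive (refl_fun k).
Proof.
move=> v; apply/ffunP => l; rewrite !ffunE; case: eqP => [->|_]; last by [].
rewrite eqxx; set S := (X in - v k - X); set S' := (X in _ - X).
suff -> : S' = S by ring.
by apply: eq_bigr => j /negbTE jk; rewrite ffunE jk.
Qed.

Definition refl_perm k : {perm V} := perm (can_inj (refl_funK k)).

Lemma refl_permE k v l : refl_perm k v l =
  if l == k then - v k - \sum_(j | j != k) a k j * v j else v l.
Proof. by rewrite permE ffunE. Qed.

Section Pair.
Variables (k l : I) (c : F).
Hypotheses (kl : k != l) (akl : a k l = - c) (alk : a l k = - c).
Local Notation g := (refl_perm k * refl_perm l)%g.

(** Both reflections of the pair fix the coordinates that enter here, so this is constant along an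
    orbit of [g], and [g] acts on the two coordinates [k] and [l] as an affine map. *)
Definition pair_const (k l : I) (v : V) := \sum_(j | (j != k) && (j != l)) a k j * v j.

Lemma refl_pair v :
  [/\ g v k = - v k + c * v l - pair_const k l v,
      g v l = - v l + c * g v k - pair_const l k v
    & forall j, j != k -> j != l -> g v j = v j].
Proof.
have gk : g v k = - v k + c * v l - pair_const k l v.
  rewrite permM refl_permE (negbTE kl) refl_permE eqxx (bigD1 l) 1?eq_sym //=.
  by rewrite akl /pair_const; ring.
split=> //; last first.
  by move=> j jk jl; rewrite permM refl_permE (negbTE jl) refl_permE (negbTE jk).
rewrite permM refl_permE eqxx (bigD1 k) //= alk.
rewrite [refl_perm l _ k]refl_permE (negbTE kl).
rewrite [X in - X]refl_permE eq_sym (negbTE kl).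
set S := \sum_(_ | _) _; suff -> : S = pair_const l k v by ring.
by apply: eq_bigr => j /andP[_ /negbTE jk]; rewrite refl_permE jk.
Qed.

Lemma pair_const_iter n v :
  pair_const k l (iter n g v) = pair_const k l v /\
  pair_const l k (iter n g v) = pair_const l k v.
Proof.
have E j : j != k -> j != l -> iter n g v j = v j.
  move=> jk jl; elim: n => //= n IH.
  by have [_ _ ->] := refl_pair (iter n g v).
by split; apply: eq_bigr => j /andP[? ?]; rewrite E.
Qed.

(** With vanishing off-diagonal entries the two reflections commute. The relation then holds for
    every even [m]; the exact order of the product is irrelevant for telling generators apart. *)
Lemma refl_pair_even m : c = 0 -> ~~ odd m -> (g ^+ m)%g = 1%g.
Proof.
move=> c0 evm; have g2 : (g ^+ 2)%g = 1%g.
  apply/permP => v; rewrite permX perm1; apply/ffunP => j.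
  have [gk gl gj] := refl_pair v.
  have [hk hl hj] := refl_pair (g v).
  have [E1 E2] := pair_const_iter 1 v; rewrite /= in E1 E2.
  case: (eqVneq j k) => [->|jk]; first by rewrite /= hk E1 gk c0; ring.
  case: (eqVneq j l) => [->|jl]; first by rewrite /= hl E2 gl c0; ring.
  by rewrite /= hj // gj.
by rewrite -(odd_double_half m) (negbTE evm) -mul2n expgM g2 expg1n.
Qed.

(* With theta = eta^-2, the two functionals v_l - eta v_k and v_l - eta^-1 v_k
   are eigenfunctionals of g up to additive constants. *)
Lemma refl_pair_odd m eta : c = eta + eta^-1 ->
  eta ^+ m = 1 -> eta ^+ 2 != 1 -> eta != 0 -> (g ^+ m)%g = 1%g.
Proof.
move=> cE etam eta2 eta0; apply/permP => v; rewrite permX perm1; apply/ffunP => j.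
pose w eta n := iter n g v l - eta * iter n g v k.
have wper e : c = e + e^-1 -> e ^+ m = 1 -> e ^+ 2 != 1 -> e != 0 -> w e m = w e 0%N.
  move=> ce em e2 e0.
  apply: (affine_iter_periodic (theta := (e^-1) ^+ 2)
     (r := - e^-1 * pair_const k l v - pair_const l k v)).
  - by rewrite -exprM mulnC exprM exprVn em invr1 expr1n.
  - by rewrite exprVn invr_eq1.
  move=> n; rewrite /w /=; have [-> -> _] := refl_pair (iter n g v).
  have [-> ->] := pair_const_iter n v.
  by rewrite ce; field.
have W1 : w eta m = w eta 0%N by apply: wper.
have W2 : w eta^-1 m = w eta^-1 0%N.
  apply: wper; rewrite ?invr_eq0 // ?invrK 1?addrC // exprVn.
    by rewrite etam invr1.
  by rewrite invr_eq1.
have Ek : iter m g v k = v k.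
  have d0 : eta - eta^-1 != 0.
    apply: contra eta2 => /eqP d; apply/eqP.
    by rewrite expr2 -[X in _ * X]subr0 -d; field.
  apply: (mulfI d0); move: W1 W2; rewrite /w /= => W1 W2.
  transitivity (w eta^-1 m - w eta m); first by rewrite /w; ring.
  by rewrite /w W1 W2 /w /=; ring.
case: (eqVneq j k) => [->|jk]; first by [].

case: (eqVneq j l) => [->|jl].
  by apply/(addIr (- (eta * v k))); rewrite -{1}Ek; exact: W1.
elim: (X in iter X) => // n IH; rewrite iterS.
by have [_ _ E] := refl_pair (iter n g v); rewrite E.
Qed.

End Pair.
End GeometricRepresentation.

Section Injectivity.
Variable C : coxeterSystem.
Local Notation I := (cox_index C).
Local Notation m := (@cox_matrix C).

(* In the geometric representation over a finite field with enough roots of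
   unity, distinct generators act as distinct reflections. *)
Lemma cox_gen_inj : injective (@cox_gen C).
Proof.
have [m1 mC _] := @cox_matrixP C.
(* A common multiple of the finite bonds, so that powers of the single root [z] provide primitive
   roots of every order [m k l] required. *)
pose N := (\prod_(p : I * I | m p.1 p.2 != 0%N) m p.1 p.2)%N.
have N_gt0 : (0 < N)%N by rewrite prodn_cond_gt0 // => p; rewrite lt0n.
have [F [z [zN F2]]] := exists_finField_prim_root N_gt0.
pose eta (k : nat) := z ^+ (N %/ k).
(* For an odd bond [n] the entry is the analogue of [-2 cos(2 pi / n)]; the product of the two
   reflections has eigenvalues [eta^2] and [eta^-2], again of order [n]. Even bonds, and the code 0
   for an infinite bond, get the entry 0. *)
pose a (k l : I) : F := let n := m k l in
  if odd n then - (eta n + (eta n)^-1) else 0.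
have rel : coxeter_relations m (fun k => refl_perm a k : {perm {ffun I -> F}}).
  move=> k l; have [<-|kl] := eqVneq k l.
    rewrite m1 expg1; apply/permP => v; rewrite permM perm1.
    by rewrite !permE /= refl_funK.
  have [od|ev] := boolP (odd (m k l)); last first.
    apply: (@refl_pair_even F I a k l 0) => //.
      by rewrite /a (negbTE ev) oppr0.
    by rewrite /a mC (negbTE ev) oppr0.
  have m_gt0 : (0 < m k l)%N by case: (m k l) od.
  have prim : (m k l).-primitive_root (eta (m k l)).
    apply: dvdn_prim_root => //.
    by rewrite /N (bigD1 (k, l)) /= ?dvdn_mulr // -lt0n.
  apply: (@refl_pair_odd F I a k l (eta (m k l) + (eta (m k l))^-1)
            _ _ _ _ (eta (m k l))) => //.
  - by rewrite /a od.
  - by rewrite /a mC od.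
  - exact: prim_expr_order.
  - rewrite -(prim_order_dvd prim); apply/negP => /dvdn_leq => /(_ isT) le2.
    have [_ _ mN1] := @cox_matrixP C; have := mN1 k l kl.
    by move: le2 od m_gt0; case: (m k l) => [|[|[]]].
  - apply/eqP => e0; have := prim_expr_order prim.
    by rewrite e0 expr0n gtn_eqF // => /eqP; rewrite eq_sym oner_eq0.
have [phi phiM phiE] := @cox_presP C _ _ rel.
move=> i j ij; apply/eqP/negPn/negP => nij.
(* The test vector is the basis vector at [i]: its coordinate [i] becomes -1 under the reflection of
   [i] and stays 1 under that of [j]. *)
have /(congr1 (fun p : {perm {ffun I -> F}} => p [ffun k => (k == i)%:R] i)) :
  refl_perm a i = refl_perm a j by rewrite -!phiE ij.
rewrite !refl_permE eqxx (negbTE nij) ffunE eqxx big1 => [|k ki].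
  by move/eqP; rewrite subr0 (negbTE F2).
by rewrite ffunE (negbTE ki) mulr0.
Qed.

End Injectivity.

(** * Inversion sets *)

Section Inversions.
Local Open Scope group_scope.
Variable C : coxeterSystem.
Local Notation I := (cox_index C).
Implicit Types (u v w x y t : C) (i j k : I) (J : {set I}) (r : seq I).

Lemma cox_genK i : 's_i * 's_i = 1 :> C.
Proof. by have [m1 _ _] := @cox_matrixP C; have := @cox_relP C i i; rewrite m1 expg1. Qed.

Lemma cox_genV i : ('s_i)^-1 = 's_i :> C.
Proof. by apply/eqP; rewrite eq_invg_mul cox_genK. Qed.

Definition wprod r : C := \prod_(i <- r) 's_i.

Lemma wprod_nil : wprod [::] = 1. Proof. exact: big_nil. Qed.
Lemma wprod_cons i r : wprod (i :: r) = 's_i * wprod r. Proof. exact: big_cons. Qed.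
Lemma wprod_cat r r' : wprod (r ++ r') = wprod r * wprod r'.
Proof. exact: big_cat. Qed.
Lemma wprod_seq1 i : wprod [:: i] = 's_i. Proof. exact: big_seq1. Qed.
Lemma wprod_rcons r i : wprod (rcons r i) = wprod r * 's_i.
Proof. by rewrite -cats1 wprod_cat wprod_seq1. Qed.
Lemma wprod_rev r : wprod (rev r) = (wprod r)^-1.
Proof.
elim: r => [|i r IH]; first by rewrite wprod_nil invg1.
by rewrite rev_cons wprod_rcons wprod_cons invMg IH cox_genV.
Qed.

Lemma ell_wprod r : (ell (wprod r) <= size r)%N.
Proof.
rewrite /ell; case: ex_minnP => n _; apply.
by apply/existsP; exists (in_tuple r); apply/eqP.
Qed.

Lemma ell_word w : exists2 r, wprod r = w & size r = ell w.
Proof.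
rewrite /ell; case: ex_minnP => n /existsP[r /eqP rw] _.
by exists r; rewrite ?size_tuple.
Qed.

Lemma ell_eq0 w : (ell w == 0%N) = (w == 1).
Proof.
apply/eqP/eqP => [w0|->]; last exact: ell1.
by have [r rw] := ell_word w; rewrite w0 => /size0nil r0; rewrite -rw r0; exact: wprod_nil.
Qed.

Lemma ell_mul u v : (ell (u * v) <= ell u + ell v)%N.
Proof.
have [r <- <-] := ell_word u; have [r' <- <-] := ell_word v.
by rewrite -wprod_cat -size_cat ell_wprod.
Qed.

Lemma ellV w : ell w^-1 = ell w.
Proof.
have le x : (ell x^-1 <= ell x)%N.
  by have [r <- <-] := ell_word x; rewrite -wprod_rev -(size_rev r) ell_wprod.
by apply/eqP; rewrite eqn_leq le -{1}(invgK w) le.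
Qed.

(** The classical permutation action on pairs (reflection, sign), here extended to all of [C]. The
    sign flips each time a letter of the word meets the current conjugate of [t]. *)
Definition cocycle_fun i (p : C * bool) : C * bool :=
  (p.1 ^ 's_i, p.2 (+) (p.1 == 's_i)).

Lemma conjs_eq i t : (t ^ 's_i == 's_i) = (t == 's_i).
Proof. by rewrite (can2_eq (conjgK _) (conjgKV _)) /conjg invgK cox_genV mulgA cox_genK mul1g. Qed.

Lemma cocycle_funK i : involutive (cocycle_fun i).
Proof.
case=> t b; rewrite /cocycle_fun /= conjs_eq -conjgM cox_genK conjg1.
by rewrite -addbA addbb addbF.
Qed.

Definition cocycle_perm i : {perm C * bool} := perm (can_inj (cocycle_funK i)).

(* The reflections met along the word (ij)^n are the (s_i s_j)^k s_i, k < 2n;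
   for n = m_ij each is met an even number of times. *)
Lemma cocycle_iter i j n t b : let g := 's_i * 's_j in
  ((cocycle_perm i * cocycle_perm j) ^+ n) (t, b) =
  (t ^ (g ^+ n), b (+) odd (count (fun q : nat => t == g ^+ q * 's_i) (iota 0 n.*2))).
Proof.
move=> g; have gV : g^-1 = g ^ 's_i.
  by rewrite /g invMg !cox_genV /conjg cox_genV !mulgA cox_genK mul1g.
have sgn p : 's_i * g ^- p = g ^+ p * 's_i.
  by rewrite -expgVn gV -conjXg /conjg cox_genV !mulgA cox_genK mul1g.
elim: n b => [|n IH] b; first by rewrite !expg0 perm1 conjg1 addbF.
rewrite doubleS -[n.*2.+2]addn2 iotaD count_cat oddD.
rewrite expgSr permM IH permM !permE /cocycle_fun /= -!conjgM -!addbA.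
congr (_, _ (+) (_ (+) _)).
  by rewrite expgSr.
rewrite add0n addn0 oddD !oddb; congr (_ (+) _).
  rewrite (can2_eq (conjgK _) (conjgKV _)); congr (_ == _).
  by rewrite /conjg invgK mulgA -mulgA sgn mulgA -expgD addnn.
rewrite (can2_eq (conjgK _) (conjgKV _)); congr (_ == _).
rewrite /conjg invgK invMg cox_genV -!mulgA sgn -addnn expgS expgD !mulgA.
by rewrite -expgS expgSr /g !mulgA.
Qed.

Lemma cocycle_rel : coxeter_relations (@cox_matrix C) (fun i => cocycle_perm i).
Proof.
move=> i j; apply/permP => -[t b]; rewrite cocycle_iter perm1.
rewrite cox_relP conjg1 -addnn iotaD count_cat add0n.
set P := fun q : nat => _; suff -> : count P (iota (cox_matrix i j) (cox_matrix i j)) =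
  count P (iota 0 (cox_matrix i j)) by rewrite oddD addbb addbF.
rewrite -[X in iota X _]addn0 iotaDl count_map; apply: eq_count => q /=.
by rewrite /P expgD cox_relP mul1g.
Qed.

Fact invs_key : unit. Proof. by []. Qed.
(** The left inversions. The definition is locked so that [inE] and simplification do not expand
    memberships; [in_invs] unfolds it on demand. *)
Definition invs w : {set C} := locked_with invs_key
  [set t | (t \in reflections [set: I]) && (ell (t * w) < ell w)%N].

Lemma in_invs w t :
  (t \in invs w) = (t \in reflections [set: I]) && (ell (t * w) < ell w)%N.
Proof. by rewrite [invs w]unlock inE. Qed.

Lemma parabolicT : parabolic [set: I] = [set: C].
Proof.
rewrite /parabolic -cox_genP; congr <<_>>.
by apply/setP=> x; apply/imsetP/imsetP=> -[i _ ->]; exists i.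
Qed.

Lemma reflP t : reflect (exists i y, t = 's_i ^ y) (t \in reflections [set: I]).
Proof.
apply: (iffP imset2P) => [[i y _ _ ->]|[i [y ->]]]; first by exists i, y.
by exists i y; rewrite ?parabolicT ?inE.
Qed.

Lemma refl_gen i : 's_i \in reflections [set: I].
Proof. by apply/reflP; exists i, 1; rewrite conjg1. Qed.

Lemma reflJ t y : (t ^ y \in reflections [set: I]) = (t \in reflections [set: I]).
Proof.
have J u z : u \in reflections [set: I] -> u ^ z \in reflections [set: I].
  by move=> /reflP[i [x ->]]; apply/reflP; exists i, (x * z); rewrite conjgM.
by apply/idP/idP=> [/J|/J]; first by move/(_ y^-1); rewrite conjgK.
Qed.

Lemma reflK t : t \in reflections [set: I] -> t * t = 1.
Proof. by move=> /reflP[i [y ->]]; rewrite -conjMg cox_genK conj1g. Qed.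

Lemma reflV t : t \in reflections [set: I] -> t^-1 = t.
Proof. by move=> tR; apply/eqP; rewrite eq_invg_mul reflK. Qed.

Section Cocycle.
Variable eta : C -> C -> bool.
Hypothesis etaM : forall u v t, eta (u * v) t = eta u t (+) eta v (t ^ u).
Hypothesis eta_gen : forall i t, eta 's_i t = (t == 's_i).

Lemma eta1 t : eta 1 t = false.
Proof.
have := etaM 1 1 t; rewrite conjg1 mulg1.
by case: (eta 1 t).
Qed.

(** Strong exchange, by walking along the word: either [t] is the first letter, which is deleted, or
    its conjugate by that letter is met later in the word. *)
Lemma eta_deletion r t : eta (wprod r) t ->
  t \in reflections [set: I] /\
  exists r', [/\ subseq r' r, size r = (size r').+1 & t * wprod r = wprod r'].
Proof.
elim: r t => [|i r IH] t; first by rewrite wprod_nil eta1.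
rewrite wprod_cons etaM eta_gen; case: eqVneq => [-> _|ti].
  split; first exact: refl_gen.
  by exists r; split; rewrite ?subseq_cons // mulgA cox_genK mul1g.
move/IH; rewrite reflJ => -[tR [r' [sr' szr' E]]]; split=> //.
exists (i :: r'); split=> /=; rewrite ?eqxx ?szr' //.
by rewrite wprod_cons -E /conjg cox_genV !mulgA cox_genK mul1g.
Qed.

(** In [t = y^-1 s y] the contributions of [y^-1] and [y] cancel because [eta 1] vanishes; the
    middle letter contributes 1. *)
Lemma eta_refl t : t \in reflections [set: I] -> eta t t.
Proof.
move=> /reflP[i [y ->]]; set t0 := 's_i ^ y.
have E : eta 1 t0 = false := eta1 t0.
have t1 : t0 ^ y^-1 = 's_i by rewrite conjgK.
have -> : eta t0 t0 = eta (y^-1 * ('s_i * y)) t0 by [].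
rewrite !etaM t1 eta_gen eqxx /conjg mulKg.
move: E; rewrite -(mulVg y) etaM t1.
by case: (eta y^-1 t0); case: (eta y _).
Qed.

(** Deletion shows that [eta w t] forces [t * w] to be shorter. If instead [eta w t] fails, then
    [eta (t * w) t] holds, and the same argument makes [w] shorter than [t * w]. *)
Lemma eta_invs w t : eta w t = (t \in invs w).
Proof.
have lt w' t' : eta w' t' -> t' \in invs w'.
  have [r rw sr] := ell_word w'; rewrite -rw => /eta_deletion[tR [r' [_ szr E]]].
  by rewrite in_invs tR E rw -sr szr ltnS ell_wprod.
apply/idP/idP=> [/lt //|]; rewrite in_invs => /andP[tR ltt].
apply: contraLR ltt => nwt; rewrite -leqNgt ltnW //.
have : eta (t * w) t by rewrite etaM eta_refl // /conjg mulKg (negbTE nwt).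
by move/lt; rewrite in_invs mulgA reflK // mul1g => /andP[].
Qed.

End Cocycle.

(** The universal property extends the action of the generators to [C]. Each element moves the sign
    by a translation depending only on [t], and that translation is the cocycle. *)
Lemma exists_cocycle : exists2 eta : C -> C -> bool,
  forall u v t, eta (u * v) t = eta u t (+) eta v (t ^ u)
  & forall i t, eta 's_i t = (t == 's_i).
Proof.
have [phi phiM phi_gen] := cox_presP cocycle_rel.
have phi1 : phi 1 = 1 by apply: (mulgI (phi 1)); rewrite -phiM !mulg1.
have phiE w t b : phi w (t, b) = (t ^ w, b (+) (phi w (t, false)).2).
  have [r <- _] := ell_word w; elim: r t b => [|i r IH] t b.
    by rewrite wprod_nil phi1 !perm1 conjg1 addbF.
  rewrite wprod_cons phiM phi_gen !permM !permE /cocycle_fun /= IH [in RHS]IH.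
  by rewrite conjgM /= addbA.
exists (fun w t => (phi w (t, false)).2) => [u v t|i t].
  by rewrite phiM permM [phi u _]phiE phiE /=.
by rewrite phi_gen permE.
Qed.

Lemma invsM u v t : (t \in invs (u * v)) = (t \in invs u) (+) (t ^ u \in invs v).
Proof. by have [eta etaM etag] := exists_cocycle; rewrite -!(eta_invs etaM etag). Qed.

Lemma invs_gen i t : (t \in invs 's_i) = (t == 's_i).
Proof. by have [eta etaM etag] := exists_cocycle; rewrite -!(eta_invs etaM etag). Qed.

Lemma invs1 : invs 1 = set0.
Proof.
by have [eta etaM etag] := exists_cocycle; apply/setP=> t; rewrite -(eta_invs etaM etag) eta1 ?inE.
Qed.

Lemma invs_refl t : t \in reflections [set: I] -> t \in invs t.
Proof.
by have [eta etaM etag] := exists_cocycle; rewrite -(eta_invs etaM etag); apply: eta_refl.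
Qed.

Lemma deletion r t : t \in invs (wprod r) ->
  exists r', [/\ subseq r' r, size r = (size r').+1 & t * wprod r = wprod r'].
Proof.
have [eta etaM etag] := exists_cocycle; rewrite -(eta_invs etaM etag).
by case/(eta_deletion etaM etag).
Qed.

Lemma invsV w t : (t \in invs w^-1) = (t ^ w^-1 \in invs w).
Proof.
have := invsM w^-1 w t; rewrite mulVg invs1 inE.
by case: (t \in _); case: (_ \in _).
Qed.

(** Prefixing a letter [s] to a reduced word conjugates the inversions of the rest by [s] and adds
    [s] itself, which is not among them. *)
Lemma card_invs w : #|invs w| = ell w.
Proof.
move En : (ell w) => n; elim: n w En => [|n IH] w En.
  by move/eqP: En; rewrite ell_eq0 => /eqP->; rewrite invs1 cards0.
have [[|i r] rw] := ell_word w; rewrite En // => -[sr].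
rewrite wprod_cons in rw; have Er : ell (wprod r) = n.
  apply/eqP; rewrite eqn_leq -{1}sr ell_wprod /= -ltnS -En -rw.
  apply: leq_trans (ell_mul _ _) _; rewrite -add1n leq_add2r.
  by rewrite -wprod_seq1 ell_wprod.
have si : 's_i \notin invs (wprod r).
  by rewrite in_invs refl_gen rw En Er -leqNgt.
have -> : invs w = 's_i |: invs (wprod r) :^ 's_i.
  apply/setP=> t; rewrite -rw invsM invs_gen in_setU1 mem_conjg cox_genV.
  case: eqVneq => // ->.
  by rewrite /conjg mulKg (negbTE si).
by rewrite cardsU1 mem_conjg cox_genV {1}/conjg mulKg si cardJg IH.
Qed.

(** By the cocycle rule [invs (u * v)] is the symmetric difference of [invs u] and a conjugate of
    [invs v]; the doubled term counts the cancellations. *)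
Lemma ellM u v :
  (ell (u * v) + (#|invs u :&: invs v :^ u^-1|).*2 = ell u + ell v)%N.
Proof.
rewrite -!card_invs -(cardJg (invs v) u^-1); set B := _ :^ _; set A := invs u.
have -> : invs (u * v) = (A :\: B) :|: (B :\: A).
  apply/setP=> t; rewrite invsM !inE !mem_conjg invgK -/A.
  by case: (t \in A); case: (_ \in _).
rewrite cardsU; have -> : (A :\: B) :&: (B :\: A) = set0.
  by apply/setP=> t; rewrite !inE; case: (t \in A); case: (t \in B).
rewrite cards0 subn0 !cardsD (setIC B A) -addnn.
by rewrite addnACA !subnK // ?subset_leq_card ?subsetIl ?subsetIr.
Qed.

Lemma odd_ellM u v : odd (ell (u * v)) = odd (ell u) (+) odd (ell v).
Proof. by rewrite -oddD -ellM oddD odd_double addbF. Qed.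

(** Lengths add exactly when no inversion cancels in [ellM], that is, when every inversion of [u]
    survives in [w]. *)
Lemma rleE u w : rle u w = (invs u \subset invs w).
Proof.
rewrite /rle; set v := u^-1 * w; have wE : w = u * v by rewrite mulKVg.
have -> : (ell w == ell u + ell v)%N = (invs u :&: invs v :^ u^-1 == set0).
  rewrite -cards_eq0 -ellM -wE; lia.
apply/eqP/subsetP => [d t tu|sub].
  rewrite wE invsM tu; have := in_set0 t; rewrite -d inE tu mem_conjg invgK /=.
  by move=> ->.
apply/setP=> t; rewrite !inE mem_conjg invgK; apply/negP=> /andP[].
by move=> tu tv; have := sub t tu; rewrite wE invsM tu tv.
Qed.

Lemma rleM u v : rle u (u * v) = (ell (u * v) == ell u + ell v)%N.
Proof. by rewrite /rle mulKg. Qed.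

Lemma rle_refl u : rle u u. Proof. by rewrite rleE. Qed.
Lemma rle_trans u v w : rle u v -> rle v w -> rle u w.
Proof. by rewrite !rleE; apply: subset_trans. Qed.

Lemma rle_ell u w : rle u w -> (ell u <= ell w)%N.
Proof. by rewrite rleE -!card_invs; apply: subset_leq_card. Qed.

Lemma rle_eq u w : rle u w -> (ell w <= ell u)%N -> u = w.
Proof.
rewrite /rle => /eqP -> le; have : ell (u^-1 * w) == 0%N by lia.
by rewrite ell_eq0 -eq_invg_mul invgK => /eqP.
Qed.

Lemma rle_anti u w : rle u w -> rle w u -> u = w.
Proof. by move=> uw /rle_ell; apply: rle_eq. Qed.

Lemma ell_gen i : ell ('s_i : C) = 1%N.
Proof.
rewrite -card_invs -(cards1 ('s_i : C)); congr #|pred_of_set _|.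
by apply/setP=> t; rewrite invs_gen inE.
Qed.

Lemma ell_eq1 w : ell w = 1%N -> exists i, w = 's_i.
Proof.
have [[|i [|j r]] <- <-] // := ell_word w.
by exists i; rewrite wprod_seq1.
Qed.

Lemma left_descentE w i : left_descent w i = ('s_i \in invs w).
Proof. by rewrite in_invs refl_gen. Qed.

Lemma invs_ell w t : t \in invs w -> (ell (t * w) < ell w)%N.
Proof. by rewrite in_invs => /andP[]. Qed.

Lemma refl_ell_gt w t : t \in reflections [set: I] -> t \notin invs w ->
  (ell w < ell (t * w))%N.
Proof.
move=> tR nt; suff /invs_ell : t \in invs (t * w) by rewrite mulgA reflK ?mul1g.
by rewrite invsM invs_refl // /conjg mulKg (negbTE nt).
Qed.

Lemma invs_mul_gen w i t : (t \in invs (w * 's_i)) = (t \in invs w) (+) (t == 's_i ^ w^-1).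
Proof. by rewrite invsM invs_gen -(inj_eq (conjg_inj w) t) conjgKV. Qed.

Lemma right_descentV w i : right_descent w i = ('s_i \in invs w^-1).
Proof.
by rewrite in_invs refl_gen ellV /right_descent -ellV invMg cox_genV.
Qed.

Lemma right_descentE w i : right_descent w i = ('s_i ^ w^-1 \in invs w).
Proof. by rewrite right_descentV invsV. Qed.

Lemma mul_genK w i : w * 's_i * 's_i = w.
Proof. by rewrite -mulgA cox_genK mulg1. Qed.

Lemma right_descentM w i : right_descent (w * 's_i) i = ~~ right_descent w i.
Proof.
by rewrite !right_descentV invMg cox_genV invsM invs_gen eqxx /conjg mulKg.
Qed.

Lemma ell_desc w i : right_descent w i -> ell w = (ell (w * 's_i)).+1.
Proof.
move=> d; have lt : (ell (w * 's_i) < ell w)%N := d.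
have := ell_mul (w * 's_i) 's_i; rewrite mul_genK ell_gen; lia.
Qed.

Lemma ell_asc w i : ~~ right_descent w i -> ell (w * 's_i) = (ell w).+1.
Proof. by rewrite -right_descentM => /ell_desc; rewrite mul_genK. Qed.

Lemma rle_asc w i : rle w (w * 's_i) = ~~ right_descent w i.
Proof.
rewrite rleM ell_gen; case: (boolP (right_descent w i)) => [/ell_desc|/ell_asc]; lia.
Qed.

Lemma rle_desc w i : right_descent w i -> rle (w * 's_i) w.
Proof. by move=> d; rewrite -{2}(mul_genK w i) rle_asc right_descentM d. Qed.

Lemma rle_word_split u w : rle u w -> u != w ->
  exists2 i, ~~ right_descent u i & rle (u * 's_i) w.
Proof.
move=> uw nuw; have [[|i r] rw sr] := ell_word (u^-1 * w).
  by case/eqP: nuw; move: rw; rewrite wprod_nil => /esym/eqP; rewrite -eq_invg_mul invgK => /eqP.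
have E : w = u * 's_i * wprod r by rewrite -mulgA -wprod_cons rw mulKVg.
have l1 := ell_mul (u * 's_i) (wprod r); rewrite -E in l1.
have l2 := ell_wprod r; have l3 := ell_mul u 's_i; rewrite ell_gen in l3.
have /eqP lw : ell w == (ell u + (size r).+1)%N by rewrite -[_.+1]/(size (i :: r)) sr.
exists i; first by rewrite -rle_asc rleM ell_gen; lia.
by rewrite E rleM -E; lia.
Qed.

(** * Bruhat order *)

Definition bstep u v := (ell u < ell v)%N && (u^-1 * v \in reflections [set: I]).

Lemma bruhat_refl u : bruhat u u. Proof. exact: connect0. Qed.
Lemma bruhat_trans v u w : bruhat u v -> bruhat v w -> bruhat u w.
Proof. exact: connect_trans. Qed.
Lemma bruhat_step u v : bstep u v -> bruhat u v.
Proof. exact: connect1. Qed.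

Lemma bruhat_ind (P : C -> C -> Prop) :
  (forall u, P u u) -> (forall u v w, bstep u v -> P v w -> P u w) ->
  forall u v, bruhat u v -> P u v.
Proof.
move=> P0 PS u v /connectP[p]; elim: p u => [|x p IH] u /=; first by move=> _ ->.
by case/andP=> ux /IH{}IH /IH; apply: PS.
Qed.

Lemma bruhat_ell u v : bruhat u v -> u = v \/ (ell u < ell v)%N.
Proof.
move: u v; apply: bruhat_ind => [u|u v w /andP[uv _] [<-|vw]]; first by left.
  by right.
by right; apply: ltn_trans vw.
Qed.

Lemma bruhat_anti_ell u v : bruhat u v -> (ell v <= ell u)%N -> u = v.
Proof. by case/bruhat_ell => // lt; rewrite leqNgt lt. Qed.

Lemma bstep_asc u i : ~~ right_descent u i -> bstep u (u * 's_i).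
Proof. by move=> d; rewrite /bstep (ell_asc d) ltnSn mulKg refl_gen. Qed.

Lemma bstep_desc u i : right_descent u i -> bstep (u * 's_i) u.
Proof. by move=> d; rewrite -{2}(mul_genK u i) bstep_asc // right_descentM d. Qed.

Lemma refl_ell_right_neq x t : t \in reflections [set: I] -> ell (x * t) != ell x.
Proof.
move=> tR; have -> : x * t = t ^ x^-1 * x by rewrite /conjg invgK mulgA mulgKV.
have [/invs_ell lt|] := boolP (t ^ x^-1 \in invs x); first by rewrite neq_ltn lt.
by move=> nt; rewrite neq_ltn orbC refl_ell_gt ?reflJ.
Qed.

Lemma in_invsV x t : t \in reflections [set: I] ->
  (t \in invs x^-1) = (ell (x * t) < ell x)%N.
Proof. by move=> tR; rewrite in_invs tR ellV -{1}(reflV tR) -invMg ellV. Qed.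

(** The lifting property for one reflection. Right multiplication by [s_i] conjugates the reflection
    [u^-1 * v], and it can spoil the comparison of lengths only if that reflection is [s_i]
    itself. *)
Lemma bstep_mul_gen u v i : bstep u v -> u * 's_i = v \/ bstep (u * 's_i) (v * 's_i).
Proof.
case/andP=> lt tR; set t := u^-1 * v in tR.
have vE : v = u * t by rewrite mulKVg.
have conjE : (u * 's_i)^-1 * (v * 's_i) = t ^ 's_i.
  by rewrite invMg /t /conjg !mulgA.
have [le|gt] := ltnP (ell (u * 's_i)) (ell (v * 's_i)).
  by right; rewrite /bstep le conjE reflJ.
left; have t'R : t ^ 's_i \in reflections [set: I] by rewrite reflJ.
have E' : v * 's_i = u * 's_i * (t ^ 's_i) by rewrite -conjE mulKVg.
have := refl_ell_right_neq (u * 's_i) t'R; rewrite -E' => ne.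
have nt' : t ^ 's_i \notin invs (v * 's_i)^-1.
  by rewrite in_invsV // {1}E' -mulgA reflK // mulg1 -leqNgt.
have : t \in invs v^-1.
  by rewrite in_invsV // {1}vE -mulgA reflK // mulg1.
rewrite -{1}(mul_genK v i) invMg invsM cox_genV invs_gen (negbTE nt') addbF.
by move=> /eqP ti; rewrite vE ti.
Qed.

(** [upi] and [downi] are the longer and the shorter element of the coset of [w] modulo [s_i]: the
    actions of [pi_i] and [pibar_i] before truncation to the interval. *)
Definition upi w i := if right_descent w i then w else w * 's_i.
Definition downi w i := if right_descent w i then w * 's_i else w.

Lemma bruhat_upi u i : bruhat u (upi u i).
Proof.
rewrite /upi; case: ifPn => [_|d]; first exact: bruhat_refl.
exact/bruhat_step/bstep_asc.
Qed.

Lemma bruhat_downi u i : bruhat (downi u i) u.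
Proof.
rewrite /downi; case: ifPn => [d|_]; last exact: bruhat_refl.
exact/bruhat_step/bstep_desc.
Qed.

Lemma upi_mono u v i : bruhat u v -> bruhat (upi u i) (upi v i).
Proof.
move: u v; apply: bruhat_ind => [u|u v w uv]; first exact: bruhat_refl.
apply: bruhat_trans; have := bruhat_upi v i; have {}vv := bruhat_step uv.
rewrite {2}/upi; case: ifP => [_|d]; first by move=> h; apply: bruhat_trans h.
move=> h; have [->//|st] := bstep_mul_gen i uv.
apply: bruhat_trans (bruhat_step st) _; rewrite /upi.
by case: ifPn => dv; [apply: bruhat_step; apply: bstep_desc | apply: bruhat_refl].
Qed.

Lemma downi_mono u v i : bruhat u v -> bruhat (downi u i) (downi v i).
Proof.
move: u v; apply: bruhat_ind => [u|u v w uv]; first exact: bruhat_refl.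
apply: bruhat_trans; have := bruhat_downi u i; have {}vv := bruhat_step uv.
rewrite {3}/downi; case: ifPn => [dv h|_ h]; last exact: bruhat_trans h vv.
have [E|st] := bstep_mul_gen i uv.
  by rewrite -E mul_genK.
rewrite /downi; case: ifPn => du; first exact: bruhat_step.
exact: bruhat_trans (bruhat_step (bstep_asc du)) (bruhat_step st).
Qed.

Lemma upi_downi u i : upi (downi u i) i = upi u i.
Proof.
by rewrite /downi; case: ifPn => // d; rewrite /upi right_descentM d /= mul_genK.
Qed.

Lemma bruhat1 u : bruhat 1 u.
Proof.
have [r <- _] := ell_word u; elim/last_ind: r => [|r i IH].
  by rewrite wprod_nil; apply: bruhat_refl.
rewrite wprod_rcons; have <- : downi 1 i = 1.
  by rewrite /downi /right_descent ell1 ltn0.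
have [d|d] := boolP (right_descent (wprod r) i).
  have := downi_mono i IH; by rewrite {2}/downi d.
rewrite {1}/downi /right_descent ell1 ltn0.
exact: bruhat_trans IH (bruhat_step (bstep_asc d)).
Qed.

(** [downi] at an ascent [i] fixes [m], so its monotonicity makes the Bruhat filter above [m] stable
    under right multiplication by [s_i]. *)
Lemma bruhat_mul_gen_filter m y i : ~~ right_descent m i -> bruhat m y -> bruhat m (y * 's_i).
Proof.
move=> d my; have [dy|dy] := boolP (right_descent y i).
  by have := downi_mono i my; rewrite /downi (negbTE d) dy.
exact: bruhat_trans my (bruhat_step (bstep_asc dy)).
Qed.

End Inversions.

(** * Parabolic subgroups and blocks *)

Section Parabolic.
Local Open Scope group_scope.
Variable C : coxeterSystem.
Local Notation I := (cox_index C).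
Implicit Types (u v w x y t : C) (i j k : I) (J K : {set I}) (r : seq I).

Canonical parabolic_group J := Eval hnf in [group of parabolic J].

Lemma gen_mem_parabolic J i : i \in J -> 's_i \in parabolic J.
Proof. by move=> iJ; rewrite mem_gen ?imset_f. Qed.

Lemma parabolicS J K : J \subset K -> parabolic J \subset parabolic K.
Proof. by move=> JK; rewrite genS ?imsetS. Qed.

Lemma parabolicU J K : parabolic (J :|: K) = parabolic J <*> parabolic K.
Proof. by rewrite /parabolic imsetU joing_idl joing_idr. Qed.

Lemma wprod_parabolic J r : all (mem J) r -> wprod r \in parabolic J.
Proof.
elim: r => [|i r IH] /=; first by rewrite wprod_nil group1.
by case/andP=> iJ /IH rJ; rewrite wprod_cons groupM ?gen_mem_parabolic.
Qed.

(** Reduction by deletion introduces no new letters; hence an element of [W_J] has a reduced word in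
    the letters of [J]. *)
Lemma reduced_subword r :
  exists r', [/\ subseq r' r, wprod r' = wprod r & size r' = ell (wprod r)].
Proof.
elim: r => [|i r [r' [sr' E sz]]]; first by exists [::]; rewrite wprod_nil ell1.
rewrite wprod_cons -E; have [d|d] := boolP ('s_i \in invs (wprod r')).
  have [r'' [sr'' sz'' E'']] := deletion d; exists r''; split=> //.
    by apply: subseq_trans (subseq_trans sr'' sr') (subseq_cons _ _).
  rewrite E''; apply/eqP; rewrite eqn_leq ell_wprod andbT.
  have := ell_mul 's_i (wprod r''); rewrite ell_gen -E'' mulgA cox_genK mul1g.
  by rewrite E -sz sz''.
exists (i :: r'); rewrite /= eqxx wprod_cons; split=> //.
apply/eqP; rewrite eqn_leq -{2}wprod_cons (ell_wprod (i :: r')) andbT.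
by rewrite sz -E refl_ell_gt // refl_gen.
Qed.

Lemma parabolic_word J w : w \in parabolic J ->
  exists r, [/\ all (mem J) r, wprod r = w & size r = ell w].
Proof.
case/gen_prodgP=> n [c cJ ->]; have cJ' (p : 'I_n) : exists i, (i \in J) && (c p == 's_i).
  by have /imsetP[i iJ ->] := cJ p; exists i; rewrite iJ eqxx.
pose r : seq I := [tuple xchoose (cJ' p) | p < n].
have rw : wprod r = \prod_(p < n) c p.
  rewrite /wprod big_tuple; apply: eq_bigr => p _; rewrite tnth_mktuple.
  by have /andP[_ /eqP E] := xchooseP (cJ' p); rewrite [RHS]E.
have [r' [sr' E sz]] := reduced_subword r; exists r'; rewrite -rw; split=> //.
apply/allP=> i /(mem_subseq sr') /tnthP[p ->]; rewrite tnth_mktuple.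
by have /andP[] := xchooseP (cJ' p).
Qed.

Lemma reflectionsJ J t a : a \in parabolic J ->
  (t ^ a \in reflections J) = (t \in reflections J).
Proof.
have J1 s b : b \in parabolic J -> s \in reflections J -> s ^ b \in reflections J.
  move=> bJ /imset2P[j y jJ yJ ->]; apply/imset2P.
  by exists j (y * b); rewrite ?groupM // conjgM.
move=> aJ; apply/idP/idP; last exact: J1.
by move/(J1 _ a^-1); rewrite conjgK groupV; apply.
Qed.

Lemma reflections_gen J j : j \in J -> 's_j \in reflections J.
Proof. by move=> jJ; apply/imset2P; exists j 1; rewrite ?conjg1 ?group1. Qed.

Lemma reflections_parabolic J t : t \in reflections J -> t \in parabolic J.
Proof.
by case/imset2P=> j y jJ yJ ->; rewrite groupJ ?gen_mem_parabolic.
Qed.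

Lemma reflectionsS J K : J \subset K -> reflections J \subset reflections K.
Proof.
move=> JK; apply/subsetP=> t /imset2P[j y jJ yJ ->]; apply/imset2P.
by exists j y; rewrite ?(subsetP JK) ?(subsetP (parabolicS JK)).
Qed.

Lemma invs_parabolic J w t : w \in parabolic J -> t \in invs w -> t \in reflections J.
Proof.
case/parabolic_word=> r [rJ <- _]; elim: r rJ t => [|j r IH] /=.
  by rewrite wprod_nil invs1 => _ t; rewrite inE.
case/andP=> jJ /IH{}IH t; rewrite wprod_cons invsM invs_gen.
case: eqVneq => [-> _|_ /IH]; first exact: reflections_gen.
by rewrite reflectionsJ ?gen_mem_parabolic.
Qed.

Lemma invs_sub_parabolic J w t : w \in parabolic J -> t \in invs w -> t \in parabolic J.
Proof. by move=> wJ /(invs_parabolic wJ); apply: reflections_parabolic. Qed.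

Lemma refl_in_parabolic J t : t \in reflections [set: I] -> t \in parabolic J ->
  t \in reflections J.
Proof. by move=> tR tJ; apply: (invs_parabolic tJ); apply: invs_refl. Qed.

(** This is where distinctness of the generators enters: without it, equality of group elements
    would not identify their indices. *)
Lemma gen_parabolic J i : ('s_i \in parabolic J) = (i \in J).
Proof.
apply/idP/idP; last exact: gen_mem_parabolic.
case/parabolic_word=> r [rJ E]; rewrite ell_gen.
case: r rJ E => [|j [|]] //=; rewrite andbT wprod_seq1 => jJ E _.
by rewrite -(cox_gen_inj E).
Qed.

Lemma reduced_word_parabolic J r : size r = ell (wprod r) ->
  wprod r \in parabolic J -> all (mem J) r.
Proof.
elim: r => //= i r IH sz; have le := ell_wprod r.
have := ell_mul 's_i (wprod r); rewrite wprod_cons in sz *; rewrite ell_gen -sz => le2 wJ.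
have iJ : 's_i \in parabolic J.
  apply: (invs_sub_parabolic wJ).
  by rewrite in_invs refl_gen mulgA cox_genK mul1g -sz ltnS.
rewrite -gen_parabolic iJ; apply: IH; first by apply/eqP; rewrite eqn_leq le andbT.
by rewrite -(groupMl _ iJ).
Qed.

(** Minimality of [x] in [W_J x], expressed through all inversions lying in [W_J] rather than
    through simple descents; [lmin_desc] proves the two forms equivalent. *)
Definition lmin J x := [disjoint invs x & parabolic J].

Lemma lminP J x t : lmin J x -> t \in invs x -> t \notin parabolic J.
Proof. by move=> d tx; rewrite (disjointFr d tx). Qed.

Section LminMul.
Variables (J : {set I}) (a x : C).
Hypotheses (aJ : a \in parabolic J) (xJ : lmin J x).

(** Conjugation by [a] preserves [W_J] and its complement. So the inversions of [a * x] inside [W_J]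
    come from [a] alone, and those outside ([lmin_invs_out]) from [x] alone. *)
Lemma lmin_invs_in t : t \in parabolic J -> (t \in invs (a * x)) = (t \in invs a).
Proof.
by move=> tJ; rewrite invsM (disjointFl xJ) ?addbF // groupJ.
Qed.

Lemma lmin_invs_out t : t \notin parabolic J -> (t \in invs (a * x)) = (t ^ a \in invs x).
Proof.
move=> tJ; rewrite invsM; case: (boolP (t \in invs a)) => // /(invs_sub_parabolic aJ).
by rewrite (negbTE tJ).
Qed.

Lemma lmin_rle : rle a (a * x).
Proof.
rewrite rleE; apply/subsetP=> t ta.
by rewrite lmin_invs_in // (invs_sub_parabolic aJ ta).
Qed.

Lemma lmin_ell : ell (a * x) = (ell a + ell x)%N.
Proof. by have := lmin_rle; rewrite rleM => /eqP. Qed.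

End LminMul.

Lemma lmin_exists J w : exists2 x, x \in parabolic J :* w & lmin J x.
Proof.
have w0 : w \in parabolic J :* w by rewrite rcoset_refl.
have [x xJ xmin] := arg_minnP (@ell C) w0; exists x => //.
apply/pred0P=> t /=; apply/negP=> /andP[tx tJ].
have : t * x \in parabolic J :* w.
  by rewrite mem_rcoset -mulgA groupM // -mem_rcoset.
by move/xmin; rewrite leqNgt (invs_ell tx).
Qed.

(** Write [x = a * y] with [y] minimal in the coset. If [a] is not 1, the first letter of a reduced
    word of [a] is a left descent of [x] in [J]. *)
Lemma lmin_desc J x : lmin J x = [forall j in J, ~~ left_descent x j].
Proof.
apply/idP/idP=> [xJ|/forall_inP nd].
  apply/forall_inP=> j jJ; rewrite left_descentE; apply/negP=> /(lminP xJ).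
  by rewrite gen_mem_parabolic.
have [y yJ ymin] := lmin_exists J x.
have {yJ} : x * y^-1 \in parabolic J by rewrite -mem_rcoset rcoset_sym.
move: (mulgKV y x) => E aJ; set a := x * y^-1 in E aJ.
have [r [rJ ra sz]] := parabolic_word aJ.
case: r rJ ra sz => [_ a1 _|j r /=/andP[jJ _] ra sz].
  by rewrite -E -a1 wprod_nil mul1g.
have ja : 's_j \in invs a.
  rewrite in_invs refl_gen -{1}ra wprod_cons mulgA cox_genK mul1g -sz ltnS.
  exact: ell_wprod.
have := nd j jJ; rewrite left_descentE -E invsM ja.
by rewrite (disjointFl ymin) // groupJ ?gen_mem_parabolic.
Qed.

Lemma lmin_coset_inj J x y : lmin J x -> lmin J y -> x \in parabolic J :* y -> x = y.
Proof.
rewrite mem_rcoset => xm ym aJ; have E := mulgKV y x; set a := x * y^-1 in aJ E.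
suff : invs a == set0 by rewrite -cards_eq0 card_invs ell_eq0 => /eqP a1; rewrite -E a1 mul1g.
apply/eqP/setP=> t; rewrite inE; apply/negP=> ta.
have tJ := invs_sub_parabolic aJ ta.
by have := disjointFl xm tJ; rewrite -E (lmin_invs_in aJ ym tJ) ta.
Qed.

Lemma lquoP J w : lquo J w \in parabolic J :* w /\ lmin J (lquo J w).
Proof.
rewrite /lquo; case: pickP => [x /andP[xJ xd]|/=]; first by rewrite lmin_desc.
have [x xJ] := lmin_exists J w; rewrite lmin_desc => xm /(_ x).
by rewrite xJ xm.
Qed.

Lemma lquo_coset J w : lquo J w \in parabolic J :* w. Proof. by case: (lquoP J w). Qed.
Lemma lquo_min J w : lmin J (lquo J w). Proof. by case: (lquoP J w). Qed.

Lemma lquo_uniq J w x : x \in parabolic J :* w -> lmin J x -> lquo J w = x.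
Proof.
move=> xw xm; apply: (lmin_coset_inj (lquo_min J w) xm).
by rewrite (rcoset_eqP xw) lquo_coset.
Qed.

Lemma lpart_in J w : lpart J w \in parabolic J.
Proof. by rewrite -mem_rcoset rcoset_sym lquo_coset. Qed.

Lemma lpart_lquo J w : lpart J w * lquo J w = w.
Proof. by rewrite mulgKV. Qed.

Lemma invs_lpart J w t : t \in parabolic J -> (t \in invs (lpart J w)) = (t \in invs w).
Proof.
by move=> tJ; rewrite -[in RHS](lpart_lquo J w) (lmin_invs_in (lpart_in J w) (lquo_min J w) tJ).
Qed.

Lemma invs_lpartE J w : invs (lpart J w) = invs w :&: parabolic J.
Proof.
apply/setP=> t; rewrite inE; case: (boolP (t \in parabolic J)) => tJ.
  by rewrite andbT invs_lpart.
by rewrite andbF; apply/negP=> /(invs_sub_parabolic (lpart_in J w)); rewrite (negbTE tJ).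
Qed.

Lemma left_blockP w J :
  reflect (exists K, parabolic J :^ w = parabolic K) (left_block w J).
Proof.
apply: (iffP existsP) => -[K].
  by move=> /eqP E; exists K; rewrite conjsgE E lcosetK.
by move=> E; exists K; rewrite -E conjsgE lcosetKV.
Qed.

Section Block.
Variables (J : {set I}) (w : C).
Hypothesis JB : left_block w J.
Local Notation x := (lquo J w).

Lemma block_conj_lquo : exists K, parabolic J :^ x = parabolic K.
Proof.
have [K E] := left_blockP _ _ JB; exists K; rewrite -E.
rewrite -[in RHS](lpart_lquo J w) conjsgM; congr (_ :^ _).
by rewrite conjGid ?lpart_in.
Qed.

(** The key property of a block. Here [a * x = x * g] with [g] in [W_K = W_J ^ x], and the
    inversions of [g] lie in [W_K]; so for [t] outside [W_J] they do not interfere. *)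
Lemma block_invs_conj a t : a \in parabolic J -> (t ^ a \in invs x) = (t \in invs x).
Proof.
move=> aJ; have [K E] := block_conj_lquo; have xm := lquo_min J w.
have [tJ|tJ] := boolP (t \in parabolic J).
  by rewrite !(disjointFl xm) // groupJ.
rewrite -(lmin_invs_out _ aJ tJ); pose g := x^-1 * (a * x).
have -> : a * x = x * g by rewrite mulKVg.
have gK : g \in parabolic K by rewrite -E -[g]/(a ^ x) memJ_conjg.
rewrite invsM.
suff /negbTE-> : t ^ x \notin invs g by rewrite addbF.
by apply: contra tJ => /(invs_sub_parabolic gK); rewrite -E memJ_conjg.
Qed.

Lemma block_invs t : (t \in invs w) = (t \in invs (lpart J w)) || (t \in invs x).
Proof.
have xm := lquo_min J w; have aJ := lpart_in J w.
case: (boolP (t \in parabolic J)) => tJ.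
  by rewrite invs_lpart // (disjointFl xm tJ) orbF.
rewrite -{1}(lpart_lquo J w) (lmin_invs_out _ aJ tJ) block_invs_conj //.
by rewrite invs_lpartE inE (negbTE tJ) andbF.
Qed.

Lemma block_invs_out t : t \notin parabolic J -> (t \in invs w) = (t \in invs x).
Proof. by move=> tJ; rewrite block_invs invs_lpartE inE (negbTE tJ) andbF. Qed.

Lemma rle_lquo : rle x w.
Proof. by rewrite rleE; apply/subsetP=> t tx; rewrite block_invs tx orbT. Qed.

Lemma rle_lquoE u : rle u w -> rle u x = lmin J u.
Proof.
move=> uw; have xm := lquo_min J w; apply/idP/idP; rewrite rleE.
  by move/disjointWl; apply.
move=> um; apply/subsetP=> t tu; rewrite -block_invs_out ?(lminP um) //.
by move: uw; rewrite rleE => /subsetP; apply.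
Qed.

(** Since [x^-1] is minimal for [W_K], the length of [x * 's_j ^ x = 's_j * x] is [ell x] plus that
    of ['s_j ^ x]; it is also [ell x + 1]. *)
Lemma block_conj_gen j : j \in J -> exists k, 's_j ^ x = 's_k :> C.
Proof.
move=> jJ; have [K E] := block_conj_lquo; have xm := lquo_min J w.
have gK : 's_j ^ x \in parabolic K by rewrite -E memJ_conjg gen_mem_parabolic.
apply: ell_eq1; have Vm : lmin K x^-1.
  apply/pred0P=> t /=; apply/negP=> /andP[tx tK].
  have tJ : t ^ x^-1 \in parabolic J by rewrite -mem_conjg E.
  by have := disjointFl xm tJ; rewrite -invsV tx.
have := lmin_ell (groupVr gK) Vm; rewrite -invMg ellV.
have -> : x * 's_j ^ x = 's_j * x by rewrite /conjg mulKVg.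
by rewrite !ellV (lmin_ell (gen_mem_parabolic jJ) xm) ell_gen => /addIn.
Qed.

End Block.

Lemma in_reduced_wordP x j :
  reflect (exists r, [/\ wprod r = x, size r = ell x & j \in r]) (in_reduced_word x j).
Proof.
apply: (iffP existsP) => [[r /andP[/eqP rx jr]]|[r [rx sr jr]]].
  by exists r; rewrite size_tuple.
have /eqP sz := sr; exists (Tuple sz).
by rewrite jr andbT; apply/eqP.
Qed.

Lemma in_reduced_word_parabolic J x j : x \in parabolic J -> in_reduced_word x j -> j \in J.
Proof.
move=> xJ /in_reduced_wordP[r [rx sz jr]]; rewrite -rx in sz xJ.
by have /allP := reduced_word_parabolic sz xJ; apply.
Qed.

Lemma in_reduced_word_rle x y j : rle x y -> in_reduced_word x j -> in_reduced_word y j.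
Proof.
move=> xy /in_reduced_wordP[r [rx sz jr]]; apply/in_reduced_wordP.
have [r' rx' sz'] := ell_word (x^-1 * y).
exists (r ++ r'); rewrite wprod_cat rx rx' mulKVg mem_cat jr; split=> //.
by rewrite size_cat sz sz' (eqP xy).
Qed.

(** With [x = a * y] and [y] minimal, an inversion of [y], conjugated back by [a], would be an
    inversion of [x] outside [W_J]. So [y] is 1. *)
Lemma parabolic_invs J x : invs x \subset parabolic J -> x \in parabolic J.
Proof.
move=> sub; have aJ := lpart_in J x; have xm := lquo_min J x.
suff : invs (lquo J x) == set0.
  rewrite -cards_eq0 card_invs ell_eq0 => /eqP E.
  by rewrite -(lpart_lquo J x) E mulg1.
apply/eqP/setP=> t; rewrite inE; apply/negP=> tx.
have tJ := lminP xm tx; set a := lpart J x in aJ.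
have taJ : t ^ a^-1 \notin parabolic J by rewrite groupJr ?groupV.
have : t ^ a^-1 \in invs x.
  by rewrite -(lpart_lquo J x) (lmin_invs_out _ aJ taJ) conjgKV.
by move/(subsetP sub); rewrite (negbTE taJ).
Qed.

(** Discarding the letters of [J] that do not occur in [w_J] keeps the cutting point. A block
    remains, since conjugation by [x] takes the kept generators to generators, whose indices form
    [K]. *)
Lemma exists_reduced_block w J : left_block w J ->
  exists2 J', reduced_left_block w J' & lquo J' w = lquo J w.
Proof.
move=> JB; set x := lquo J w; have aJ := lpart_in J w; have xm : lmin J x := lquo_min J w.
pose J' := [set j in J | in_reduced_word (lpart J w) j].
have J'J : J' \subset J by apply/subsetP=> j; rewrite inE => /andP[].
have aJ' : lpart J w \in parabolic J'.
  have [r [rJ ra sz]] := parabolic_word aJ; rewrite -ra wprod_parabolic //.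
  apply/allP=> j jr; have jJ : j \in J := allP rJ j jr.
  rewrite /= inE jJ /=; by apply/in_reduced_wordP; exists r.
have E : lquo J' w = x.
  apply: lquo_uniq; last exact: disjointWr (parabolicS J'J) xm.
  rewrite rcoset_sym mem_rcoset; exact: aJ'.
exists J' => //; rewrite /reduced_left_block /lpart E; apply/andP; split; last first.
  by apply/forall_inP=> j; rewrite inE => /andP[].
apply/left_blockP; pose K := [set k | [exists j in J', 's_j ^ x == 's_k]].
exists K; rewrite -[X in _ :^ X](lpart_lquo J w) conjsgM (conjGid aJ') -/x.
rewrite /parabolic -genJ; congr <<_>>; apply/setP=> t.
apply/idP/idP.
  rewrite mem_conjg => /imsetP[j jJ' E'].
  have [k Ek] := block_conj_gen JB (subsetP J'J j jJ').
  have tE : t = 's_k by rewrite -Ek -E' conjgKV.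
  rewrite tE imset_f // inE; apply/exists_inP; exists j => //.
  by rewrite Ek.
case/imsetP=> k; rewrite inE => /exists_inP[j jJ' /eqP Ek] ->.
by rewrite -Ek memJ_conjg imset_f.
Qed.

(** An inversion of [w_J] outside [W_J'] would be an inversion of the smaller cutting point, hence
    of [lquo J w], which has none in [W_J]. So [w_J] lies in [W_J'], and its letters are those of
    the reduced block [J]. *)
Lemma reduced_block_sub w J J' : reduced_left_block w J -> left_block w J' ->
  rle (lquo J' w) (lquo J w) -> J \subset J'.
Proof.
case/andP=> JB /forall_inP Jred J'B; rewrite rleE => /subsetP sub.
have Jm := lquo_min J w.
have aJ' : lpart J w \in parabolic J'.
  apply: parabolic_invs; apply/subsetP=> t ta.
  have tJ := invs_sub_parabolic (lpart_in J w) ta.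
  apply: contraT => tJ'; move: ta; rewrite invs_lpart // (block_invs_out J'B tJ').
  by move/sub; rewrite (disjointFl Jm tJ).
by apply/subsetP=> j /Jred; apply: in_reduced_word_parabolic.
Qed.

Lemma left_block0 w : left_block w set0.
Proof.
apply/left_blockP; exists set0.
have -> : parabolic (set0 : {set I}) = 1 :> {set C} by rewrite /parabolic imset0 gen0.
by rewrite conjs1g.
Qed.

Lemma reduced_block0 w : reduced_left_block w set0.
Proof. by rewrite /reduced_left_block left_block0; apply/forall_inP=> j; rewrite inE. Qed.

Lemma lpart_rle w J J' : J \subset J' -> rle (lpart J w) (lpart J' w).
Proof.
move=> JJ'; rewrite rleE !invs_lpartE setIS //; exact: parabolicS.
Qed.

Lemma reduced_blockU w J J' : reduced_left_block w J -> reduced_left_block w J' ->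
  reduced_left_block w (J :|: J').
Proof.
case/andP=> JB /forall_inP Jr /andP[J'B /forall_inP J'r]; apply/andP; split.
  have [K E] := left_blockP _ _ JB; have [K' E'] := left_blockP _ _ J'B.
  by apply/left_blockP; exists (K :|: K'); rewrite !parabolicU conjYg E E'.
apply/forall_inP=> j; rewrite inE => /orP[/Jr|/J'r]; apply: in_reduced_word_rle.
  by rewrite lpart_rle ?subsetUl.
by rewrite lpart_rle ?subsetUr.
Qed.

Lemma left_block_lquo w J J' : left_block w J -> J' \subset J ->
  left_block (lquo J' w) J /\ lquo J (lquo J' w) = lquo J w.
Proof.
move=> JB J'J; have aJ' := lpart_in J' w.
have aJ := subsetP (parabolicS J'J) _ aJ'.
split.
  have [K E] := left_blockP _ _ JB; apply/left_blockP; exists K.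
  by rewrite -E -[in RHS](lpart_lquo J' w) conjsgM (conjGid aJ).
apply: lquo_uniq; last exact: lquo_min.
have -> : parabolic J :* lquo J' w = parabolic J :* w; last exact: lquo_coset.
by apply/esym/rcoset_eqP; rewrite mem_rcoset.
Qed.

Lemma cut_le_rle v w : cut_le v w -> rle v w.
Proof. by case/existsP=> J /andP[JB /eqP->]; apply: rle_lquo. Qed.

Lemma cut_leP w J J' : reduced_left_block w J -> reduced_left_block w J' ->
  cut_le (lquo J w) (lquo J' w) = (J' \subset J).
Proof.
move=> Jr J'r; have [JB _] := andP Jr; apply/idP/idP.
  by move/cut_le_rle; apply: reduced_block_sub.
move=> J'J; have [B E] := left_block_lquo JB J'J.
by apply/existsP; exists J; rewrite B E eqxx.
Qed.

Lemma lquo_inj w J J' : reduced_left_block w J -> reduced_left_block w J' ->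
  lquo J w = lquo J' w -> J = J'.
Proof.
move=> Jr J'r E; have [JB _] := andP Jr; have [J'B _] := andP J'r.
apply/eqP; rewrite eqEsubset (reduced_block_sub Jr J'B) ?E ?rle_refl //.
by rewrite (reduced_block_sub J'r JB) // E rle_refl.
Qed.

Lemma lminU J J' u : lmin (J :|: J') u = lmin J u && lmin J' u.
Proof.
rewrite !lmin_desc; apply/forall_inP/andP=> [h|[/forall_inP h1 /forall_inP h2] j].
  by split; apply/forall_inP=> j jJ; apply: h; rewrite inE jJ ?orbT.
by rewrite inE => /orP[/h1|/h2].
Qed.

(** Reduced blocks and [lmin] both pass to unions, so this is the greatest reduced block for which
    [u] is minimal. It turns the [pick] of [Jblock] into an explicit set. *)
Definition max_block w u : {set I} :=
  \bigcup_(J | reduced_left_block w J && lmin J u) J.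

Lemma max_blockP w u : reduced_left_block w (max_block w u) && lmin (max_block w u) u.
Proof.
rewrite /max_block; elim/big_rec: _ => [|J K Jp /andP[Kr Km]].
  by rewrite reduced_block0 lmin_desc; apply/forall_inP=> j; rewrite inE.
by case/andP: Jp => Jr Jm; rewrite reduced_blockU // lminU Jm.
Qed.

Section JBlock.
Variables (w : C) (u : rinterval w).

Lemma Jblock_max : Jblock u = max_block w (val u).
Proof.
have [Mr Mm] := andP (max_blockP w (val u)); set M := max_block _ _ in Mr Mm *.
have [MB _] := andP Mr; have uw : rle (val u) w := valP u.
have Mu : rle (val u) (lquo M w) by rewrite rle_lquoE.
have Mlow v : cut_le v w -> rle (val u) v -> cut_le (lquo M w) v.
  case/existsP=> J /andP[JB /eqP->] uJ.
  have [J' J'r EJ'] := exists_reduced_block JB; rewrite -EJ' in uJ *.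
  have [J'B _] := andP J'r; rewrite cut_leP //; apply: bigcup_sup.
  by rewrite J'r -(rle_lquoE J'B uw).
rewrite /Jblock; case: pickP => [J /and3P[Jr uJ /forallP low]|/(_ M)] /=; last first.
  rewrite Mr Mu /= => /negP[]; apply/forallP=> v; apply/implyP=> /andP[].
  exact: Mlow.
have [JB _] := andP Jr; apply: (lquo_inj Jr Mr).
apply: rle_anti; apply: cut_le_rle; last first.
  by apply: Mlow => //; apply/existsP; exists J; rewrite JB eqxx.
have := low (lquo M w); rewrite Mu andbT; move/implyP; apply.
by apply/existsP; exists M; rewrite MB eqxx.
Qed.

Lemma Jblock_reduced : reduced_left_block w (Jblock u).
Proof. by rewrite Jblock_max; case/andP: (max_blockP w (val u)). Qed.

Lemma Jblock_rle : rle (val u) (lquo (Jblock u) w).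
Proof.
have [Mr Mm] := andP (max_blockP w (val u)); have [MB _] := andP Mr.
by rewrite Jblock_max rle_lquoE ?(valP u).
Qed.

Lemma sub_Jblock J : reduced_left_block w J ->
  (J \subset Jblock u) = rle (val u) (lquo J w).
Proof.
move=> Jr; have [JB _] := andP Jr; rewrite rle_lquoE ?(valP u) // Jblock_max.
apply/idP/idP=> [sub|Jm]; last by apply: bigcup_sup; rewrite Jr.
have [_ Mm] := andP (max_blockP w (val u)).
exact: disjointWr (parabolicS sub) Mm.
Qed.

End JBlock.

Lemma Jblock_lquo w J (u : rinterval w) : reduced_left_block w J ->
  val u = lquo J w -> Jblock u = J.
Proof.
move=> Jr uE; apply/eqP; rewrite eqEsubset (sub_Jblock u Jr) uE rle_refl andbT.
apply: (reduced_block_sub (Jblock_reduced u)); first by case/andP: Jr.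
by rewrite -uE Jblock_rle.
Qed.

End Parabolic.

(** * The operators as partial maps of the interval *)

Section Operators.
Variables (C : coxeterSystem) (K : fieldType) (w : C).
Local Notation I := (cox_index C).
Local Notation T := (transmod K w).
Local Notation E := (transEnd K w).
Local Notation X := (rinterval w).
Implicit Types (u v x y z t : X) (i j k : I) (r : seq I) (f g h : E).

Definition ap f (x : T) : T := (f : 'End(T)) x.

Lemma apM f g (x : T) : ap (f * g) x = ap g (ap f x).
Proof. by rewrite /ap -comp_lfunE. Qed.
Lemma ap1 (x : T) : ap 1 x = x.
Proof. by rewrite /ap id_lfunE. Qed.
Lemma apD f g (x : T) : ap (f + g) x = ap f x + ap g x.
Proof. exact: add_lfunE. Qed.
Lemma apN f (x : T) : ap (- f) x = - ap f x.
Proof. exact: opp_lfunE. Qed.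
Lemma apZ (c : K) f (x : T) : ap (c *: f) x = c *: ap f x.
Proof. exact: scale_lfunE. Qed.
Lemma ap0 f : ap f 0 = 0.
Proof. exact: linear0. Qed.
Lemma ap_opp f (x : T) : ap f (- x) = - ap f x.
Proof. exact: linearN. Qed.

Local Notation tv := (tvec K w).

Lemma tvecE (x : C) u : tv x u = (val u == x)%:R.
Proof. by rewrite ffunE. Qed.

Lemma tvec_out (x : C) : ~~ rle x w -> tv x = 0.
Proof.
move=> xw; apply/ffunP=> u; rewrite !ffunE; case: eqP => // ux.
by move: xw; rewrite -ux (valP u).
Qed.

Lemma transmod_sum (x : T) : x = \sum_u x u *: tv (val u).
Proof.
apply/ffunP=> v; rewrite sum_ffunE (bigD1 v) //= !ffunE eqxx big1 => [|u uv].
  by rewrite addr0 /GRing.scale /= mulr1.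
by rewrite !ffunE (inj_eq val_inj) eq_sym (negbTE uv) /GRing.scale /= mulr0.
Qed.

Lemma basis_op_linear (g : C -> T) : linear (fun x : T => \sum_u x u *: g (val u)).
Proof.
move=> c x y; rewrite scaler_sumr -big_split /=; apply: eq_bigr => u _.
by rewrite !ffunE scalerDl scalerA.
Qed.

Lemma basis_opE (g : C -> T) (x : T) : ap (basis_op g) x = \sum_u x u *: g (val u).
Proof.
pose F : {linear T -> T} := HB.pack (fun x : T => \sum_u x u *: g (val u))
  (GRing.isLinear.Build _ _ _ _ _ (basis_op_linear g)).
exact: (lfunE F).
Qed.

Lemma basis_op_tvec (g : C -> T) u : ap (basis_op g) (tv (val u)) = g (val u).
Proof.
rewrite basis_opE (bigD1 u) //= tvecE eqxx scale1r big1 ?addr0 // => v vu.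
by rewrite tvecE (inj_eq val_inj) (negbTE vu) scale0r.
Qed.

Lemma ap_ext f g : (forall u, ap f (tv (val u)) = ap g (tv (val u))) -> f = g.
Proof.
move=> fg; apply/lfunP => x; rewrite (transmod_sum x) !linear_sum.
by apply: eq_bigr => u _; rewrite !linearZ /=; congr (_ *: _); exact: fg.
Qed.

Lemma pi_tvec i u : ap (pi_op K w i) (tv (val u)) = tv (upi (val u) i).
Proof. by rewrite basis_op_tvec /upi; case: ifP. Qed.

Lemma pibar_tvec i u : ap (pibar_op K w i) (tv (val u)) =
  if rle (upi (val u) i) w then tv (downi (val u) i) else 0.
Proof. by rewrite basis_op_tvec /upi /downi; case: ifP => //; rewrite (valP u). Qed.

Lemma s_tvec i u : ap (s_op K w i) (tv (val u)) =
  if rle (val u * 's_i)%g w then tv (val u * 's_i)%g else - tv (val u).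
Proof.
rewrite /s_op apD apN ap1 apD pi_tvec pibar_tvec /upi /downi; case: ifPn => d.
  rewrite (valP u) ifT; first by rewrite addrAC subrr add0r.
  exact: rle_trans (rle_desc d) (valP u).
by case: ifPn => d'; [rewrite addrK | rewrite tvec_out // !add0r].
Qed.

Definition maps f u v : bool :=
  (ap f (tv (val u)) == tv (val v)) || (ap f (tv (val u)) == - tv (val v)).

Lemma tvec_eq_pm (x : C) v : (tv x == tv (val v)) || (tv x == - tv (val v)) = (val v == x).
Proof.
apply/orP/eqP=> [[]/eqP/ffunP/(_ v)|->]; last by left.
  by rewrite !ffunE eqxx; case: eqP => // _ /esym/eqP; rewrite oner_eq0.
rewrite !ffunE eqxx; case: eqP => // _ /esym/eqP.
by rewrite oppr_eq0 oner_eq0.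
Qed.

Lemma tvec_neq0 v : tv (val v) != 0.
Proof.
apply/eqP=> /ffunP/(_ v); rewrite !ffunE eqxx => /eqP.
by rewrite oner_eq0.
Qed.

Lemma maps_tvec f u v (x : C) : ap f (tv (val u)) = tv x -> maps f u v = (val v == x).
Proof. by rewrite /maps => ->; apply: tvec_eq_pm. Qed.

Lemma maps_Ntvec f u v (x : C) : ap f (tv (val u)) = - tv x -> maps f u v = (val v == x).
Proof.
by rewrite /maps => ->; rewrite eqr_opp orbC -{2}[tv (val v)]opprK eqr_opp tvec_eq_pm.
Qed.

Lemma maps_0 f u v : ap f (tv (val u)) = 0 -> maps f u v = false.
Proof. by rewrite /maps => ->; rewrite eq_sym [0 == - _]eq_sym oppr_eq0 (negbTE (tvec_neq0 v)). Qed.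

Lemma mapsP f u v : maps f u v ->
  ap f (tv (val u)) = tv (val v) \/ ap f (tv (val u)) = - tv (val v).
Proof. by case/orP=> /eqP; [left | right]. Qed.

Lemma maps_uniq f u v v' : maps f u v -> maps f u v' -> v = v'.
Proof.
case/mapsP=> [/maps_tvec|/maps_Ntvec] ->; rewrite (inj_eq val_inj); by move/eqP.
Qed.

Definition signed f := forall u, ap f (tv (val u)) = 0 \/ exists v, maps f u v.

Lemma maps_mul f g u t : signed f ->
  maps (f * g) u t <-> exists2 v, maps f u v & maps g v t.
Proof.
move=> sf; have mapsM v : maps f u v -> maps (f * g) u t = maps g v t.
  rewrite /maps apM => /mapsP[] -> //.
  by rewrite ap_opp eqr_opp orbC -{2}[tv (val t)]opprK eqr_opp.
split=> [fgut|[v /mapsM <- //]].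
case: (sf u) => [fu0|[v fuv]]; last by exists v => //; rewrite -(mapsM v).
by move: fgut; rewrite maps_0 // apM fu0 ap0.
Qed.

Lemma signed1 : signed 1.
Proof. by move=> u; right; exists u; rewrite /maps ap1 eqxx. Qed.

Lemma maps1 u v : maps 1 u v = (u == v).
Proof. by rewrite (@maps_tvec _ _ _ (val u)) ?ap1 // eq_sym. Qed.

Lemma signedM f g : signed f -> signed g -> signed (f * g).
Proof.
move=> sf sg u; case: (sf u) => [fu0|[v fuv]]; first by left; rewrite apM fu0 ap0.
case: (sg v) => [gv0|[t gvt]].
  by left; rewrite apM; case/mapsP: fuv => ->; rewrite ?ap_opp gv0 ?oppr0.
by right; exists t; apply/maps_mul => //; exists v.
Qed.

Lemma maps_pi i u v : maps (pi_op K w i) u v = (val v == upi (val u) i).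
Proof. exact/maps_tvec/pi_tvec. Qed.

Lemma maps_pibar i u v : maps (pibar_op K w i) u v =
  rle (upi (val u) i) w && (val v == downi (val u) i).
Proof.
have := pibar_tvec i u; case: ifP => _; first exact: maps_tvec.
exact: maps_0.
Qed.

Lemma maps_s i u v : maps (s_op K w i) u v =
  (val v == if rle (val u * 's_i)%g w then (val u * 's_i)%g else val u).
Proof.
by have := s_tvec i u; case: ifP => _; [apply: maps_tvec | apply: maps_Ntvec].
Qed.

Lemma signed_tvec f : (forall u, ap f (tv (val u)) = 0 \/
  exists x : C, ap f (tv (val u)) = tv x \/ ap f (tv (val u)) = - tv x) -> signed f.
Proof.
move=> h u; case: (h u) => [->|[x fx]]; first by left.
case: (boolP (rle x w)) => xw; last by left; case: fx => ->; rewrite tvec_out ?oppr0.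
right; exists (exist _ x xw : X).
by rewrite /maps; case: fx => ->; rewrite eqxx ?orbT.
Qed.

Definition gens := [seq pi_op K w i | i : I] ++ [seq pibar_op K w i | i : I]
                 ++ [seq s_op K w i | i : I].

Lemma signed_gens f : f \in gens -> signed f.
Proof.
rewrite !mem_cat => /or3P[]/mapP[i _ ->]; apply: signed_tvec => u.
- by right; exists (upi (val u) i); left; apply: pi_tvec.
- rewrite pibar_tvec; case: ifP => _; last by left.
  by right; exists (downi (val u) i); left.
rewrite s_tvec; right.
by case: ifP => _; [exists (val u * 's_i)%g; left | exists (val u); right].
Qed.

Lemma pi_gens i : pi_op K w i \in gens.
Proof. by rewrite mem_cat map_f ?mem_enum. Qed.
Lemma pibar_gens i : pibar_op K w i \in gens.
Proof. by rewrite !mem_cat [X in _ || (X || _)]map_f ?mem_enum ?orbT. Qed.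
Lemma s_gens i : s_op K w i \in gens.
Proof. by rewrite !mem_cat [X in _ || (_ || X)]map_f ?mem_enum ?orbT. Qed.

Lemma monoid1 : biHecke_monoid (1 : E).
Proof. by exists [::]; rewrite ?big_nil. Qed.

Lemma monoidM f g : biHecke_monoid f -> biHecke_monoid g -> biHecke_monoid (f * g).
Proof.
case=> r rg -> [r' r'g ->]; exists (r ++ r'); last by rewrite big_cat.
by move=> h; rewrite mem_cat => /orP[/rg|/r'g].
Qed.

Lemma monoid_gen f : f \in gens -> biHecke_monoid f.
Proof. by move=> fg; exists [:: f]; rewrite ?big_seq1 // => h; rewrite inE => /eqP->. Qed.

Lemma monoid_word (p : I -> E) r : (forall i, p i \in gens) ->
  biHecke_monoid (\prod_(i <- r) p i).
Proof.
move=> pg; elim: r => [|i r IH]; first by rewrite big_nil; apply: monoid1.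
by rewrite big_cons; apply: monoidM => //; apply: monoid_gen.
Qed.

Lemma monoid_signed f : biHecke_monoid f -> signed f.
Proof.
case=> r rg ->; elim: r rg => [|h r IH] rg; first by rewrite big_nil; apply: signed1.
rewrite big_cons; apply: signedM.
  by apply: signed_gens; apply: rg; rewrite mem_head.
by apply: IH => g gr; apply: rg; rewrite inE gr orbT.
Qed.

Definition tri f u v := [/\ maps f u v, forall x y, maps f x y -> bruhat (val v) (val y)
  & forall x, maps f x v -> bruhat (val x) (val u)].

Lemma op_fiberE f v u : (u \in op_fiber f v) = maps f u v.
Proof. by rewrite inE. Qed.

Lemma op_imP f v : reflect (exists u, maps f u v) (v \in op_im f).
Proof.
rewrite inE; apply: (iffP (set0Pn _)) => -[u]; first by rewrite op_fiberE; exists u.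
by exists u; rewrite op_fiberE.
Qed.

(** In a finite poset a unique minimal element is least and a unique maximal one is greatest. The
    form [tri] with least and greatest elements is the one that composes. *)
Lemma triangularP f u v : triangular f u v <-> tri f u v.
Proof.
split=> [[/setP im_v /setP fib_u]|[fuv minv maxu]].
  have := fib_u u; rewrite in_set1 eqxx in_set op_fiberE => /andP[fuv _].
  split=> // [x y fxy|x fxv].
    pose P := [pred z : X | (z \in op_im f) && bruhat (val z) (val y)].
    have Py : P y by rewrite /= bruhat_refl andbT; apply/op_imP; exists x.
    have [z /andP[zim zy] zmin] := arg_minnP (fun z : X => ell (val z)) Py.
    suff : z \in [set v] by rewrite inE => /eqP <-.
    rewrite -im_v in_set zim; apply/forall_inP=> y' y'im; apply/implyP=> y'z.
    rewrite -(inj_eq val_inj); apply/eqP/bruhat_anti_ell => //; apply: zmin.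
    by rewrite /= y'im (bruhat_trans y'z zy).
  pose P := [pred z : X | (z \in op_fiber f v) && bruhat (val x) (val z)].
  have Px : P x by rewrite /= bruhat_refl op_fiberE fxv.
  have [z /andP[zf xz] zmax] := arg_maxnP (fun z : X => ell (val z)) Px.
  suff : z \in [set u] by rewrite inE => /eqP <-.
  rewrite -fib_u in_set zf; apply/forall_inP=> y' y'f; apply/implyP=> zy'.
  rewrite -(inj_eq val_inj) eq_sym; apply/eqP/bruhat_anti_ell => //; apply: zmax.
  by rewrite /= y'f (bruhat_trans xz zy').
split; apply/setP=> x; rewrite in_set1 in_set ?op_fiberE; apply/andP/eqP=> [[]|->].
- case/op_imP=> y fyx /forall_inP/(_ v).
  have vim : v \in op_im f by apply/op_imP; exists u.
  by move/(_ vim)/implyP/(_ (minv _ _ fyx))/eqP.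
- split; first by apply/op_imP; exists u.
  apply/forall_inP=> y /op_imP[z fzy]; apply/implyP=> yv.
  rewrite -(inj_eq val_inj); apply/eqP.
  case: (bruhat_ell yv) => // lt; case: (bruhat_ell (minv _ _ fzy)) => // lt'.
  by move: (ltn_trans lt lt'); rewrite ltnn.
- move=> fxv /forall_inP/(_ u); rewrite op_fiberE => /(_ fuv).
  by move/implyP/(_ (maxu _ fxv))/eqP.
split=> //; apply/forall_inP=> y; rewrite op_fiberE => fyv.
apply/implyP=> uy; rewrite -(inj_eq val_inj); apply/eqP.
case: (bruhat_ell uy) => // lt; case: (bruhat_ell (maxu _ fyv)) => // lt'.
by move: (ltn_trans lt lt'); rewrite ltnn.
Qed.

Definition reach u v := exists2 f, biHecke_monoid f & tri f u v.

(** If [x] goes to [z] under [f] and [z] to [t] under [g], then [z] is below [v] by the fibre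
    condition on [g] and above [v] by the image condition on [f]; so [z = v]. *)
Lemma reach_trans v u t : reach u v -> reach v t -> reach u t.
Proof.
case=> f fF [fuv fim ffib] [g gF [gvt gim gfib]].
have sf := monoid_signed fF; exists (f * g); first exact: monoidM.
split=> [|x y|x].
- by apply/maps_mul => //; exists v.
- by case/maps_mul => // z _ /gim.
case/maps_mul => // z fxz gzt.
have zv := gfib _ gzt; have vz := fim _ _ fxz.
suff zE : z = v by apply: ffib; rewrite -zE.
apply: val_inj; case: (bruhat_ell zv) => // lt; case: (bruhat_ell vz) => // lt'.
by move: (ltn_trans lt lt'); rewrite ltnn.
Qed.

End Operators.

(** * Stabilisers of inversion sets *)

Section Normaliser.
Local Open Scope group_scope.
Variable C : coxeterSystem.
Local Notation I := (cox_index C).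
Implicit Types (m g x y t : C) (i j k : I) (L : {set I}).

Lemma ell_mulV x y : ell (x * y^-1) = ell (y * x^-1).
Proof. by rewrite -ellV invMg invgK. Qed.

Lemma invM_gen x i : (x * 's_i)^-1 = 's_i * x^-1.
Proof. by rewrite invMg cox_genV. Qed.

Lemma invs_genM x i t : (t \in invs ('s_i * x)) = (t == 's_i) (+) (t ^ 's_i \in invs x).
Proof. by rewrite invsM invs_gen. Qed.

Lemma lminV_desc L m : lmin L m^-1 = [forall i in L, ~~ right_descent m i].
Proof.
rewrite lmin_desc; apply: eq_forallb => i; congr (_ ==> ~~ _).
by rewrite left_descentE right_descentV.
Qed.

Lemma ell_mul_lminV L m g : lmin L m^-1 -> g \in parabolic L ->
  ell (m * g) = (ell m + ell g)%N.
Proof.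
move=> mm gL; have := lmin_ell (groupVr gL) mm.
by rewrite -invMg !ellV addnC.
Qed.

(* [m * g] ends with a reduced word of [m] iff [g] normalises the right
   inversion set of [m]. *)
Lemma suffix_norm L m g : lmin L m^-1 -> g \in parabolic L ->
  rle m^-1 (m * g)^-1 = (g \in 'N(invs m^-1)).
Proof.
move=> mm gL; have gF t : t \in invs m^-1 -> (t \in invs g^-1) = false.
  move=> tm; apply/negP=> /(invs_sub_parabolic (groupVr gL)).
  by rewrite (disjointFr mm tm).
rewrite -groupV rleE inE invMg; apply/subsetP/subsetP=> sub t.
  rewrite mem_conjg invgK => /[dup] tm /sub.
  by rewrite invsM (gF _ tm) /= conjgK.
by move=> tm; rewrite invsM (gF _ tm) /= sub // memJ_conjg.
Qed.

(** The ascents [i] for which [m * 's_i] still ends with a reduced word of [m] ([suffix_asc]). They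
    are the obstruction to the direct construction in [reach_asc]. *)
Definition norm_asc m : {set I} :=
  [set i | ~~ right_descent m i && ('s_i \in 'N(invs m^-1))].

Lemma lmin_norm_asc m : lmin (norm_asc m) m^-1.
Proof. by rewrite lminV_desc; apply/forall_inP=> i; rewrite inE => /andP[]. Qed.

Lemma lmin_set1 m i : lmin [set i] m^-1 = ~~ right_descent m i.
Proof.
rewrite lminV_desc; apply/forall_inP/idP=> [|d j]; first by apply; rewrite inE.
by rewrite inE => /eqP->.
Qed.

Lemma suffix_asc m i : ~~ right_descent m i ->
  rle m^-1 (m * 's_i)^-1 = (i \in norm_asc m).
Proof.
move=> d; rewrite inE d /=; apply: (suffix_norm (L := [set i])).
  by rewrite lmin_set1.
by rewrite gen_parabolic inE.
Qed.

(** As [m * 's_i] is one letter longer than [m] and ends with [m], it equals ['s_j * m] for some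
    [j]. This is how a left block will appear. *)
Lemma norm_asc_gen m i : i \in norm_asc m -> exists j, 's_i ^ m^-1 = 's_j.
Proof.
move=> iB; have d : ~~ right_descent m i by move: iB; rewrite inE => /andP[].
apply: ell_eq1; move: iB; rewrite -(suffix_asc d) /rle !ellV (ell_asc d) invgK ell_mulV.
by rewrite -addn1 eqn_add2l => /eqP; rewrite /conjg invgK mulgA.
Qed.

Lemma norm_asc_sub m : parabolic (norm_asc m) \subset 'N(invs m^-1).
Proof.
rewrite gen_subG; apply/subsetP=> t /imsetP[i iB ->].
by move: iB; rewrite inE => /andP[].
Qed.

(* [m * b * s_k * b'] ends with a reduced word of [m] only if [s_k] normalises
   the right inversions of [m]. *)
Lemma suffix_norm_asc m k b b' : ~~ right_descent m k -> k \notin norm_asc m ->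
  b \in parabolic (norm_asc m) -> b' \in parabolic (norm_asc m) ->
  ~~ rle m^-1 (m * (b * 's_k * b'))^-1.
Proof.
move=> kd kB bB b'B; pose L := norm_asc m :|: [set k].
have mm : lmin L m^-1 by rewrite lminU lmin_norm_asc lmin_set1.
have sub := subsetP (parabolicS (subsetUl (norm_asc m) [set k])).
have kL : 's_k \in parabolic L by rewrite gen_parabolic !inE eqxx orbT.
have bL : b \in parabolic L := sub _ bB; have b'L : b' \in parabolic L := sub _ b'B.
rewrite (suffix_norm mm); last by rewrite !groupM.
have nB := subsetP (norm_asc_sub m); apply: contra kB => h.
rewrite inE kd /= -(groupMl _ (nB _ bB)) -(groupMr _ (nB _ b'B)).
exact: h.
Qed.

(** Write [y = z * m'] with lengths adding. The descent of [y] at [i] does not come from [m'], so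
    ['s_i ^ m'^-1] is a right inversion of [z] and can be removed from it. *)
Lemma suffix_exchange m' y i : rle m'^-1 y^-1 -> ~~ right_descent m' i ->
  right_descent y i -> rle (m' * 's_i)^-1 y^-1.
Proof.
move=> my md yd; pose z := y * m'^-1.
have yE : y = z * m' by rewrite mulgKV.
have ly : ell y = (ell z + ell m')%N.
  by move: my; rewrite /rle !ellV invgK ell_mulV addnC => /eqP.
have tz : 's_i ^ m'^-1^-1^-1 \in invs z^-1.
  move: yd; rewrite right_descentV yE invMg invsM -right_descentV (negbTE md).
  by rewrite invgK.
rewrite invgK in_invsV in tz; last by rewrite reflJ refl_gen.
rewrite /rle !ellV invgK (ell_asc md) ell_mulV.
have E : y * (m' * 's_i)^-1 = z * 's_i ^ m'^-1.
  by rewrite yE invMg cox_genV /conjg invgK !mulgA.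
have := ell_mul (y * (m' * 's_i)^-1) (m' * 's_i); rewrite mulgKV (ell_asc md) E.
by rewrite eqn_leq ly; move: tz; lia.
Qed.

End Normaliser.

(** * Products of operators along words *)

Section Reach.
Variables (C : coxeterSystem) (K : fieldType) (w : C).
Local Notation I := (cox_index C).
Local Notation E := (transEnd K w).
Local Notation X := (rinterval w).
Implicit Types (u v x y z t m : X) (i j k : I) (r : seq I) (f g h : E).

Definition piw r : E := \prod_(i <- r) pi_op K w i.
Definition pibarw r : E := \prod_(i <- r) pibar_op K w i.
Definition sw r : E := \prod_(i <- r) s_op K w i.

Lemma monoid_piw r : biHecke_monoid (piw r).
Proof. by apply: monoid_word => i; apply: pi_gens. Qed.
Lemma monoid_pibarw r : biHecke_monoid (pibarw r).
Proof. by apply: monoid_word => i; apply: pibar_gens. Qed.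
Lemma monoid_sw r : biHecke_monoid (sw r).
Proof. by apply: monoid_word => i; apply: s_gens. Qed.
Lemma monoid_pi i : biHecke_monoid (pi_op K w i).
Proof. exact/monoid_gen/pi_gens. Qed.
Lemma monoid_pibar i : biHecke_monoid (pibar_op K w i).
Proof. exact/monoid_gen/pibar_gens. Qed.
Lemma monoid_s i : biHecke_monoid (s_op K w i).
Proof. exact/monoid_gen/s_gens. Qed.

Lemma maps_mulF f g x y : biHecke_monoid f ->
  maps (f * g) x y <-> exists2 z, maps f x z & maps g z y.
Proof. by move=> fF; apply/maps_mul/monoid_signed. Qed.

Definition reduced r := ell (wprod r : C) == size r.

Lemma reduced_rcons r i : reduced (rcons r i) ->
  reduced r /\ ~~ right_descent (wprod r : C) i.
Proof.
rewrite /reduced wprod_rcons size_rcons => /eqP sz; have le := ell_wprod (C := C) r.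
case: (boolP (right_descent (wprod r : C) i)) => [/ell_desc|/ell_asc] e.
  by move: e le; rewrite sz; lia.
by split=> //; move: e; rewrite sz => -[->].
Qed.

Lemma piw_rcons r i : piw (rcons r i) = piw r * pi_op K w i.
Proof. by rewrite /piw -cats1 big_cat big_seq1. Qed.

(** By induction on the word. If the current element already descends at the new letter, [pi_i]
    fixes it and [suffix_exchange] lengthens its suffix; otherwise the letter is appended to
    both. *)
Lemma piw_image r x y : reduced r -> maps (piw r) x y ->
  bruhat (wprod r) (val y) /\ rle (wprod r)^-1%g (val y)^-1%g.
Proof.
elim/last_ind: r y => [|r i IH] y.
  by rewrite wprod_nil invg1 rle1 => _ _; split; first exact: bruhat1.
case/reduced_rcons=> rr d; rewrite piw_rcons => /(maps_mulF _ _ _ (monoid_piw r)).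
case=> z /(IH _ rr)[rz sz]; rewrite maps_pi => /eqP yE.
have uE : upi (wprod r) i = wprod (rcons r i) :> C by rewrite /upi (negbTE d) wprod_rcons.
rewrite yE -uE; split; first exact: upi_mono.
rewrite {1}/upi (negbTE d) /upi; case: ifPn => zd; first exact: suffix_exchange.
move: sz; rewrite !rleE => /subsetP sub; apply/subsetP=> t.
rewrite (invM_gen _ i) (invM_gen (val z) i).
rewrite (invs_genM _ i) (invs_genM (val z)^-1 i).
have [->|_] := eqVneq t ('s_i : C); last by rewrite !addFb => /sub.
have ssE : ('s_i ^ 's_i = 's_i :> C)%g by rewrite /conjg mulKg.
by rewrite !ssE -!right_descentV (negbTE zd) (negbTE d).
Qed.

(* [bounce r] is triangular at the element of which [r] is a reduced word. *)
Definition bounce r : E := pibarw (rev r) * piw r.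

Lemma monoid_bounce r : biHecke_monoid (bounce r).
Proof. by apply: monoidM; [apply: monoid_pibarw | apply: monoid_piw]. Qed.

Lemma bounce_rcons r i : bounce (rcons r i) = pibar_op K w i * (bounce r * pi_op K w i).
Proof. by rewrite /bounce piw_rcons rev_rcons /pibarw big_cons !mulrA. Qed.

Lemma bounce_image r x y : reduced r -> maps (bounce r) x y ->
  bruhat (wprod r) (val y) /\ rle (wprod r)^-1%g (val y)^-1%g.
Proof.
move=> rr /(maps_mulF _ _ _ (monoid_pibarw _))[z _].
exact: piw_image.
Qed.

(** Each descent by [pibar_i] is made good by the matching [pi_i], because
    [upi (downi x i) i = upi x i]. *)
Lemma bounce_bruhat r x y : maps (bounce r) x y -> bruhat (val x) (val y).
Proof.
elim/last_ind: r x y => [|r i IH] x y.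
  by rewrite /bounce /pibarw /piw /= !big_nil mulr1 maps1 => /eqP->; apply: bruhat_refl.
rewrite bounce_rcons => /(maps_mulF _ _ _ (monoid_pibar i))[z].
rewrite maps_pibar => /andP[_ /eqP zE] /(maps_mulF _ _ _ (monoid_bounce r))[t /IH zt].
rewrite maps_pi => /eqP ->; have := upi_mono i zt; rewrite zE upi_downi.
exact: bruhat_trans (bruhat_upi _ _).
Qed.

Lemma bounce_fix r m : reduced r -> val m = wprod r -> maps (bounce r) m m.
Proof.
elim/last_ind: r m => [|r i IH] m rr mE.
  by rewrite /bounce /pibarw /piw /= !big_nil mulr1 maps1.
have [rr' d] := reduced_rcons rr; rewrite wprod_rcons in mE.
have dm : right_descent (val m) i by rewrite mE right_descentM d.
have m'w : rle (wprod r) w.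
  by apply: rle_trans (valP m); rewrite mE rle_asc.
rewrite bounce_rcons; apply/(maps_mulF _ _ _ (monoid_pibar i)).
exists (exist _ (wprod r) m'w : X).
  by rewrite maps_pibar /upi /downi dm (valP m) mE mul_genK /=.
apply/(maps_mulF _ _ _ (monoid_bounce r)); exists (exist _ (wprod r) m'w : X).
  exact: IH.
by rewrite maps_pi /upi /= (negbTE d) mE.
Qed.

(** At the element just below its own, the outer [pibar_i] and the inner bounce act trivially and
    the final [pi_i] goes up. This second preimage of [v] is what [reach_broken] exploits. *)
Lemma bounce_step r m v i : reduced (rcons r i) -> val m = wprod r ->
  val v = (val m * 's_i)%g -> maps (bounce (rcons r i)) m v.
Proof.
move=> rr mE vE; have [rr' d] := reduced_rcons rr.
rewrite bounce_rcons; apply/(maps_mulF _ _ _ (monoid_pibar i)); exists m.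
  by rewrite maps_pibar /upi /downi mE (negbTE d) eqxx andbT -mE -vE (valP v).
apply/(maps_mulF _ _ _ (monoid_bounce r)); exists m; first exact: bounce_fix.
by rewrite maps_pi /upi mE (negbTE d) vE mE.
Qed.

Lemma exists_reduced (x : C) : exists2 r, wprod r = x & reduced r.
Proof. by have [r <- sz] := ell_word x; exists r; rewrite // /reduced sz. Qed.

Lemma reach_refl m : reach K m m.
Proof.
have [r rE rr] := exists_reduced (val m); exists (bounce r); first exact: monoid_bounce.
split=> [|x y /(bounce_image rr)[]|x]; [exact: bounce_fix | by rewrite rE | exact: bounce_bruhat].
Qed.

Lemma reach_desc u v i : right_descent (val u) i -> val v = (val u * 's_i)%g -> reach K u v.
Proof.
move=> d vE; apply: (reach_trans (reach_refl u)).
have [r rE rr] := exists_reduced (val u).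
exists (bounce r * pibar_op K w i).
  by apply: monoidM; [apply: monoid_bounce | apply: monoid_pibar].
split=> [|x y|x].
- apply/(maps_mulF _ _ _ (monoid_bounce r)); exists u; first exact: bounce_fix.
  by rewrite maps_pibar /upi /downi d (valP u) vE /=.
- case/(maps_mulF _ _ _ (monoid_bounce r))=> z /(bounce_image rr)[rz _].
  rewrite maps_pibar => /andP[_ /eqP->]; rewrite rE in rz.
  by have := downi_mono i rz; rewrite {1}/downi d vE.
case/(maps_mulF _ _ _ (monoid_bounce r))=> z xz; have xz' := bounce_bruhat xz.
have [rz _] := bounce_image rr xz; rewrite rE in rz.
(* A preimage [z] of [v] under [pibar_i] is at most one letter longer than [v], hence no longer than
   [u]; being above [u], it is [u]. *)
rewrite maps_pibar => /andP[_ /eqP vz]; suff <- : z = u by [].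
apply: val_inj; apply/esym/bruhat_anti_ell => //.
move: vz; rewrite /downi; case: ifPn => zd vz.
  by rewrite (ell_desc zd) -vz vE (ell_desc d).
by rewrite -vz vE (ell_desc d).
Qed.

Lemma reach_rle u v : rle (val v) (val u) -> reach K u v.
Proof.
move En : (ell (val u) - ell (val v))%N => n; elim: n v En => [|n IH] v En vu.
  have -> : v = u by apply/val_inj/rle_eq => //; rewrite -subn_eq0 En.
  exact: reach_refl.
have nvu : val v != val u by apply/eqP=> E; move: En; rewrite E subnn.
have [i d vi] := rle_word_split vu nvu.
have viw : rle (val v * 's_i)%g w by apply: rle_trans vi (valP u).
pose vsi : X := exist _ (val v * 's_i)%g viw.
have s1 : reach K u vsi by apply: IH => //=; rewrite (ell_asc d) subnS En.
have s2 : reach K vsi v by apply: (@reach_desc vsi v i); rewrite /= ?right_descentM ?d ?mul_genK.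
exact: reach_trans s1 s2.
Qed.

(* If [v = m s_i] were in the image of [bounce r], then [s_i] would normalise the
   right inversions of [m]. *)
Lemma reach_asc m v i : ~~ right_descent (val m) i -> i \notin norm_asc (val m) ->
  val v = (val m * 's_i)%g -> reach K m v.
Proof.
move=> d iB vE; have [r rE rr] := exists_reduced (val m).
exists (bounce r * pi_op K w i).
  by apply: monoidM; [apply: monoid_bounce | apply: monoid_pi].
split=> [|x y|x].
- apply/(maps_mulF _ _ _ (monoid_bounce r)); exists m; first exact: bounce_fix.
  by rewrite maps_pi /upi (negbTE d) vE.
- case/(maps_mulF _ _ _ (monoid_bounce r))=> z /(bounce_image rr)[rz _].
  rewrite maps_pi => /eqP->; rewrite rE in rz.
  by have := upi_mono i rz; rewrite {1}/upi (negbTE d) vE.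
case/(maps_mulF _ _ _ (monoid_bounce r))=> z xz; have xz' := bounce_bruhat xz.
have [rz sz] := bounce_image rr xz; rewrite rE in rz sz.
rewrite maps_pi => /eqP vz; move: vz; rewrite /upi vE; case: ifPn => zd vz.
  by case/negP: iB; rewrite -suffix_asc // vz.
by rewrite (mulIg _ _ _ vz).
Qed.

Lemma maps_sw_sub r x y : maps (sw r) x y ->
  exists r', subseq r' r /\ val y = (val x * wprod r')%g.
Proof.
elim: r x => [|i r IH] x.
  by rewrite /sw big_nil maps1 => /eqP->; exists [::]; rewrite wprod_nil mulg1.
rewrite /sw big_cons => /(maps_mulF _ _ _ (monoid_s i))[z].
rewrite maps_s => /eqP zE /IH[r' [sr' yE]]; move: zE; case: ifP => _ zE.
  by exists (i :: r'); rewrite /= eqxx wprod_cons mulgA -zE.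
by exists r'; rewrite (subseq_trans sr') ?subseq_cons // yE zE.
Qed.

Lemma maps_sw_path r x y : (forall p, prefix p r -> rle (val x * wprod p)%g w) ->
  val y = (val x * wprod r)%g -> maps (sw r) x y.
Proof.
elim: r x => [|i r IH] x pw yE.
  rewrite /sw big_nil maps1; apply/eqP/val_inj.
  by rewrite yE wprod_nil mulg1.
have xiw : rle (val x * 's_i)%g w.
  by have := pw [:: i]; rewrite wprod_seq1; apply; rewrite /= eqxx prefix0s.
rewrite /sw big_cons; apply/(maps_mulF _ _ _ (monoid_s i)).
exists (exist _ (val x * 's_i)%g xiw : X); first by rewrite maps_s xiw.
apply: IH => [p pr|] /=; last by rewrite yE wprod_cons mulgA.
by have := pw (i :: p); rewrite wprod_cons mulgA /= eqxx; apply.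
Qed.

(** Each [s_op] is a signed involution of the basis, so the product along the reversed word undoes
    [sw r]. *)
Lemma maps_s_sym i x y : maps (s_op K w i) x y -> maps (s_op K w i) y x.
Proof.
rewrite !maps_s; case: ifPn => xi /eqP yE; first by rewrite yE mul_genK (valP x).
by rewrite yE (negbTE xi).
Qed.

Lemma maps_sw_rev r x y : maps (sw r) x y -> maps (sw (rev r)) y x.
Proof.
elim: r x => [|i r IH] x; first by rewrite /sw !big_nil !maps1 eq_sym.
rewrite /sw big_cons => /(maps_mulF _ _ _ (monoid_s i))[z xz /IH zy].
rewrite rev_cons -cats1 big_cat big_seq1.
apply/(maps_mulF _ _ _ (monoid_sw (rev r))); exists z => //.
exact: maps_s_sym.
Qed.

Lemma maps_sw_filter (m : C) r x y : all (fun i => ~~ right_descent m i) r ->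
  bruhat m (val x) -> maps (sw r) x y -> bruhat m (val y).
Proof.
elim: r x => [|i r IH] x /=; first by rewrite /sw big_nil maps1 => _ mx /eqP<-.
case/andP=> d dr mx; rewrite /sw big_cons => /(maps_mulF _ _ _ (monoid_s i))[z].
rewrite maps_s => /eqP zE; apply: IH => //; rewrite zE.
by case: ifP => // _; apply: bruhat_mul_gen_filter.
Qed.

End Reach.

(** * Existence of triangular elements *)

Lemma mul_conjV (G : groupType) (x y z : G) : (x * y ^ z^-1 * z = x * z * y)%g.
Proof. by rewrite /conjg invgK !mulgA mulgKV. Qed.

Section Triangular.
Variables (C : coxeterSystem) (K : fieldType) (w : C).
Local Notation I := (cox_index C).
Local Notation X := (rinterval w).
Implicit Types (u v x y z t m : X) (i j k : I) (r : seq I).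

(** No right inversion of [m] lies in the parabolic generated by [norm_asc m] and [k], and ['s_k] is
    not an inversion of [b^-1], which lies in the smaller parabolic. *)
Lemma norm_asc_mul (m b : C) k : ~~ right_descent m k -> k \notin norm_asc m ->
  b \in parabolic (norm_asc m) -> ~~ right_descent (m * b)%g k.
Proof.
move=> kd kB bB; pose L := norm_asc m :|: [set k].
have mm : lmin L m^-1%g by rewrite lminU lmin_norm_asc lmin_set1.
have bL : b \in parabolic L := subsetP (parabolicS (subsetUl _ _)) _ bB.
have kL : 's_k \in parabolic L by rewrite gen_parabolic !inE eqxx orbT.
rewrite right_descentV invMg invsM.
have -> : ('s_k \in invs b^-1)%g = false.
  apply/negP=> /(invs_sub_parabolic (groupVr bB)).
  by rewrite gen_parabolic (negbTE kB).
by rewrite (disjointFl mm) //= groupJ // groupV.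
Qed.

(** Lengths add in [m * W_B], so multiplying [m] by successive prefixes of a reduced word climbs in
    weak order and never leaves the interval. *)
Lemma rle_cat_parabolic (m : C) r r' : reduced (C := C) (r ++ r') ->
  all (mem (norm_asc m)) (r ++ r') -> rle (m * wprod r)%g (m * wprod (r ++ r'))%g.
Proof.
move=> rr rB; have le := ell_wprod (C := C) r; have le' := ell_wprod (C := C) r'.
have mm := lmin_norm_asc m; have rB' := rB.
rewrite all_cat in rB'; have [r1B r2B] := andP rB'.
have sz : ell (wprod (r ++ r') : C) = (size r + size r')%N.
  by rewrite (eqP rr) size_cat.
have := ell_mul (wprod r : C) (wprod r'); rewrite -wprod_cat sz => le2.
rewrite wprod_cat mulgA rleM -mulgA -wprod_cat.
rewrite (ell_mul_lminV mm (wprod_parabolic rB)) (ell_mul_lminV mm (wprod_parabolic r1B)) sz.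
by rewrite -addnA eqn_add2l eqn_leq le2 leq_add.
Qed.

(* The element [w] meets a coset m W_B, at m * a * s_k, where right
   multiplication by s_k leaves the interval at every shorter m * b, b in W_B.
   Then pibar_k, conjugated by the permutation [sw], kills m * s_i and fixes m. *)
Lemma reach_broken m v i r k : let a := wprod (i :: r) in
    reduced (C := C) (i :: r) -> all (mem (norm_asc (val m))) (i :: r) ->
    ~~ right_descent (val m) k -> k \notin norm_asc (val m) ->
    rle (val m * a * 's_k)%g w ->
    (forall b, b \in parabolic (norm_asc (val m)) -> rle (val m * b * 's_k)%g w ->
      ell a <= ell b)%N ->
    val v = (val m * 's_i)%g ->
  reach K m v.
Proof.
move=> a ra aB kd kB masw amin vE; set p := i :: r in ra aB a masw amin *.
have aP : a \in parabolic (norm_asc (val m)) := wprod_parabolic aB.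
have maw : rle (val m * a)%g w.
  by apply: rle_trans masw; rewrite rle_asc norm_asc_mul.
pose ma : X := exist _ (val m * a)%g maw.
have pd : all (fun j => ~~ right_descent (val m) j) p.
  by apply: sub_all aB => j /=; rewrite inE => /andP[].
have path : maps (sw K w p) m ma.
  apply: maps_sw_path => // q /prefixP[q' pE].
  by apply: (rle_trans _ maw); rewrite /a pE; apply: rle_cat_parabolic; rewrite -pE.
have [rm rmE rmr] := exists_reduced (val m).
have iB : i \in norm_asc (val m) by case/andP: aB.
have id : ~~ right_descent (val m) i by case/andP: pd.
have rvr : reduced (C := C) (rcons rm i).
  rewrite /reduced wprod_rcons rmE (ell_asc id) size_rcons -rmE.
  by rewrite (eqP rmr).
have rvE : wprod (rcons rm i) = val v by rewrite wprod_rcons rmE vE.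
have m_ee := monoid_bounce K w rm; have m_sw := monoid_sw K w p.
have m_pb := monoid_pibar K w k; have m_sw' := monoid_sw K w (rev p).
have m_ev := monoid_bounce K w (rcons rm i).
have lv : ell (val v) = (ell (val m)).+1 by rewrite vE ell_asc.
exists (bounce K w rm * (sw K w p * (pibar_op K w k * (sw K w (rev p) * bounce K w (rcons rm i))))).
  exact: (monoidM m_ee (monoidM m_sw (monoidM m_pb (monoidM m_sw' m_ev)))).
have mapsE x y : maps (bounce K w rm * (sw K w p *
      (pibar_op K w k * (sw K w (rev p) * bounce K w (rcons rm i))))) x y <->
    exists y1 y2 y3 y4, [/\ maps (bounce K w rm) x y1, maps (sw K w p) y1 y2,
      maps (pibar_op K w k) y2 y3, maps (sw K w (rev p)) y3 y4
    & maps (bounce K w (rcons rm i)) y4 y].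
  split=> [/(maps_mulF _ _ _ m_ee)[y1 h1 /(maps_mulF _ _ _ m_sw)[y2 h2]]|].
    move=> /(maps_mulF _ _ _ m_pb)[y3 h3 /(maps_mulF _ _ _ m_sw')[y4 h4 h5]].
    by exists y1, y2, y3, y4.
  case=> [y1 [y2 [y3 [y4 [h1 h2 h3 h4 h5]]]]].
  apply/(maps_mulF _ _ _ m_ee); exists y1 => //.
  apply/(maps_mulF _ _ _ m_sw); exists y2 => //.
  apply/(maps_mulF _ _ _ m_pb); exists y3 => //.
  by apply/(maps_mulF _ _ _ m_sw'); exists y4.
split=> [|x y|x].
- apply/mapsE; exists m, ma, ma, m; split=> //.
  + exact: bounce_fix.
  + by rewrite maps_pibar /upi /downi /= (negbTE (norm_asc_mul kd kB aP)) masw eqxx.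
  + exact: maps_sw_rev.
  + exact: bounce_step.
- case/mapsE=> [y1 [y2 [y3 [y4 [_ _ _ _ h5]]]]].
  by have [] := bounce_image rvr h5; rewrite rvE.
case/mapsE=> [y1 [y2 [y3 [y4 [h1 h2 h3 h4 h5]]]]].
have y4v : bruhat (val y4) (val v) := bounce_bruhat h5.
have [my1 sy1] := bounce_image rmr h1; rewrite rmE in my1 sy1.
have my2 := maps_sw_filter pd my1 h2.
move: (h3); rewrite maps_pibar => /andP[y2w /eqP y3E].
have my3 : bruhat (val m) (val y3).
  by rewrite y3E; have := downi_mono k my2; rewrite {1}/downi (negbTE kd).
have pd' : all (fun j => ~~ right_descent (val m) j) (rev p) by rewrite all_rev.
have my4 := maps_sw_filter pd' my3 h4.
have h4' : maps (sw K w p) y4 y3 by have := maps_sw_rev h4; rewrite revK.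
have y3k : rle (val y3 * 's_k)%g w.
  move: y2w; rewrite y3E /upi /downi; case: ifP => //.
  by rewrite mul_genK.
(* [y4] lies between [m] and [v], so it is one of them. If it were [v], the first letter [i] would
   bring it to [m], and [y3] would be [m] times a subword of [r]: shorter than [a], yet with
   [y3 * 's_k] in the interval. *)
have [y4E|lt] := bruhat_ell my4; last first.
  have y4E : y4 = v by apply: val_inj; apply: bruhat_anti_ell y4v _; rewrite lv.
  case/negP: (ltnn (ell a)); move: h4'; rewrite y4E /sw big_cons.
  case/(maps_mulF _ _ _ (monoid_s K w i))=> z; rewrite maps_s vE mul_genK (valP m).
  move=> /eqP/val_inj -> /maps_sw_sub[r' [sr' y3E']].
  have r'B : all (mem (norm_asc (val m))) r'.
    apply/allP=> j /(mem_subseq sr') jr; apply: (allP aB).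
    by rewrite inE jr orbT.
  have := amin (wprod r') (wprod_parabolic r'B); rewrite -y3E' => /(_ y3k) le.
  apply: leq_ltn_trans (le) _; rewrite (eqP ra) /= ltnS.
  exact: leq_trans (ell_wprod _) (size_subseq sr').
have y4m : y4 = m by apply: val_inj.
have y3ma : y3 = ma by rewrite y4m in h4'; exact: maps_uniq h4' path.
(* The two preimages of [m * a] under [pibar_k]. The first leads back to [y1 = m]; for the second,
   [y1] would be [m * a * 's_k] times an element of [W_B] and still end with [m], which
   [suffix_norm_asc] forbids. *)
have [y2E|y2E] : val y2 = val ma \/ val y2 = (val ma * 's_k)%g.
  move: y3E; rewrite y3ma /downi; case: ifP => _ ->; last by left.
  by right; rewrite mul_genK.
- have y2ma : y2 = ma by apply: val_inj.
  have y1m : y1 = m.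
    rewrite y2ma in h2; apply: maps_uniq (maps_sw_rev h2) (maps_sw_rev path).
  by rewrite -y1m; apply: bounce_bruhat h1.
have [r' [sr' y2E']] := maps_sw_sub h2.
have r'B : all (mem (norm_asc (val m))) r'.
  by apply/allP=> j /(mem_subseq sr') jr; apply: (allP aB).
case/negP: (suffix_norm_asc kd kB aP (groupVr (wprod_parabolic r'B))).
have -> : (val m * (a * 's_k * (wprod r')^-1) = val y1)%g => //.
by apply: (mulIg (wprod r')); rewrite -y2E' y2E !mulgA mulgKV.
Qed.

(** A longest reachable [m] above [u] is shown to be a cutting point. The hypothesis on blocks then
    puts [v] below [m], and [reach_rle] descends to it. *)
Lemma reach_Jblock u v : Jblock u \subset Jblock v -> reach K u v.
Proof.
move=> uv; pose P := [pred t : X | rle (val u) (val t) && `[< reach K u t >]].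
have Pu : P u by rewrite /= rle_refl; apply/asboolP/reach_refl.
have [m /andP[um /asboolP rum] mmax] := arg_maxnP (fun t : X => ell (val t)) Pu.
apply: (reach_trans rum).
have maxm i t : ~~ right_descent (val m) i -> val t = (val m * 's_i)%g ->
    ~ reach K m t.
  move=> d tE rmt; have : P t.
    rewrite /= tE (rle_trans um) ?rle_asc //=.
    by apply/asboolP/(reach_trans rum).
  by move/mmax; rewrite /= tE (ell_asc d) ltnn.
pose B := norm_asc (val m); have mm : lmin B (val m)^-1%g := lmin_norm_asc _.
pose b := ((val m)^-1 * w)%g; have wE : (val m * b)%g = w by rewrite mulKVg.
have lw : ell w = (ell (val m) + ell b)%N by apply/eqP; exact: (valP m).
pose c := lpart B b; pose d := lquo B b; have bE : b = (c * d)%g by rewrite lpart_lquo.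
have cB : c \in parabolic B := lpart_in _ _; have dm : lmin B d := lquo_min _ _.
have lb : ell b = (ell c + ell d)%N by rewrite bE (lmin_ell cB dm).
(* Here [w] lies in [m W_B]. Conjugating [B] by [m^-1] gives generators indexed by a left block [J],
   whose cutting point is [m]. *)
have [d1|d1] := eqVneq d 1%g.
  pose J := [set j | [exists i in B, 's_i ^ (val m)^-1 == 's_j]%g].
  have JE : (parabolic B :^ (val m)^-1 = parabolic J)%g.
    rewrite /parabolic -genJ; congr <<_>>%g; apply/setP=> t.
    rewrite mem_conjg invgK; apply/idP/idP=> [/imsetP[i iB tE]|/imsetP[j]].
      have [j jE] := norm_asc_gen iB.
      have -> : t = 's_j by rewrite -jE -tE conjgK.
      by rewrite imset_f // inE; apply/exists_inP; exists i => //; rewrite jE.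
    rewrite inE => /exists_inP[i iB /eqP jE] ->.
    by rewrite -jE conjgKV imset_f.
  have wc : (val m * c)%g = w by have := wE; rewrite bE d1 mulg1.
  have JB : left_block w J.
    apply/left_blockP; exists B.
    by rewrite -JE -[X in (_ :^ X)%g]wc conjsgM conjsgKV (conjGid cB).
  have Jm : lquo J w = val m.
    apply: lquo_uniq.
      rewrite mem_rcoset -[X in (_ * X^-1)%g]wc invMg mulgA -JE mem_conjg invgK /conjg.
      by rewrite !mulgA mulVg mul1g mulgKV groupV.
    rewrite lmin_desc; apply/forall_inP=> j; rewrite inE => /exists_inP[i iB /eqP jE].
    rewrite left_descentE -jE -right_descentE.
    by move: iB; rewrite inE => /andP[].
  have [J' J'r J'E] := exists_reduced_block JB; rewrite Jm in J'E.
  apply: reach_rle; rewrite -J'E -sub_Jblock // (subset_trans _ uv) //.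
  by rewrite sub_Jblock // J'E.
(* The first letter of [d] leads out of the coset [m W_B]: [k] is not in [B], as [d] is minimal, and
   [m * c * 's_k] is still below [w]. *)
have [k _ kd] : exists2 k, ~~ right_descent 1%g k & rle (1 * 's_k)%g d.
  by apply: rle_word_split; rewrite ?rle1 // eq_sym.
rewrite mul1g in kd.
have kB : k \notin B.
  apply/negP=> kB; have kd' : 's_k \in invs d.
    by move: kd; rewrite rleE => /subsetP; apply; rewrite invs_gen.
  by have := lminP dm kd'; rewrite gen_mem_parabolic.
have ld : ell d = (ell (('s_k)^-1 * d)%g).+1 by move: kd; rewrite /rle ell_gen => /eqP.
have Ew : (val m * c * 's_k * (('s_k)^-1 * d))%g = w.
  by rewrite -mulgA mulKVg -mulgA -bE.
have := ell_mul (val m * c * 's_k)%g (('s_k)^-1 * d)%g; rewrite Ew => lmck.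
have lmc := ell_mul (val m) c; have lmck' := ell_mul (val m * c)%g 's_k.
rewrite ell_gen in lmck'.
have mckw : rle (val m * c * 's_k)%g w.
  have : rle (val m * c * 's_k)%g (val m * c * 's_k * (('s_k)^-1 * d))%g.
    rewrite rleM Ew eqn_leq lmck lw lb ld /= addnA -addSnnS leq_add2r.
    by apply: (leq_trans lmck'); rewrite addn1 ltnS.
  by rewrite Ew.
(* If [k] were a descent of [m], so would be the reflection ['s_k ^ c^-1], as [c] normalises the
   right inversions of [m]; then [m * c * 's_k] would be too short for the reduced factorisation of
   [w]. *)
have kdm : ~~ right_descent (val m) k.
  apply/negP; rewrite right_descentV => kR.
  have nc : (c^-1 \in 'N(invs (val m)^-1))%g.
    by rewrite groupV (subsetP (norm_asc_sub _) _ cB).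
  have : ('s_k ^ c^-1 \in invs (val m)^-1)%g by rewrite memJ_norm.
  rewrite in_invsV ?reflJ ?refl_gen // => lt.
  have := ell_mul (val m * 's_k ^ c^-1)%g c.
  rewrite mul_conjV.
  rewrite leqNgt => /negP[]; apply: (leq_trans (n := (ell (val m) + ell c)%N)).
    by rewrite ltn_add2r.
  rewrite -(leq_add2r (ell (('s_k)^-1 * d)%g)); apply: leq_trans lmck.
  by rewrite lw lb ld addnA leq_add2l.
(* A shortest exit [a] from the coset. If [a = 1], then [reach_asc] reaches [m * 's_k]; otherwise
   [reach_broken] reaches [m * 's_i] for the first letter [i] of [a]. Both contradict the maximality
   of [m]. *)
pose Q := [pred a | (a \in parabolic B) && rle (val m * a * 's_k)%g w].
have Qc : Q c by rewrite /= cB.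
have [a /andP[aB aw] amin] := arg_minnP (@ell C) Qc.
have [[|i r] [rB ra sz]] := parabolic_word aB.
  move: aw; rewrite -ra wprod_nil mulg1 => mkw.
  pose mk : X := exist _ (val m * 's_k)%g mkw.
  have rk : reach K m mk by apply: (@reach_asc C K w m mk k).
  by case: (maxm k mk).
have mapw : rle (val m * a)%g w.
  by apply: rle_trans aw; rewrite rle_asc norm_asc_mul.
have rr : reduced (C := C) (i :: r) by rewrite /reduced ra sz.
have miw : rle (val m * 's_i)%g w.
  apply: rle_trans mapw; rewrite -ra -wprod_seq1.
  exact: (@rle_cat_parabolic _ [:: i] r).
have id : ~~ right_descent (val m) i.
  by case/andP: rB; rewrite /= inE => /andP[].
pose mi : X := exist _ (val m * 's_i)%g miw.
suff ri : reach K m mi by case: (maxm i mi).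
apply: (@reach_broken m mi i r k) => //; first by rewrite ra.
by move=> b' b'B b'w; rewrite ra; apply: amin; rewrite /= b'B.
Qed.

End Triangular.

(** * The antisymmetric submodules *)

Section Antisymmetric.
Variables (C : coxeterSystem) (K : fieldType) (w : C).
Local Notation I := (cox_index C).
Local Notation T := (transmod K w).
Local Notation E := (transEnd K w).
Local Notation X := (rinterval w).
Local Notation tv := (tvec K w).
Implicit Types (u v z : X) (i j k : I) (J : {set I}) (f g h : E) (x y : T) (t : C).

Lemma scaleT (a b : K^o) : a *: b = a * b. Proof. by []. Qed.

Lemma left_op_coord t x v : (t * t)%g = 1%g ->
  ap (left_op K w t) x v =
  if insub (t * val v)%g is Some v' then x v' else - x v.
Proof.
move=> tt; rewrite basis_opE sum_ffunE; case: insubP => [v' v'w v'E|vw].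
  have tv' : (t * val v' = val v)%g by rewrite v'E mulgA tt mul1g.
  rewrite (bigD1 v') //= !ffunE tv' (valP v) !ffunE eqxx scaleT mulr1.
  rewrite big1 ?addr0 // => u uv'; rewrite !ffunE scaleT.
  case: ifPn => tuw; rewrite !ffunE.
    case: eqP => [E'|_]; rewrite ?mulr0 //; case/eqP: uv'; apply: val_inj.
    by rewrite v'E E' mulgA tt mul1g.
  case: eqP => [E'|_]; rewrite ?oppr0 ?mulr0 //.
  by rewrite -E' -v'E (valP v') in tuw.
rewrite (bigD1 v) //= !ffunE (negbTE vw) !ffunE eqxx scaleT mulrN1.
rewrite big1 ?addr0 // => u uv; rewrite !ffunE scaleT.
case: ifPn => tuw; rewrite !ffunE.
  case: eqP => [E'|_]; rewrite ?mulr0 //; case/negP: vw.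
  by rewrite E' mulgA tt mul1g (valP u).
by rewrite (inj_eq val_inj) eq_sym (negbTE uv) oppr0 mulr0.
Qed.

(** Where [t * v] leaves the interval, [left_op t] negates the coordinate and the condition is
    empty; only pairs inside the interval impose a relation. *)
Lemma antisymP J x : reflect
  (forall t v v', t \in reflections J -> val v' = (t * val v)%g -> x v' = - x v)
  (x \in antisym K w J).
Proof.
have tt t : t \in reflections J -> (t * t)%g = 1%g.
  by move=> tJ; apply: reflK; apply: subsetP tJ; apply: reflectionsS; apply: subsetT.
rewrite memvE; apply: (iffP subv_bigcapP) => [h t v v' tJ v'E|h t tJ].
  have := h t tJ; rewrite -memvE memv_ker add_lfunE id_lfunE => /eqP/ffunP/(_ v).
  rewrite !ffunE -[X in X + _]/(ap (left_op K w t) x v) left_op_coord ?tt //.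
  by rewrite -v'E valK => /eqP; rewrite addr_eq0 => /eqP.
rewrite -memvE memv_ker add_lfunE id_lfunE; apply/eqP/ffunP=> v.
rewrite !ffunE -[X in X + _]/(ap (left_op K w t) x v) left_op_coord ?tt //.
by case: insubP => [v' _ v'E|_]; rewrite ?(h t v v' tJ v'E) addNr.
Qed.

Lemma antisymS J J' x : J \subset J' -> x \in antisym K w J' -> x \in antisym K w J.
Proof.
move=> JJ' /antisymP h; apply/antisymP=> t v v' tJ; apply: h.
exact: subsetP (reflectionsS JJ') t tJ.
Qed.

Lemma ap_coord f x v : ap f x v = \sum_u x u * ap f (tv (val u)) v.
Proof.
rewrite {1}(transmod_sum x) /ap linear_sum sum_ffunE.
by apply: eq_bigr => u _; rewrite linearZ /= ffunE.
Qed.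

Lemma upi_eq (a b : C) i :
  (b == upi a i) = right_descent b i && ((a == b) || (a == b * 's_i)%g).
Proof.
rewrite /upi; case: ifPn => ad.
  rewrite eq_sym; case: eqVneq => [<-|ab]; first by rewrite ad.
  case: eqP => [aE|]; rewrite ?andbF // andbT.
  by move: ad; rewrite aE right_descentM => /negbTE.
have [aE|aE] := eqVneq a (b * 's_i)%g.
  by rewrite aE mul_genK eqxx orbT andbT -[b in RHS](mul_genK b i) -aE right_descentM ad.
rewrite orbF; case: eqVneq => [bE|_]; first by rewrite bE mul_genK eqxx in aE.
by case: eqVneq => [<-|_]; rewrite ?andbF // (negbTE ad).
Qed.

Lemma downi_eq (a b : C) i :
  (b == downi a i) = ~~ right_descent b i && ((a == b) || (a == b * 's_i)%g).
Proof.
rewrite /downi; case: ifPn => ad.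
  have [aE|aE] := eqVneq a (b * 's_i)%g.
    by rewrite aE mul_genK eqxx orbT andbT -[b in RHS](mul_genK b i) -aE right_descentM ad.
  rewrite orbF; case: eqVneq => [bE|_]; first by rewrite bE mul_genK eqxx in aE.
  by case: eqVneq => [<-|_]; rewrite ?andbF // ad.
rewrite eq_sym; case: eqVneq => [<-|ab]; first by rewrite ad.
case: eqP => [aE|]; rewrite ?andbF // andbT.
by move: ad; rewrite aE right_descentM negbK => ->.
Qed.

Lemma val_mul_gen_neq v i : (val v != val v * 's_i :> C)%g.
Proof.
apply/eqP=> E; case: (boolP (right_descent (val v) i)) => [/ell_desc|/ell_asc].
  by rewrite -E; lia.
by rewrite -E; lia.
Qed.

Lemma pi_coord0 i x v : ~~ right_descent (val v) i -> ap (pi_op K w i) x v = 0.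
Proof.
move=> d; rewrite ap_coord big1 // => u _.
by rewrite pi_tvec tvecE upi_eq (negbTE d) mulr0.
Qed.

Lemma pi_coord i x v v' : right_descent (val v) i -> val v' = (val v * 's_i)%g ->
  ap (pi_op K w i) x v = x v + x v'.
Proof.
move=> d v'E; have vv' : v' != v.
  by apply: contra (val_mul_gen_neq v i) => /eqP E; rewrite -v'E E.
rewrite ap_coord (bigD1 v) //= (bigD1 v') //= big1 => [|u /andP[uv uv']].
  by rewrite !pi_tvec !tvecE !upi_eq d v'E !eqxx orbT !mulr1 addr0.
by rewrite pi_tvec tvecE upi_eq -v'E !(inj_eq val_inj) (negbTE uv) (negbTE uv') andbF mulr0.
Qed.

Lemma pibar_coord0 i x v : right_descent (val v) i || ~~ rle (val v * 's_i)%g w ->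
  ap (pibar_op K w i) x v = 0.
Proof.
move=> h; rewrite ap_coord big1 // => u _; rewrite pibar_tvec.
case: ifPn => uw; last by rewrite ffunE mulr0.
rewrite tvecE; case: eqP => [vE|_]; rewrite ?mulr0 //.
move: h uw; rewrite vE /downi /upi; case: ifPn => d.
  by rewrite right_descentM d mul_genK (valP u).
by rewrite (negbTE d) /= => /negbTE->.
Qed.

Lemma pibar_coord i x v v' : ~~ right_descent (val v) i -> val v' = (val v * 's_i)%g ->
  ap (pibar_op K w i) x v = x v + x v'.
Proof.
move=> d v'E; have vv' : v' != v.
  by apply: contra (val_mul_gen_neq v i) => /eqP E; rewrite -v'E E.
have v'w : rle (val v * 's_i)%g w by rewrite -v'E (valP v').
rewrite ap_coord (bigD1 v) //= (bigD1 v') //= big1 => [|u /andP[uv uv']].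
  rewrite !pibar_tvec /upi v'E right_descentM d v'w (negbTE d) v'w.
  by rewrite !tvecE !downi_eq d !eqxx orbT !mulr1 addr0.
rewrite pibar_tvec; case: ifP => _; last by rewrite ffunE mulr0.
by rewrite tvecE downi_eq -v'E !(inj_eq val_inj) (negbTE uv) (negbTE uv') andbF mulr0.
Qed.

Lemma conj_gen_mul (a : C) i : ('s_i ^ a^-1 * a = a * 's_i)%g.
Proof. by rewrite -conjgCV. Qed.

Section Stability.
Variable J : {set I}.
Implicit Type (a : C).

(** A reflection of [W_J] can change the descent at [i] only if [a * 's_i = t' * a] for a reflection
    [t'] of [W_J]. Then antisymmetry makes the coordinates at [a] and [a * 's_i] cancel. *)
Lemma descent_change t a i : t \in reflections J -> right_descent a i ->
  ~~ right_descent (t * a)%g i -> ('s_i ^ a^-1)%g \in reflections J.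
Proof.
move=> tJ d; rewrite right_descentE invMg conjgM.
rewrite invsM conjgKV -right_descentE d addbT negbK.
move/(invs_parabolic (reflections_parabolic tJ)).
by rewrite (reflectionsJ _ (groupVr (reflections_parabolic tJ))).
Qed.

Lemma antisym_gen x v v' i : x \in antisym K w J ->
  ('s_i ^ (val v)^-1)%g \in reflections J -> val v' = (val v * 's_i)%g -> x v' = - x v.
Proof.
move=> /antisymP xJ tJ v'E; apply: xJ tJ _.
by rewrite v'E conj_gen_mul.
Qed.

Lemma reflectionsK t : t \in reflections J -> (t * t)%g = 1%g.
Proof. by move=> tJ; apply: reflK; apply: subsetP tJ; apply: reflectionsS; apply: subsetT. Qed.

Lemma conj_gen_refl t a i : t \in reflections J ->
  ('s_i ^ (t * a)^-1 \in reflections J)%g = ('s_i ^ a^-1 \in reflections J)%g.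
Proof.
by move=> tJ; rewrite invMg conjgM (reflectionsJ _ (groupVr (reflections_parabolic tJ))).
Qed.

Lemma exists_desc v i : right_descent (val v) i -> exists v', val v' = (val v * 's_i)%g.
Proof.
move=> d; have vw : rle (val v * 's_i)%g w by apply: rle_trans (rle_desc d) (valP v).
by exists (exist _ (val v * 's_i)%g vw).
Qed.

Lemma pi_antisym i x : x \in antisym K w J -> ap (pi_op K w i) x \in antisym K w J.
Proof.
move=> xJ; have xJ' := antisymP _ _ xJ; apply/antisymP=> t v v' tJ v'E.
have vE : val v = (t * val v')%g by rewrite v'E mulgA reflectionsK ?mul1g.
have zero z z' : val z' = (t * val z)%g -> right_descent (val z) i ->
    ~~ right_descent (val z') i -> ap (pi_op K w i) x z = 0.
  move=> z'E d d'; have [z1 z1E] := exists_desc d.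
  rewrite (pi_coord _ d z1E) (antisym_gen xJ _ z1E) ?subrr //.
  by apply: (descent_change tJ d); rewrite -z'E.
have [d|d] := boolP (right_descent (val v) i); have [d'|d'] := boolP (right_descent (val v') i).
- have [v1 v1E] := exists_desc d; have [v1' v1'E] := exists_desc d'.
  rewrite (pi_coord _ d v1E) (pi_coord _ d' v1'E) opprD (xJ' t v v') //.
  by rewrite (xJ' t v1 v1') // v1'E v1E v'E mulgA.
- by rewrite (zero v v') // pi_coord0 // oppr0.
- by rewrite (zero v' v) // [X in _ = - X]pi_coord0 // oppr0.
by rewrite !pi_coord0 ?oppr0.
Qed.

Lemma pibar_antisym i x : left_block w J ->
  x \in antisym K w J -> ap (pibar_op K w i) x \in antisym K w J.
Proof.
move=> JB xJ; have xJ' := antisymP _ _ xJ; apply/antisymP=> t v v' tJ v'E.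
have vE : val v = (t * val v')%g by rewrite v'E mulgA reflectionsK ?mul1g.
have zero z z' : val z' = (t * val z)%g -> right_descent (val z) i ->
    ~~ right_descent (val z') i -> ap (pibar_op K w i) x z' = 0.
  move=> z'E d d'; case: (boolP (rle (val z' * 's_i)%g w)) => z'w; last first.
    by rewrite pibar_coord0 ?z'w ?orbT.
  rewrite (pibar_coord (v' := exist _ (val z' * 's_i)%g z'w) _ d') //.
  rewrite (@antisym_gen x z' (exist _ (val z' * 's_i)%g z'w) i xJ) ?subrr //.
  by rewrite z'E conj_gen_refl //; apply: (descent_change tJ d); rewrite -z'E.
(* Here the block property is used. Unless the reflection from [z] to [z * 's_i] lies in [W_J], so
   that the two coordinates cancel, it is an inversion of [w] outside [W_J]. These are stable under
   conjugation by [W_J], so [z' * 's_i] would be in the interval as well. *)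
have out z z' : val z' = (t * val z)%g -> ~~ right_descent (val z) i ->
    ~~ right_descent (val z') i -> rle (val z * 's_i)%g w ->
    ~~ rle (val z' * 's_i)%g w -> ap (pibar_op K w i) x z = 0.
  move=> z'E d d' zw z'w; pose z1 : X := exist _ (val z * 's_i)%g zw.
  rewrite (pibar_coord (v' := z1) _ d) //.
  rewrite (@antisym_gen x z z1 i xJ) ?subrr //; set t0 := ('s_i ^ _)%g.
  apply: contraR z'w => t0J; have t0nP : t0 \notin parabolic J.
    apply: contra t0J; apply: refl_in_parabolic.
    by rewrite reflJ refl_gen.
  have t0w : t0 \in invs w.
    move: (valP z1); rewrite rleE => /subsetP; apply.
    by rewrite invs_mul_gen eqxx -right_descentE (negbTE d).
  have tP := reflections_parabolic tJ.
  rewrite rleE; apply/subsetP=> s; rewrite invs_mul_gen.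
  have [-> _|_] := eqVneq s ('s_i ^ (val z')^-1)%g; last first.
    by rewrite addbF; move: (valP z'); rewrite rleE => /subsetP; apply.
  have t0c : (t0 ^ t^-1)%g \notin parabolic J by rewrite (groupJr _ (groupVr tP)).
  rewrite z'E invMg conjgM -/t0 (block_invs_out JB t0c).
  by rewrite (block_invs_conj JB _ (groupVr tP)) -(block_invs_out JB t0nP).
have [d|d] := boolP (right_descent (val v) i); have [d'|d'] := boolP (right_descent (val v') i).
- by rewrite !pibar_coord0 ?d ?d' ?oppr0.
- by rewrite (zero v v') // pibar_coord0 ?d // oppr0.
- by rewrite [X in _ = - X](zero v' v) // pibar_coord0 ?d' // oppr0.
have [vw|vw] := boolP (rle (val v * 's_i)%g w); have [v'w|v'w] := boolP (rle (val v' * 's_i)%g w).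
- rewrite (pibar_coord (v' := exist _ (val v * 's_i)%g vw) _ d) //.
  rewrite (pibar_coord (v' := exist _ (val v' * 's_i)%g v'w) _ d') //.
  rewrite opprD (xJ' t v v') //; congr (_ + _); apply: (xJ' t) => //=.
  by rewrite v'E mulgA.
- by rewrite (out v v') // pibar_coord0 ?v'w ?orbT // oppr0.
- by rewrite [LHS](out v' v) // pibar_coord0 ?vw ?orbT // oppr0.
by rewrite !pibar_coord0 ?vw ?v'w ?orbT ?oppr0.
Qed.

End Stability.
End Antisymmetric.

(** * A basis adapted to the antisymmetric submodules *)

Section AdaptedBasis.
Variables (C : coxeterSystem) (K : fieldType) (w : C).
Local Notation I := (cox_index C).
Local Notation T := (transmod K w).
Local Notation E := (transEnd K w).
Local Notation X := (rinterval w).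
Local Notation tv := (tvec K w).
Implicit Types (u v z : X) (i j k : I) (J : {set I}) (f g h : E) (x y : T) (t a : C).

(** The signed sum over the coset [W_{J(u)} u], truncated to the interval. *)
Definition bvec u : T :=
  [ffun v : X => if (val v * (val u)^-1)%g \in parabolic (Jblock u)
                 then (-1) ^+ ell (val v * (val u)^-1)%g else 0].

Lemma odd_ell_refl t : t \in reflections [set: I] -> odd (ell t).
Proof.
move=> /reflP[i [y ->]]; rewrite /conjg !odd_ellM ellV ell_gen /=.
by case: (odd _).
Qed.

Lemma bvec_antisym J u : J \subset Jblock u -> bvec u \in antisym K w J.
Proof.
move=> /antisymS; apply; apply/antisymP=> t v v' tJ v'E; rewrite !ffunE v'E -mulgA.
have tP := reflections_parabolic tJ; rewrite (groupMl _ tP).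
case: ifP => _; last by rewrite oppr0.
have tR := subsetP (reflectionsS (subsetT _)) t tJ.
by rewrite -signr_odd odd_ellM odd_ell_refl // -[in RHS]signr_odd /= signrN.
Qed.

Lemma bvec_diag u : bvec u u = 1.
Proof. by rewrite ffunE mulgV group1 ell1. Qed.

Lemma Jblock_lmin u : lmin (Jblock u) (val u).
Proof. by rewrite Jblock_max; case/andP: (max_blockP w (val u)). Qed.

(** [u] is the unique shortest element of its coset, so the family [bvec] is unitriangular for
    length in every characteristic. *)
Lemma bvec_neq0 u v : bvec u v != 0 -> u = v \/ (ell (val u) < ell (val v))%N.
Proof.
rewrite ffunE; case: ifP => [aP _|_]; last by rewrite eqxx.
set a := (val v * _)%g in aP; have vE : val v = (a * val u)%g by rewrite mulgKV.
rewrite vE (lmin_ell aP (Jblock_lmin u)).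
have [a0|a0] := eqVneq (ell a) 0%N; last by right; rewrite -add1n leq_add2r lt0n.
by left; apply: val_inj; rewrite vE; move/eqP: a0; rewrite ell_eq0 => /eqP->; rewrite mul1g.
Qed.

Definition gmat : E := basis_op (fun a => oapp bvec 0 (insub a : option X)).

Lemma gmat_tvec u : ap gmat (tv (val u)) = bvec u.
Proof. by rewrite basis_op_tvec valK. Qed.

Lemma gmatE x : ap gmat x = \sum_u x u *: bvec u.
Proof. by rewrite basis_opE; apply: eq_bigr => u _; rewrite valK. Qed.

Lemma bvec_sum_lead (c : X -> K) u : (forall v, (ell (val v) < ell (val u))%N -> c v = 0) ->
  (\sum_v c v *: bvec v : T) u = c u.
Proof.
move=> c0; rewrite sum_ffunE (bigD1 u) //= ffunE bvec_diag scaleT mulr1 big1 ?addr0 // => v vu.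
rewrite ffunE scaleT; have [->|/bvec_neq0] := eqVneq (bvec v u) 0; first by rewrite mulr0.
by case=> [E|/c0->]; [rewrite E eqxx in vu | rewrite mul0r].
Qed.

Lemma min_support (P : pred X) : (exists u, P u) ->
  exists2 u, P u & forall v, (ell (val v) < ell (val u))%N -> ~~ P v.
Proof.
case=> u0 Pu0; have [u Pu umin] := arg_minnP (fun u : X => ell (val u)) Pu0.
by exists u => // v; apply: contraL => /umin; rewrite -leqNgt.
Qed.

Lemma lker_gmat : lker (gmat : 'End(T)) == 0%VS.
Proof.
rewrite -subv0; apply/subvP=> x; rewrite memv_ker memv0 -[X in X == 0]/(ap gmat x) gmatE.
move=> x0; apply: contraT => xn0.
have : exists u, x u != 0.
  apply/existsP; apply: contraNT xn0 => /existsPn h.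
  by apply/eqP/ffunP=> u; rewrite ffunE; apply/eqP; rewrite -[_ == _]negbK h.
case/min_support=> u xu umin; case/eqP: xu.
rewrite -(@bvec_sum_lead (fun v => x v) u); first by rewrite (eqP x0) ffunE.
by move=> v /umin /negPn/eqP.
Qed.

Definition ginv : E := (gmat : 'End(T))^-1%VF.

Lemma gmatK x : ap ginv (ap gmat x) = x.
Proof. exact: (lker0_lfunK lker_gmat). Qed.

Lemma ginvK x : ap gmat (ap ginv x) = x.
Proof. exact: (lker0_lfunVK lker_gmat). Qed.

Lemma gmat_ginv : gmat * ginv = 1.
Proof. by apply: ap_ext => u; rewrite apM ap1 gmatK. Qed.
Lemma ginv_gmat : ginv * gmat = 1.
Proof. by apply: ap_ext => u; rewrite apM ap1 ginvK. Qed.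

Lemma bvec_exp x : x = \sum_u ap ginv x u *: bvec u.
Proof. by rewrite -gmatE ginvK. Qed.

Lemma ginv_bvec u v : ap ginv (bvec u) v = (v == u)%:R.
Proof. by rewrite -gmat_tvec gmatK tvecE (inj_eq val_inj). Qed.

Section AntisymCoord.
Variables (J : {set I}) (JB : left_block w J).

Lemma lquo_interval v : rle (lquo J (val v)) (lquo J w).
Proof.
have xm := lquo_min J (val v); have aJ := lpart_in J (val v).
rewrite rleE; apply/subsetP=> t tx; have tJ := lminP xm tx.
have taJ : (t ^ (lpart J (val v))^-1)%g \notin parabolic J.
  by rewrite (groupJr _ (groupVr aJ)).
rewrite -(block_invs_conj JB _ (groupVr aJ)) -(block_invs_out JB taJ).
have := valP v; rewrite rleE => /subsetP; apply.
by rewrite -[X in _ \in invs X](lpart_lquo J (val v)) (lmin_invs_out _ aJ taJ) conjgKV.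
Qed.

Lemma block_interval a (x0 : C) : a \in parabolic J -> lmin J x0 ->
  rle x0 (lquo J w) -> (invs a \subset invs w) -> rle (a * x0)%g w.
Proof.
move=> aJ xm x0w aw; rewrite rleE; apply/subsetP=> t.
have [tJ|tJ] := boolP (t \in parabolic J).
  by rewrite (lmin_invs_in aJ xm tJ) => /(subsetP aw).
rewrite (lmin_invs_out _ aJ tJ) (block_invs_out JB tJ) -(block_invs_conj JB _ aJ).
by move: x0w; rewrite rleE => /subsetP; apply.
Qed.

(** Antisymmetry relates only elements of the interval. By [block_interval] the path from [v] down
    to the shortest element of [W_J v], along a reduced word, stays inside, so the sign can be
    carried along it. *)
Lemma antisym_zero x v : x \in antisym K w J ->
  (forall z, val z = lquo J (val v) -> x z = 0) -> x v = 0.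
Proof.
move=> /antisymP xJ; have xm := lquo_min J (val v); have aJ := lpart_in J (val v).
have x0w := lquo_interval v; have vE := lpart_lquo J (val v).
have aw : invs (lpart J (val v)) \subset invs w.
  have vw : invs (val v) \subset invs w by rewrite -rleE; exact: (valP v).
  apply: subset_trans vw.
  by apply/subsetP=> t; rewrite invs_lpartE inE => /andP[].
move: aJ vE aw; set x0 := lquo J (val v) in xm x0w *.
case/parabolic_word=> r [rJ <- sz] vE aw x0z.
have {sz} rr : reduced (C := C) r by rewrite /reduced sz.
elim/last_ind: r v @x0 xm x0w rJ rr vE aw x0z => [|r j IH] v x0 xm x0w rJ rr vE aw x0z.
  by apply: x0z; rewrite -vE wprod_nil mul1g.
have [jJ rJ'] : j \in J /\ all (mem J) r by move: rJ; rewrite all_rcons => /andP[].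
have aJ' : wprod r \in parabolic J := wprod_parabolic rJ'.
have [rr' d] := reduced_rcons rr.
have aw' : invs (wprod r : C) \subset invs w.
  by apply: subset_trans aw; rewrite -rleE wprod_rcons rle_asc.
have zw := block_interval aJ' xm x0w aw'.
pose z : X := exist _ (wprod r * x0)%g zw.
have -> : x v = - x z.
  apply: (xJ ('s_j ^ (wprod r)^-1)%g).
    by rewrite (reflectionsJ _ (groupVr aJ')); apply: reflections_gen.
  by rewrite -vE /= wprod_rcons mulgA conj_gen_mul.
apply/eqP; rewrite oppr_eq0; apply/eqP.
have zE : lquo J (val z) = x0.
  by apply: lquo_uniq => //; rewrite rcoset_sym mem_rcoset /= mulgK.
by apply: IH; rewrite ?zE.
Qed.

End AntisymCoord.
End AdaptedBasis.

(** * The algebra as a stabiliser *)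

Section Stabiliser.
Variables (C : coxeterSystem) (K : fieldType) (w : C).
Local Notation I := (cox_index C).
Local Notation T := (transmod K w).
Local Notation E := (transEnd K w).
Local Notation X := (rinterval w).
Local Notation tv := (tvec K w).
Implicit Types (u v z : X) (i j k : I) (J : {set I}) (f g h : E) (x y : T).

(** The adapted basis property. The part [y] of [x] carried by the [bvec v] with [J] not inside
    [Jblock v] is again antisymmetric, and the aim is to show that it vanishes. *)
Lemma antisym_coef J x : reduced_left_block w J ->
  reflect (forall v, ~~ (J \subset Jblock v) -> ap (ginv K w) x v = 0)
          (x \in antisym K w J).
Proof.
move=> Jr; have [JB _] := andP Jr; apply: (iffP idP) => [xJ|h]; last first.
  rewrite (bvec_exp x) memv_suml // => v _.
  have [sub|nsub] := boolP (J \subset Jblock v); first by rewrite memvZ ?bvec_antisym.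
  by rewrite h // scale0r mem0v.
pose c v := ap (ginv K w) x v; pose c' v := if J \subset Jblock v then 0 else c v.
pose y : T := \sum_v c' v *: bvec K v.
have yJ : y \in antisym K w J.
  have -> : y = x - \sum_(v | J \subset Jblock v) c v *: bvec K v.
    rewrite {1}(bvec_exp x) (bigID (fun v => J \subset Jblock v)) /= addrAC subrr add0r.
    rewrite /y [RHS]big_mkcond; apply: eq_bigr => v _; rewrite /c'.
    by case: ifP; rewrite ?scale0r.
  rewrite memvB // memv_suml // => v sub; by rewrite memvZ ?bvec_antisym.
suff c'0 v : c' v = 0 by move=> v nsub; have := c'0 v; rewrite /c' (negbTE nsub).
apply/eqP; apply: contraT => c'v; have ex : exists v, c' v != 0 by exists v.
(* At a shortest [u] in the support, [y u] is the coefficient itself. The shortest element [z] of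
   [W_J u] is either shorter, and then [y z = 0], or equal to [u], and then [J] is inside
   [Jblock u]. *)
have [u c'u umin] := min_support ex; case/eqP: c'u.
have umin' v' : (ell (val v') < ell (val u))%N -> c' v' = 0 by move/umin/negPn/eqP.
rewrite -(bvec_sum_lead umin'); apply: (antisym_zero JB yJ) => z zE.
have zu : (ell (val z) < ell (val u))%N \/ val z = val u.
  rewrite -[X in (_ < ell X)%N](lpart_lquo J (val u)).
  rewrite (lmin_ell (lpart_in J (val u)) (lquo_min J (val u))) -zE.
  have [a0|a0] := eqVneq (ell (lpart J (val u))) 0%N.
    right; rewrite zE; move/eqP: a0; rewrite ell_eq0 => /eqP a1.
    by rewrite -[RHS](lpart_lquo J (val u)) a1 mul1g.
  by left; rewrite -add1n leq_add2r lt0n.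
case: zu => [zu|zu]; last first.
  have um : J \subset Jblock u.
    by rewrite sub_Jblock // rle_lquoE ?(valP u) // -zu zE lquo_min.
  by rewrite (val_inj zu) bvec_sum_lead // /c' um.
by rewrite bvec_sum_lead ?umin' // => v' v'z; apply: umin'; apply: ltn_trans zu.
Qed.

(** The matrix of [f] in the basis [bvec], row [u] being the image of [bvec u]. Products of right
    operators become matrix products without reversal. *)
Definition cf f u v : K := ap (gmat K w * f * ginv K w) (tv (val u)) v.

Lemma cfE f u v : cf f u v = ap (ginv K w) (ap f (bvec K u)) v.
Proof. by rewrite /cf !apM gmat_tvec. Qed.

Lemma ap_bvec f u : ap f (bvec K u) = \sum_v cf f u v *: bvec K v.
Proof. by rewrite {1}(bvec_exp (ap f _)); apply: eq_bigr => v _; rewrite cfE. Qed.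

Lemma cfM f g u t : cf (f * g) u t = \sum_v cf f u v * cf g v t.
Proof.
rewrite /cf; set A := gmat K w * f * _; have -> : gmat K w * (f * g) * ginv K w =
  A * (gmat K w * g * ginv K w).
  by rewrite /A !mulrA -[_ * ginv K w * gmat K w]mulrA ginv_gmat mulr1.
by rewrite apM ap_coord.
Qed.

Lemma cf1 u v : cf 1 u v = (u == v)%:R.
Proof. by rewrite cfE ap1 ginv_bvec eq_sym. Qed.

Lemma cf_linear u v : scalar (fun f => cf f u v).
Proof. by move=> a f g; rewrite !cfE apD apZ /ap linearD linearZ /= !ffunE. Qed.

Lemma cfD f g u v : cf (f + g) u v = cf f u v + cf g u v.
Proof. by have := cf_linear u v 1 f g; rewrite scale1r mul1r. Qed.
Lemma cfZ (a : K) f u v : cf (a *: f) u v = a * cf f u v.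
Proof. by rewrite !cfE apZ /ap linearZ ffunE. Qed.

Lemma cf_ext f g : (forall u v, cf f u v = cf g u v) -> f = g.
Proof.
move=> fg; have : gmat K w * f * ginv K w = gmat K w * g * ginv K w.
  by apply: ap_ext => u; apply/ffunP=> v; exact: fg.
move/(congr1 (fun h => ginv K w * h * gmat K w)).
by rewrite !mulrA ginv_gmat !mul1r -!mulrA !ginv_gmat !mulr1.
Qed.

Lemma exists_cf (c : X -> X -> K) : exists f, forall u v, cf f u v = c u v.
Proof.
pose F : E := basis_op (fun a => oapp (fun u => [ffun v => c u v]) 0 (insub a : option X)).
exists (ginv K w * F * gmat K w) => u v.
rewrite /cf !mulrA gmat_ginv mul1r -mulrA gmat_ginv mulr1.
by rewrite basis_op_tvec valK /= ffunE.
Qed.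

Definition stab f :=
  [forall J : RBL w, (f @: antisym K w (val J) <= antisym K w (val J))%VS].

Lemma stabP f : reflect (forall J, reduced_left_block w J ->
    forall x, x \in antisym K w J -> ap f x \in antisym K w J) (stab f).
Proof.
apply: (iffP forallP) => [h J Jr x xJ|h J].
  exact: subvP (h (exist _ J Jr)) _ (memv_img f xJ).
apply/subvP=> _ /memv_imgP[x xJ ->].
exact: (h _ (valP J)).
Qed.

Lemma stab_cf f : reflect (forall u v, ~~ (Jblock u \subset Jblock v) -> cf f u v = 0)
  (stab f).
Proof.
apply: (iffP (stabP f)) => [h u v uv|h J Jr x xJ].
  rewrite cfE; apply: (antisym_coef _ (Jblock_reduced u)) uv.
  by apply: h; rewrite ?Jblock_reduced // bvec_antisym.
rewrite {1}(bvec_exp x) /ap linear_sum memv_suml // => u _; rewrite linearZ /=.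
have [sub|nsub] := boolP (J \subset Jblock u); last first.
  by rewrite (antisym_coef _ Jr xJ u nsub) scale0r mem0v.
rewrite memvZ // -[X in X \in _]/(ap f (bvec K u)) ap_bvec memv_suml // => v _.
have [uv|uv] := boolP (Jblock u \subset Jblock v); last by rewrite h // scale0r mem0v.
by rewrite memvZ // bvec_antisym // (subset_trans sub).
Qed.

Definition stabv : {vspace E} := lker (linfun (fun f =>
  [ffun p : X * X => if Jblock p.1 \subset Jblock p.2 then 0 else cf f p.1 p.2 : K^o])).

Lemma mem_stabv f : (f \in stabv) = stab f.
Proof.
have lin : linear (fun f : E => [ffun p : X * X =>
    if Jblock p.1 \subset Jblock p.2 then 0 else cf f p.1 p.2 : K^o]).
  move=> a g h; apply/ffunP=> p; rewrite !ffunE.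
  by case: ifP => _; rewrite ?scaler0 ?addr0 // cfD cfZ.
pose F : {linear E -> {ffun X * X -> K^o}} := HB.pack (fun f : E => [ffun p : X * X =>
    if Jblock p.1 \subset Jblock p.2 then 0 else cf f p.1 p.2 : K^o])
  (GRing.isLinear.Build _ _ _ _ _ lin).
rewrite memv_ker (lfunE F); apply/eqP/stab_cf => [/ffunP F0 u v uv|h].
  by have := F0 (u, v); rewrite !ffunE /= (negbTE uv).
by apply/ffunP=> -[u v]; rewrite !ffunE /=; case: ifPn => // /h.
Qed.

Lemma dim_stabv : (\dim stabv <= #|Jpairs w|)%N.
Proof.
pose S := {p : X * X | p \in Jpairs w}.
have lin : linear (fun f : E => [ffun p : S => cf f (val p).1 (val p).2 : K^o]).
  by move=> a g h; apply/ffunP=> p; rewrite !ffunE cfD cfZ.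
pose F : {linear E -> {ffun S -> K^o}} :=
  HB.pack (fun f : E => [ffun p : S => cf f (val p).1 (val p).2 : K^o])
  (GRing.isLinear.Build _ _ _ _ _ lin).
have -> : #|Jpairs w| = dim {ffun S -> K^o}.
  by rewrite -[dim _]/(#|{: S}| * 1)%N muln1 card_sig; apply: eq_card.
rewrite -dimvf -(@limg_dim_eq _ _ _ (linfun F) stabv) ?dimvS ?subvf //.
apply/eqP; rewrite -subv0; apply/subvP=> f; rewrite memv_cap memv_ker memv0 mem_stabv.
case/andP=> /stab_cf h; rewrite lfunE => /eqP/ffunP F0; apply/eqP/cf_ext => u v.
have -> : cf 0 u v = 0 by rewrite -(scale0r f) cfZ mul0r.
have [uv|] := boolP (Jblock u \subset Jblock v); last exact: h.
have uvP : (u, v) \in Jpairs w by rewrite inE.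
by have := F0 (exist _ (u, v) uvP); rewrite !ffunE.
Qed.

Lemma stab_pi i : stab (pi_op K w i).
Proof. by apply/stabP=> J _ x; apply: pi_antisym. Qed.

Lemma stab_pibar i : stab (pibar_op K w i).
Proof. by apply/stabP=> J /andP[JB _] x; apply: pibar_antisym. Qed.

Lemma biHecke_stabv : (biHecke K w <= stabv)%VS.
Proof.
rewrite /biHecke; apply: agenv_sub_modl.
  by rewrite -memvE mem_stabv; apply/stabP=> J _ x; rewrite ap1.
apply/prodvP=> f g fU; rewrite !mem_stabv => /stabP gS.
have fS : f \in stabv.
  apply: subvP fU; apply/span_subvP=> h; rewrite mem_cat => /orP[]/mapP[i _ ->].
    by rewrite mem_stabv stab_pi.
  by rewrite mem_stabv stab_pibar.
rewrite mem_stabv in fS; have {}fS := stabP _ fS.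
by apply/stabP=> J Jr x xJ; rewrite apM; apply: gS => //; apply: fS.
Qed.

Lemma mem_biHecke_pi i : pi_op K w i \in biHecke K w.
Proof.
rewrite /biHecke; apply: (subvP (sub_agenv _)); apply: memv_span.
by rewrite mem_cat map_f ?mem_enum.
Qed.

Lemma mem_biHecke_pibar i : pibar_op K w i \in biHecke K w.
Proof.
rewrite /biHecke; apply: (subvP (sub_agenv _)); apply: memv_span.
by rewrite mem_cat orbC map_f ?mem_enum.
Qed.

Lemma mem_biHecke1 : 1 \in biHecke K w.
Proof. by rewrite memvE sub1_agenv. Qed.

Lemma monoid_biHecke f : biHecke_monoid f -> f \in biHecke K w.
Proof.
case=> r rg ->; elim: r rg => [|h r IH] rg; first by rewrite big_nil mem_biHecke1.
rewrite big_cons memvM //; last by apply: IH => g gr; apply: rg; rewrite inE gr orbT.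
have := rg h (mem_head _ _); rewrite !mem_cat => /or3P[]/mapP[i _ ->].
- exact: mem_biHecke_pi.
- exact: mem_biHecke_pibar.
by rewrite memvB ?mem_biHecke1 // memvD ?mem_biHecke_pi ?mem_biHecke_pibar.
Qed.

Lemma signed_coord f u v : biHecke_monoid f -> (ap f (tv (val u)) v != 0) = maps f u v.
Proof.
move=> /monoid_signed fs; have natr_neq0 (b : bool) : (b%:R != 0 :> K) = b.
  by case: b; rewrite ?mulr1n ?oner_eq0 ?mulr0n ?eqxx.
have vv v' : tv (val v') v = (v == v')%:R :> K.
  by rewrite tvecE (inj_eq val_inj).
case: (fs u) => [f0|[v' fv']]; first by rewrite f0 ffunE eqxx maps_0.
have -> : maps f u v = (v == v').
  by apply/idP/eqP=> [fv|->//]; exact: maps_uniq fv fv'.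
case/mapsP: fv' => ->; first by rewrite vv natr_neq0.
have -> : (- tv (val v')) v = - tv (val v') v by rewrite [LHS]ffunE.
by rewrite vv oppr_eq0 natr_neq0.
Qed.

Section TriangularFamily.
Variable F : X -> X -> E.
Hypothesis FP : forall u v, Jblock u \subset Jblock v ->
  biHecke_monoid (F u v) /\ triangular (F u v) u v.
Local Notation s := [seq F p.1 p.2 | p in Jpairs w].

(** In a relation, choose among the nonzero coefficients a pair with shortest [v] and, for that [v],
    longest [u]. Evaluate at row [u], column [v]: any other contributing element has its minimal
    image below [v], so the same [v], and its maximal preimage above [u], so the same [u]. *)
Lemma triangular_free : free s.
Proof.
rewrite -[s]/(tval (image_tuple _ _)); apply/freeP => k k0 i.
pose pr (a : 'I_#|Jpairs w|) := enum_val a.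
have prP a : Jblock (pr a).1 \subset Jblock (pr a).2.
  by have := enum_valP a; rewrite inE.
have nthE (a : 'I_#|Jpairs w|) :
    (image_tuple (fun p : X * X => F p.1 p.2) (Jpairs w))`_a = F (pr a).1 (pr a).2.
  by rewrite nth_image.
apply/eqP; apply: contraT => ki.
have [b kb bmin] := @arg_minnP _ i (fun a => k a != 0)
  (fun a => ell (val (pr a).2)) ki.
have kb' : (k b != 0) && ((pr b).2 == (pr b).2) by rewrite kb eqxx.
have [a /andP[ka /eqP av] amax] := @arg_maxnP _ b
  (fun a => (k a != 0) && ((pr a).2 == (pr b).2)) (fun a => ell (val (pr a).1)) kb'.
have [Fa Ta] := FP (prP a); have /triangularP[fa mina maxa] := Ta.
have /eqP : ap (\sum_(c < #|Jpairs w|) k c *: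
  (image_tuple (fun p : X * X => F p.1 p.2) (Jpairs w))`_c) (tv (val (pr a).1)) (pr a).2 = 0.
  by rewrite k0 /ap lfunE /= ffunE.
rewrite /ap sum_lfunE sum_ffunE (bigD1 a) //= scale_lfunE ffunE nthE big1 ?addr0.
  by rewrite mulf_eq0 (negbTE ka) /= -[_ == 0]negbK (signed_coord _ _ Fa) fa.
move=> c ca; rewrite scale_lfunE ffunE nthE scaleT.
have [Fc Tc] := FP (prP c); have /triangularP[fc minc maxc] := Tc.
have [->|kc] := eqVneq (k c) 0; first by rewrite mul0r.
apply/eqP; rewrite mulf_eq0 (negbTE kc) /=; apply: contraT.
rewrite (signed_coord _ _ Fc) => fca; case/eqP: ca; apply: enum_val_inj.
have cv : (pr c).2 = (pr b).2.
  have := minc _ _ fca; rewrite av => /bruhat_anti_ell; move/(_ (bmin c kc)).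
  exact: val_inj.
have cu : (pr c).1 = (pr a).1.
  apply/esym/val_inj; apply: bruhat_anti_ell; first by apply: maxc; move: fca; rewrite av -cv.
  by apply: amax; rewrite kc cv eqxx.
rewrite -[enum_val c]/(pr c) -[enum_val a]/(pr a) (surjective_pairing (pr c)).
by rewrite cu cv -av -surjective_pairing.
Qed.

(** A dimension squeeze: the family spans a subspace of the algebra, the algebra lies in the
    stabiliser, and the latter has dimension at most the number of pairs. *)
Lemma triangular_basis : basis_of (biHecke K w) s /\ biHecke K w = stabv :> {vspace E}.
Proof.
have sB : (<<s>> <= biHecke K w)%VS.
  apply/span_subvP=> f /imageP[[u v]] /=; rewrite inE /= => uv ->.
  by apply: monoid_biHecke; case: (FP uv).
have szs : size s = #|Jpairs w| by rewrite size_image.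
have ds : \dim <<s>> = #|Jpairs w| by rewrite -szs; apply/eqP; exact: triangular_free.
have E1 : stabv = <<s>>%VS.
  apply/eqP; rewrite eq_sym eqEdim (subv_trans sB biHecke_stabv) ds; exact: dim_stabv.
have E2 : biHecke K w = <<s>>%VS :> {vspace E}.
  by apply/eqP; rewrite eqEsubv sB andbT -E1 biHecke_stabv.
by split; [rewrite basisEfree triangular_free sB szs -ds E2 leqnn | rewrite E2].
Qed.

End TriangularFamily.

Lemma exists_triangular u v : Jblock u \subset Jblock v ->
  exists2 f : E, biHecke_monoid f & triangular f u v.
Proof.
by move=> /(reach_Jblock K)[f fF fT]; exists f => //; apply/triangularP.
Qed.

Lemma exists_triangular_family : exists F : X -> X -> E,
  forall u v, Jblock u \subset Jblock v ->
  biHecke_monoid (F u v) /\ triangular (F u v) u v.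
Proof.
have /choice[F FP] : forall p : X * X, exists f : E,
    Jblock p.1 \subset Jblock p.2 -> biHecke_monoid f /\ triangular f p.1 p.2.
  move=> [u v]; have [uv|uv] := boolP (Jblock u \subset Jblock v); last first.
    by exists 0.
  by have [f fF fT] := exists_triangular uv; exists f.
by exists (fun u v => F (u, v)) => u v; apply: (FP (u, v)).
Qed.

Lemma biHecke_stab f : (f \in biHecke K w) = stab f.
Proof.
have [F FP] := exists_triangular_family; have [_ E] := triangular_basis FP.
by rewrite E mem_stabv.
Qed.

Lemma dim_biHecke : \dim (biHecke K w) = #|Jpairs w|.
Proof.
have [F FP] := exists_triangular_family; have [B _] := triangular_basis FP.
by rewrite -(size_basis B).
Qed.

End Stabiliser.

(** * Modules over digraph algebras *)

Section RightAction.
Variables (K : fieldType) (A : algType K).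
Implicit Types (M N : lmodType A^c) (a b : A) (c : K).

Definition rmact M (x : M) a : M := (a : A^c) *: x.

Lemma rmactA M (x : M) a b : rmact (rmact x a) b = rmact x (a * b).
Proof. by rewrite /rmact scalerA. Qed.
Lemma rmact1 M (x : M) : rmact x 1 = x.
Proof. exact: scale1r. Qed.
Lemma rmact0 M (x : M) : rmact x 0 = 0.
Proof. exact: scale0r. Qed.
Lemma rmact0x M a : rmact (0 : M) a = 0.
Proof. exact: scaler0. Qed.
Lemma rmactDl M (x y : M) a : rmact (x + y) a = rmact x a + rmact y a.
Proof. exact: scalerDr. Qed.
Lemma rmactBl M (x y : M) a : rmact (x - y) a = rmact x a - rmact y a.
Proof. exact: scalerBr. Qed.
Lemma rmactDr M (x : M) a b : rmact x (a + b) = rmact x a + rmact x b.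
Proof. exact: scalerDl. Qed.
Lemma rmactBr M (x : M) a b : rmact x (a - b) = rmact x a - rmact x b.
Proof. exact: scalerBl. Qed.
Lemma rmact_sumr M (x : M) (J : finType) (P : pred J) (F : J -> A) :
  rmact x (\sum_(i | P i) F i) = \sum_(i | P i) rmact x (F i).
Proof. exact: (scaler_suml (R := A^c)). Qed.
Lemma rmact_suml M (J : finType) (P : pred J) (F : J -> M) a :
  rmact (\sum_(i | P i) F i) a = \sum_(i | P i) rmact (F i) a.
Proof. exact: scaler_sumr. Qed.
Lemma rmact_lin M N (f : {linear M -> N}) x a : f (rmact x a) = rmact (f x) a.
Proof. exact: linearZ. Qed.

Lemma kscaleE M c (x : M) : kscale c x = rmact x c%:A. Proof. by []. Qed.
Lemma rmact_kscale M c (x : M) a : rmact (kscale c x) a = kscale c (rmact x a).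
Proof. by rewrite !kscaleE !rmactA mulr_algl mulr_algr. Qed.
Lemma rmact_scale M c (x : M) a : rmact x (c *: a) = kscale c (rmact x a).
Proof. by rewrite kscaleE rmactA mulr_algr. Qed.
Lemma kscale1 M (x : M) : kscale (1 : K) x = x.
Proof. by rewrite kscaleE scale1r rmact1. Qed.
Lemma kscale0 M (x : M) : kscale (0 : K) x = 0.
Proof. by rewrite kscaleE scale0r rmact0. Qed.
Lemma kscale0x M c : kscale c (0 : M) = 0.
Proof. exact: rmact0x. Qed.
Lemma kscaleA M c d (x : M) : kscale c (kscale d x) = kscale (c * d) x.
Proof. by rewrite !kscaleE rmactA mulr_algl scalerA mulrC. Qed.
Lemma kscaleDr M c (x y : M) : kscale c (x + y) = kscale c x + kscale c y.
Proof. exact: rmactDl. Qed.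
Lemma kscaleDl M c d (x : M) : kscale (c + d) x = kscale c x + kscale d x.
Proof. by rewrite !kscaleE scalerDl rmactDr. Qed.
Lemma kscaleBl M c d (x : M) : kscale (c - d) x = kscale c x - kscale d x.
Proof. by rewrite !kscaleE scalerBl rmactBr. Qed.
Lemma kscale_eq0 M c (x : M) : c != 0 -> kscale c x = 0 -> x = 0.
Proof.
by move=> c0 /(congr1 (kscale c^-1)); rewrite kscaleA mulVf // kscale1 kscale0x.
Qed.
Lemma kscale_lin M N (f : {linear M -> N}) c x : f (kscale c x) = kscale c (f x).
Proof. exact: rmact_lin. Qed.
Lemma kscale_sumr M c (J : finType) (P : pred J) (F : J -> M) :
  kscale c (\sum_(i | P i) F i) = \sum_(i | P i) kscale c (F i).
Proof. exact: rmact_suml. Qed.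

Lemma submod_act M (U : {pred M}) x a : submod_closed U -> x \in U -> rmact x a \in U.
Proof. by case=> U0 Ulin xU; rewrite -[rmact x a]addr0; apply: Ulin. Qed.
Lemma submod_kscale M (U : {pred M}) c x : submod_closed U -> x \in U -> kscale c x \in U.
Proof. exact: submod_act. Qed.
Lemma submod_add M (U : {pred M}) x y : submod_closed U -> x \in U -> y \in U -> x + y \in U.
Proof. by case=> U0 Ulin xU yU; rewrite -[x]scale1r; apply: Ulin. Qed.
Lemma submod_opp M (U : {pred M}) x : submod_closed U -> x \in U -> - x \in U.
Proof. by case=> U0 Ulin xU; rewrite -scaleN1r -[_ *: x]addr0; apply: Ulin. Qed.
Lemma submod_sum M (U : {pred M}) (J : finType) (P : pred J) (F : J -> M) :
  submod_closed U -> (forall i, P i -> F i \in U) -> \sum_(i | P i) F i \in U.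
Proof.
move=> hU FU; elim/big_rec: _ => [|i x Pi xU]; first by case: hU.
by rewrite submod_add ?FU.
Qed.

Lemma exists_linear M N (f : M -> N) : (forall a x y, f (rmact x a + y) = rmact (f x) a + f y) ->
  exists h : {linear M -> N}, h =1 f.
Proof.
move=> lin; have lin' : linear f by move=> a x y; exact: lin.
pose h : {linear M -> N} := HB.pack f (GRing.isLinear.Build A^c M N *:%R f lin').
by exists h.
Qed.

Lemma cyclic_hom M N (p : M) (y : N) : (forall x, exists a, x = rmact p a) ->
  (forall a, rmact p a = 0 -> rmact y a = 0) ->
  exists h : {linear M -> N}, forall a, h (rmact p a) = rmact y a.
Proof.
move=> /choice[s sE] ann; pose f x := rmact y (s x).
have wd a b : rmact p a = rmact p b -> rmact y a = rmact y b.
  move=> E; apply/eqP; rewrite -subr_eq0 -rmactBr; apply/eqP/ann.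
  by rewrite rmactBr E subrr.
have [h hE] : exists h : {linear M -> N}, h =1 f.
  apply: exists_linear => a x z; rewrite /f rmactA -rmactDr; apply: wd.
  by rewrite -sE rmactDr -rmactA -!sE.
by exists h => a; rewrite hE; apply: wd; rewrite -sE.
Qed.

Lemma cyclic_iso M N (p : M) (y : N) :
  (forall x, exists a, x = rmact p a) -> (forall x, exists a, x = rmact y a) ->
  (forall a, rmact p a = 0 <-> rmact y a = 0) -> mod_iso M N.
Proof.
move=> pgen ygen ann.
have [h hE] := cyclic_hom pgen (fun a => proj1 (ann a)).
have [k kE] := cyclic_hom ygen (fun a => proj2 (ann a)).
exists h; exists k => x.
  by have [a ->] := pgen x; rewrite hE kE.
by have [a ->] := ygen x; rewrite kE hE.
Qed.

End RightAction.

(** * Matrix units, and modules with a basis adapted to them *)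

Section DigraphModules.
Variables (K : fieldType) (A : algType K) (X : finType) (e : rel X) (x0 : X).
Local Notation D := (digraph_alg K e x0).
Variables (phi : {lrmorphism A -> D}) (psi : D -> A).
Hypotheses (phiK : cancel phi psi) (psiK : cancel psi phi).
Local Notation le := (connect e).
Implicit Types (a b : A) (u v s t : X) (Y : {set X}) (M N P Q : lmodType A^c) (c : K).

Definition co a u v : K := dg_coef (phi a) u v.
(** The matrix unit [e_{u,v}] pulled back to [A]. [dg_of] truncates, so it is 0 when there is no
    path from [u] to [v]. *)
Definition mu u v : A := psi (dg_of e x0 (fun s t => ((s == u) && (t == v))%:R)).

Lemma co_ext a b : (forall u v, co a u v = co b u v) -> a = b.
Proof. by move=> ab; apply: (can_inj phiK); apply: dg_coefP. Qed.

Lemma co_mu u v s t : le u v -> co (mu u v) s t = ((s == u) && (t == v))%:R.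
Proof.
move=> uv; rewrite /co /mu psiK dg_ofE; case: ifPn => // st.
by case: eqP => //= su; case: eqP => //= tv; rewrite su tv uv in st.
Qed.

Lemma co_out a u v : ~~ le u v -> co a u v = 0.
Proof. exact: dg_coef_out. Qed.

Lemma coM a b u t : co (a * b) u t = \sum_v co a u v * co b v t.
Proof. by rewrite /co rmorphM; exact: dg_mulE. Qed.

Lemma co1 u v : co 1 u v = (u == v)%:R.
Proof. by rewrite /co rmorph1; exact: dg_oneE. Qed.

Lemma coD a b u v : co (a + b) u v = co a u v + co b u v.
Proof. by rewrite /co raddfD; exact: dg_coefD. Qed.

Lemma coZ c a u v : co (c *: a) u v = c * co a u v.
Proof. by rewrite /co linearZ; exact: dg_coefZ. Qed.

Lemma co0 u v : co 0 u v = 0.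
Proof. by rewrite -(scale0r 0) coZ mul0r. Qed.

Lemma co_sum (J : finType) (p : pred J) (F : J -> A) u v :
  co (\sum_(i | p i) F i) u v = \sum_(i | p i) co (F i) u v.
Proof.
elim/big_rec2: _ => [|i x y _ <-]; first exact: co0.
exact: coD.
Qed.

Lemma mu_mul u v s t : le u v -> le s t -> mu u v * mu s t = if v == s then mu u t else 0.
Proof.
move=> uv st; apply: co_ext => x y; rewrite coM (bigD1 v) //= big1 => [|z zv]; last first.
  by rewrite co_mu // (negbTE zv) andbF mul0r.
rewrite addr0 !co_mu // eqxx andbT; case: (eqVneq v s) => [vs|_]; last by rewrite mulr0 co0.
rewrite co_mu; last by apply: connect_trans uv _; rewrite vs.
by case: (x == u); rewrite /= ?mul1r ?mul0r.
Qed.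

Lemma alg_exp a : a = \sum_u \sum_(v | le u v) co a u v *: mu u v.
Proof.
apply: co_ext => x y; rewrite co_sum (bigD1 x) //= [X in _ + X]big1 ?addr0 => [|u ux]; last first.
  by rewrite co_sum big1 // => v uv; rewrite coZ co_mu // eq_sym (negbTE ux) mulr0.
rewrite co_sum; have [xy|xy] := boolP (le x y); last first.
  rewrite co_out // big1 // => v xv; rewrite coZ co_mu // eqxx.
  by case: eqP => [yv|_]; rewrite ?mulr0 //; rewrite yv xv in xy.
rewrite (bigD1 y) //= coZ co_mu // !eqxx mulr1 big1 ?addr0 // => v /andP[xv vy].
by rewrite coZ co_mu // eq_sym (negbTE vy) andbF mulr0.
Qed.

Lemma sum_mu : 1 = \sum_u mu u u.
Proof.
apply: co_ext => x y; rewrite co_sum co1 (bigD1 x) //= big1 => [|u ux].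
  by rewrite co_mu // eqxx eq_sym addr0.
by rewrite co_mu // eq_sym (negbTE ux).
Qed.

Lemma mu_idl u v : le u v -> mu u u * mu u v = mu u v.
Proof. by move=> uv; rewrite mu_mul // eqxx. Qed.

Lemma mu_row u a : mu u u * a = \sum_(v | le u v) co a u v *: mu u v.
Proof.
rewrite {1}(alg_exp a) mulr_sumr (bigD1 u) //= [X in _ + X]big1 ?addr0 => [|s su].
  by rewrite mulr_sumr; apply: eq_bigr => v uv; rewrite -scalerAr mu_idl.
rewrite mulr_sumr big1 // => v sv.
by rewrite -scalerAr mu_mul // eq_sym (negbTE su) scaler0.
Qed.

Lemma mod_exp M (x : M) : x = \sum_u rmact x (mu u u).
Proof. by rewrite -rmact_sumr -sum_mu rmact1. Qed.

Lemma mod_neq0 M (x : M) : x <> 0 -> exists u, rmact x (mu u u) <> 0.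
Proof.
move=> x_neq0; apply/existsNP => h; apply: x_neq0; by rewrite (mod_exp x) big1.
Qed.

(* A module with basis [b v], [v \in Y], on which the matrix units act by
   [b u . mu u v = b v], where [b v = 0] for [v \notin Y]. *)
Record typed M Y (b : X -> M) : Prop := Typed {
  typed_neq0 : forall v, b v <> 0 <-> v \in Y;
  typed_act : forall v s t, v \in Y -> le s t ->
    rmact (b v) (mu s t) = if v == s then b t else 0;
  typed_span : forall x, exists f : X -> K, x = \sum_v kscale (f v) (b v)
}.

Section Typed.
Variables (M : lmodType A^c) (Y : {set X}) (b : X -> M).
Hypothesis bT : typed Y b.

Lemma typed_out v : v \notin Y -> b v = 0.
Proof. by move=> vY; apply: contrapT => /(typed_neq0 bT); rewrite (negbTE vY). Qed.

Lemma typed_in v : v \in Y -> b v <> 0.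
Proof. by move/(typed_neq0 bT). Qed.

Lemma typed_actE u a : u \in Y -> rmact (b u) a = \sum_(v | le u v) kscale (co a u v) (b v).
Proof.
move=> uY; have -> : rmact (b u) a = rmact (b u) (mu u u * a).
  by rewrite -rmactA (typed_act bT) // eqxx.
rewrite mu_row rmact_sumr; apply: eq_bigr => v uv.
by rewrite rmact_scale (typed_act bT) // eqxx.
Qed.

Lemma sum_act_mu0 (f : X -> K) u v : u \notin Y -> le u v ->
  rmact (\sum_s kscale (f s) (b s)) (mu u v) = 0.
Proof.
move=> uY uv; rewrite rmact_suml big1 // => s _; rewrite rmact_kscale.
have [sY|sY] := boolP (s \in Y); last by rewrite typed_out // rmact0x kscale0x.
rewrite (typed_act bT) //; case: eqP => [su|_]; last by rewrite kscale0x.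
by rewrite -su sY in uY.
Qed.

Lemma sum_act_mu (f : X -> K) u v : u \in Y -> le u v ->
  rmact (\sum_s kscale (f s) (b s)) (mu u v) = kscale (f u) (b v).
Proof.
move=> uY uv; rewrite rmact_suml (bigD1 u) //= big1 => [|s su].
  by rewrite addr0 rmact_kscale (typed_act bT) // eqxx.
have [sY|sY] := boolP (s \in Y); last by rewrite typed_out // kscale0x rmact0x.
by rewrite rmact_kscale (typed_act bT) // (negbTE su) kscale0x.
Qed.

Lemma typed_indep (f : X -> K) : \sum_v kscale (f v) (b v) = 0 ->
  forall v, v \in Y -> f v = 0.
Proof.
move=> f0 v vY; apply/eqP; apply: contraT => fv.
have := sum_act_mu f vY (connect0 e v); rewrite f0 rmact0x => /esym /(kscale_eq0 fv) bv.
by case: (typed_in vY).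
Qed.

Lemma typed_le u v : u \in Y -> le u v -> le v u -> v \in Y.
Proof.
move=> uY uv vu; apply/(typed_neq0 bT) => bv; case: (typed_in uY).
have -> : b u = rmact (rmact (b u) (mu u v)) (mu v u).
  by rewrite rmactA mu_mul // eqxx (typed_act bT) // eqxx.
by rewrite (typed_act bT uY uv) eqxx bv rmact0x.
Qed.

(** This recovers [Y] from the module alone, which makes it an isomorphism invariant. *)
Lemma typed_supp v : v \in Y <-> exists x : M, rmact x (mu v v) <> 0.
Proof.
split=> [vY|[x xv]]; first by exists (b v); rewrite (typed_act bT) // eqxx; apply: typed_in.
apply: contrapT => vY; apply: xv; have [f ->] := typed_span bT x.
by rewrite sum_act_mu0 //; apply/negP.
Qed.

Lemma typed_gen u : u \in Y -> (forall v, v \in Y -> le u v) ->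
  forall x, exists a, x = rmact (b u) a.
Proof.
move=> uY uY' x; have [f ->] := typed_span bT x.
exists (\sum_(v in Y) f v *: mu u v); rewrite rmact_sumr [LHS](bigID (mem Y)) /=.
rewrite [X in _ + X]big1 ?addr0 => [|v vY]; last by rewrite typed_out ?kscale0x.
by apply: eq_bigr => v vY; rewrite rmact_scale (typed_act bT) ?uY' // eqxx.
Qed.

Lemma typed_ann u a : u \in Y -> (forall v, v \in Y -> le u v) ->
  rmact (b u) a = 0 <-> forall v, v \in Y -> co a u v = 0.
Proof.
move=> uY uY'; rewrite typed_actE // big_mkcond /=; split=> [h v vY|h].
  pose f v := if le u v then co a u v else 0.
  have := @typed_indep f; rewrite (_ : \sum_v _ = 0).
    by move/(_ erefl v vY); rewrite /f uY'.
  by apply: etrans h; apply: eq_bigr => s _; rewrite /f; case: ifP; rewrite ?kscale0.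
rewrite big1 // => v _; case: ifP => // _.
by have [vY|vY] := boolP (v \in Y); [rewrite h ?kscale0 | rewrite typed_out ?kscale0x].
Qed.

End Typed.

Lemma typed_iso M N Y (b : X -> M) (b' : X -> N) u : typed Y b -> typed Y b' ->
  u \in Y -> (forall v, v \in Y -> le u v) -> mod_iso M N.
Proof.
move=> bT b'T uY uY'; apply: (cyclic_iso (typed_gen bT uY uY') (typed_gen b'T uY uY')).
by move=> a; rewrite (typed_ann bT) // (typed_ann b'T).
Qed.

Lemma typed_iso_eq M N Y Y' (b : X -> M) (b' : X -> N) :
  typed Y b -> typed Y' b' -> mod_iso M N -> Y = Y'.
Proof.
move=> bT b'T [f [g fK gK]]; apply/setP=> v.
apply/idP/idP => [/(typed_supp bT)[x xv]|/(typed_supp b'T)[x xv]].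
  apply/(typed_supp b'T); exists (f x); rewrite -rmact_lin => f0; apply: xv.
  by rewrite -[LHS]fK f0 -(linear0 f) fK.
apply/(typed_supp bT); exists (g x) => g0; apply: xv.
by rewrite -(gK x) -rmact_lin g0 linear0.
Qed.

Lemma typed_nonzero M Y (b : X -> M) u : typed Y b -> u \in Y -> ~ mod_zero M.
Proof. by move=> bT uY M0; apply: (typed_in bT uY); apply: M0. Qed.

Lemma typed_zero M Y (b : X -> M) : typed Y b -> Y = set0 -> mod_zero M.
Proof.
move=> bT Y0 x; have [f ->] := typed_span bT x.
by rewrite big1 // => v _; rewrite (typed_out bT) ?kscale0x // Y0 inE.
Qed.

(** A nonzero vector has a nonzero coordinate at some [v] in [Y]; [mu v t] isolates it and moves it
    to any other [t] of the class. *)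
Lemma typed_simple M Y (b : X -> M) u : typed Y b -> u \in Y ->
  (forall v, v \in Y -> le u v /\ le v u) -> simple_mod M.
Proof.
move=> bT uY uY'; split; first exact: (typed_nonzero bT uY).
move=> U hU; have [|h] := pselect (forall x, x \in U -> x = 0); first by left.
right=> x; have [y [yU y0]] : exists y, y \in U /\ y <> 0.
  by move: h => /existsNP[y /not_implyP[yU y0]]; exists y.
have [f yE] := typed_span bT y.
have [v vY fv] : exists2 v, v \in Y & f v != 0.
  apply: contrapT => hn; apply: y0; rewrite yE big1 // => v _.
  have [vY|vY] := boolP (v \in Y); last by rewrite (typed_out bT) ?kscale0x.
  have [->|fv] := eqVneq (f v) 0; first by rewrite kscale0.
  by case: hn; exists v.
have bU t : t \in Y -> b t \in U.
  move=> tY; have vt : le v t.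
    by apply: connect_trans (proj2 (uY' v vY)) (proj1 (uY' t tY)).
  have := submod_kscale (f v)^-1 hU (submod_act (mu v t) hU yU).
  by rewrite yE (sum_act_mu bT) // kscaleA mulVf // kscale1.
have [g ->] := typed_span bT x; apply: submod_sum => // t _.
have [tY|tY] := boolP (t \in Y); first by apply: submod_kscale => //; apply: bU.
by rewrite (typed_out bT) // kscale0x; case: hU.
Qed.

Section SubQuotient.
Variables (M : lmodType A^c) (Y : {set X}) (b : X -> M) (U : {pred M}).
Hypotheses (bT : typed Y b) (hU : submod_closed U).

(** The default 0 for vectors outside [U] matches the convention of [typed] outside the index
    set. *)
Definition sub_basis v : submod hU := insubd (0 : submod hU) (b v).

Lemma val_submod_lin (a : A) (x y : submod hU) :
  val (rmact x a + y) = rmact (val x) a + val y.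
Proof. by []. Qed.

Lemma val_submod_sum (f : X -> K) (g : X -> submod hU) :
  val (\sum_v kscale (f v) (g v)) = \sum_v kscale (f v) (val (g v)).
Proof. by elim/big_rec2: _ => [|v x y _ <-]. Qed.

(** Every submodule is spanned by the basis vectors that it contains, because [mu v v] isolates one
    coordinate and nonzero scalars are invertible. *)
Lemma typed_submod : typed [set v in Y | b v \in U] sub_basis.
Proof.
have valb v : val (sub_basis v) = if b v \in U then b v else 0.
  by rewrite /sub_basis val_insubd.
split=> [v|v s t|x].
- rewrite inE; split=> [bv|/andP[vY vU] bv].
    have [vU|vU] := boolP (b v \in U); last first.
      by case: bv; apply: val_inj; rewrite valb (negbTE vU).
    rewrite andbT; apply/(typed_neq0 bT) => bv0; apply: bv; apply: val_inj.
    by rewrite valb vU bv0.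
  by apply: (typed_in bT vY); have := valb v; rewrite vU bv.
- rewrite inE => /andP[vY vU] st; apply: val_inj.
  rewrite -[LHS]/(rmact (val (sub_basis v)) (mu s t)) valb vU (typed_act bT) //.
  case: eqP => [vs|//]; subst s; rewrite valb ifT //.
  by have := submod_act (mu v t) hU vU; rewrite (typed_act bT) // eqxx.
have [f xE] := typed_span bT (val x); exists f; apply: val_inj.
rewrite val_submod_sum xE; apply: eq_bigr => v _; rewrite valb; case: ifPn => // vU.
have [vY|vY] := boolP (v \in Y); last by rewrite (typed_out bT) // kscale0x.
have [->|fv] := eqVneq (f v) 0; first by rewrite !kscale0.
case/negP: vU; have := submod_kscale (f v)^-1 hU (submod_act (mu v v) hU (valP x)).
by rewrite xE (sum_act_mu bT) // kscaleA mulVf // kscale1.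
Qed.

Lemma pi_quot_act (a : A) (x : M) :
  \pi_(quotmod hU)%qT (rmact x a) = rmact (\pi_(quotmod hU)%qT x) a.
Proof. exact: (esym (quotmod_scaleE hU _ _)). Qed.

Lemma pi_quot_lin (a : A) (x y : M) :
  \pi_(quotmod hU)%qT (rmact x a + y) =
  rmact (\pi_(quotmod hU)%qT x) a + \pi_(quotmod hU)%qT y.
Proof. by rewrite quotmod_piD pi_quot_act. Qed.

Lemma pi_quot_eq0 (x : M) : \pi_(quotmod hU)%qT x = 0 :> quotmod hU <-> x \in U.
Proof.
have -> : 0 = \pi_(quotmod hU)%qT 0 :> quotmod hU.
  by have := pi_quot_act 0 0; rewrite rmact0 => ->; rewrite rmact0.
by rewrite -{2}(subr0 x) -(quotmod_piE hU); split=> /eqP.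
Qed.

Lemma typed_quotmod :
  typed [set v in Y | b v \notin U] (fun v => \pi_(quotmod hU)%qT (b v) : quotmod hU).
Proof.
split=> [v|v s t|x].
- rewrite inE; split=> [bv|/andP[vY vU] /pi_quot_eq0 bv]; last by rewrite bv in vU.
  apply/andP; split; last by apply/negP=> /pi_quot_eq0.
  by apply/(typed_neq0 bT) => bv0; apply: bv; apply/pi_quot_eq0; rewrite bv0; case: hU.
- rewrite inE => /andP[vY vU] st; rewrite -pi_quot_act (typed_act bT) //.
  by case: eqP => // _; apply/pi_quot_eq0; case: hU.
elim/quotW: x => x; have [f xE] := typed_span bT x; exists f.
rewrite [in LHS]xE; elim/big_rec2: _ => [|v y z _ <-].
  by apply/pi_quot_eq0; case: hU.
by rewrite quotmod_piD pi_quot_act.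
Qed.

End SubQuotient.
Lemma mu_col a t : a * mu t t = \sum_(s | le s t) co a s t *: mu s t.
Proof.
rewrite {1}(alg_exp a) mulr_suml [RHS]big_mkcond; apply: eq_bigr => s _.
rewrite mulr_suml; case: ifPn => st; last first.
  rewrite big1 // => v sv; rewrite -scalerAl mu_mul //; case: eqP => [vt|_].
    by rewrite -vt sv in st.
  by rewrite scaler0.
rewrite (bigD1 t) //= -scalerAl mu_mul // eqxx big1 ?addr0 // => v /andP[sv vt].
by rewrite -scalerAl mu_mul // (negbTE vt) scaler0.
Qed.

Lemma rmact_col M (x : M) a t : rmact (rmact x a) (mu t t) =
  \sum_(s | le s t) kscale (co a s t) (rmact (rmact x (mu s s)) (mu s t)).
Proof.
rewrite rmactA mu_col rmact_sumr; apply: eq_bigr => s st.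
by rewrite rmact_scale rmactA mu_idl.
Qed.

(** [le] is only a preorder. The size of the up-set drops along strict relations, so an element with
    the largest up-set is minimal. *)
Lemma exists_minimal_le (p : pred X) : (exists u, p u) ->
  exists2 v, p v & forall t, p t -> le t v -> le v t.
Proof.
case=> u0 pu0; have [v pv vmax] := arg_maxnP (fun v => #|[set t | le v t]|) pu0.
exists v => // t pt tv; apply: contraT => nvt.
have : [set s | le v s] \proper [set s | le t s].
  apply/properP; split; first by apply/subsetP=> s; rewrite !inE; apply: connect_trans.
  by exists t; rewrite inE ?connect0.
have le_t : (#|[set s | le t s]| <= #|[set s | le v s]|)%N := vmax t pt.
by move/proper_card; rewrite ltnNge le_t.
Qed.

(** * Minimal classes, composition series and radicals *)

Section TopClass.
Variables (M : lmodType A^c) (v : X).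
Hypothesis vmin : forall t (x : M), le t v -> rmact x (mu t t) <> 0 -> le v t.

Definition below_class : {pred M} :=
  [pred x : M | [forall t, le v t && le t v ==> (rmact x (mu t t) == 0)]].

Lemma below_classP x :
  reflect (forall t, le v t -> le t v -> rmact x (mu t t) = 0) (x \in below_class).
Proof.
apply: (iffP forallP) => h t; first by move=> vt tv; have := h t; rewrite vt tv => /eqP.
by apply/implyP=> /andP[vt tv]; rewrite h.
Qed.

(** The component of a product [x a] at [t] involves only components of [x] at [s] with a path to
    [t]. For [t] in the class of [v], minimality forces such an [s] with nonzero component into the
    same class. *)
Lemma below_class_closed : submod_closed below_class.
Proof.
split=> [|a x y /below_classP xU /below_classP yU]; apply/below_classP=> t vt tv.
  by rewrite rmact0x.
rewrite rmactDl (yU t) // addr0 -[a *: x]/(rmact x a) rmact_col big1 // => s st.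
suff -> : rmact x (mu s s) = 0 by rewrite rmact0x kscale0x.
apply: contrapT => xs; have sv : le s v := connect_trans st tv.
by have vs := vmin sv xs; exact: xs (xU s vs sv).
Qed.

End TopClass.
Arguments below_class : clear implicits.

Section TopClassTyped.
Variables (M : lmodType A^c) (Y : {set X}) (b : X -> M) (v : X).
Hypotheses (bT : typed Y b) (vY : v \in Y).
Hypothesis vmin : forall t, t \in Y -> le t v -> le v t.

Lemma typed_vmin t (x : M) : le t v -> rmact x (mu t t) <> 0 -> le v t.
Proof. by move=> tv xt; apply: vmin => //; apply/(typed_supp bT); exists x. Qed.

Lemma basis_below s : s \in Y -> (b s \in below_class M v) = ~~ (le v s && le s v).
Proof.
move=> sY; apply/below_classP/idP=> [h|sv t vt tv].
  apply/negP=> /andP[vs sv]; apply: (typed_in bT sY).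
  by have := h s vs sv; rewrite (typed_act bT) // eqxx.
by rewrite (typed_act bT) //; case: eqP => // st; rewrite st vt tv in sv.
Qed.

End TopClassTyped.

Lemma sub_quot_exact M (U : {pred M}) (hU : submod_closed U) :
  exists (f : {linear submod hU -> M}) (g : {linear M -> quotmod hU}), short_exact f g.
Proof.
have [f fE] := exists_linear (M := submod hU) (f := fun x : submod hU => val x)
  (val_submod_lin (hU := hU)).
have [g gE] := exists_linear (f := fun x : M => \pi_(quotmod hU)%qT x) (pi_quot_lin hU).
exists f, g; split.
- by move=> x y; rewrite !fE; apply: val_inj.
- by elim/quotW=> x; exists x; rewrite gE.
move=> x; rewrite gE; split=> [/pi_quot_eq0 xU|[y <-]].
  by exists (Sub x xU); rewrite fE.
by rewrite fE; apply/pi_quot_eq0; apply: valP.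
Qed.

(** Classes are split off from a minimal one, the quotient by [below_class] being simple. Each class
    occurs once, so the multiplicity is the truth value of [u \in Y] read as 0 or 1. *)
Lemma typed_composition (S : lmodType A^c) u (bS : X -> S) M Y (b : X -> M) :
  typed [set v | le u v && le v u] bS -> typed Y b -> composition_mult S M (u \in Y).
Proof.
move=> bST; move En : #|Y| => n; elim: n {-2}n (leqnn n) M Y b En => [|n IH] n' len M Y b En bT.
  have Y0 : Y = set0 by apply: cards0_eq; move: len; rewrite En leqn0 => /eqP.
  by rewrite Y0 inE; apply: CompositionNil; apply: typed_zero bT Y0.
have [Y0|/set0Pn Yn0] := eqVneq Y set0.
  by rewrite Y0 inE; apply: CompositionNil; apply: typed_zero bT Y0.
have [v vY vmin] := exists_minimal_le Yn0.
have hU := below_class_closed (typed_vmin bT vmin).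
have subT := typed_submod bT hU; have quoT := typed_quotmod bT hU.
set Y1 := [set s in Y | b s \in _] in subT; set Y2 := [set s in Y | _] in quoT.
have Y1E s : (s \in Y1) = (s \in Y) && ~~ (le v s && le s v).
  by rewrite inE; case: (boolP (s \in Y)) => //= sY; rewrite (basis_below _ bT).
have Y2E : Y2 = [set s | le v s && le s v].
  apply/setP=> s; rewrite /Y2 !in_set; case: (boolP (s \in Y)) => [sY|sY] /=.
    by rewrite (basis_below _ bT) // negbK.
  by apply/esym/negP=> /andP[vs sv]; case/negP: sY; apply: (typed_le bT vY).
have simpQ : simple_mod (quotmod hU : lmodType A^c).
  apply: (typed_simple (u := v) quoT); rewrite Y2E ?inE ?connect0 // => s.
  by rewrite inE => /andP[].
have [f [g fg]] := sub_quot_exact hU.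
have lt1 : (#|Y1| <= n)%N.
  rewrite -ltnS; apply: leq_trans len; rewrite -En; apply: proper_card.
  apply/properP; split; first by apply/subsetP=> s; rewrite Y1E => /andP[].
  by exists v; rewrite // Y1E vY connect0.
have IH1 := IH _ lt1 _ _ _ erefl subT.
have [uv|uv] := boolP (le v u && le u v).
  have uY : u \in Y by case/andP: uv => vu uv'; apply: (typed_le bT vY).
  have {}IH1 : composition_mult S (submod hU : lmodType A^c) 0.
    by move: IH1; rewrite Y1E uv andbF.
  rewrite uY; apply: (CompositionIso fg simpQ _ IH1).
  apply: (typed_iso (u := v) (Y := Y2) quoT _); rewrite ?Y2E ?inE ?connect0 //.
    case/andP: uv => vu uv'; have -> : [set s | le v s && le s v] = [set s | le u s && le s u].
      apply/setP=> s; rewrite !inE; apply/andP/andP=> -[h1 h2]; split.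
      - exact: connect_trans uv' h1.
      - exact: connect_trans h2 vu.
      - exact: connect_trans vu h1.
      exact: connect_trans h2 uv'.
    exact: bST.
  by move=> s; rewrite inE => /andP[].
rewrite Y1E uv andbT in IH1; apply: (CompositionOther fg simpQ _ IH1).
move=> QS; have := typed_iso_eq quoT bST QS; rewrite Y2E => /setP/(_ u).
by rewrite !inE connect0 (negbTE uv).
Qed.

(** If [v] lies in a minimal class of [Y], then [below_class M v] is a maximal submodule that misses
    [b v]. *)
Lemma typed_radical M Y (b : X -> M) v : typed Y b -> v \in Y ->
  (b v \in @radical _ M) = [exists u in Y, le u v && ~~ le v u].
Proof.
move=> bT vY; apply/idP/idP=> [/asboolP rv|/exists_inP[u uY /andP[uv vu]]].
  apply: contraT; rewrite negb_exists_in => /forall_inP nomin.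
  have vmin t : t \in Y -> le t v -> le v t.
    by move=> tY tv; have := nomin t tY; rewrite tv /= negbK.
  have hU := below_class_closed (typed_vmin bT vmin).
  have vU : b v \notin below_class M v by rewrite (basis_below _ bT) // connect0.
  case/negP: vU; apply: rv; split=> //.
    by exists (b v); rewrite (basis_below _ bT) // connect0.
  move=> V hV UV.
  have [VU|/existsNP[y /not_implyP[yV yU]]] := pselect {subset V <= below_class M v}.
    by left.
  right=> x; have [f yE] := typed_span bT y.
  have [t [vt tv yt]] : exists t, [/\ le v t, le t v & rmact y (mu t t) <> 0].
    apply: contrapT => hn; apply: yU; apply/below_classP=> t vt tv.
    by apply: contrapT => yt; apply: hn; exists t.
  have tY : t \in Y := typed_le bT vY vt tv.
  have ft : f t != 0.
    apply/eqP=> ft; apply: yt.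
    by rewrite yE (sum_act_mu bT) // ft kscale0.
  have btV : b t \in V.
    have := submod_kscale (f t)^-1 hV (submod_act (mu t t) hV yV).
    by rewrite yE (sum_act_mu bT) // kscaleA mulVf // kscale1.
  have [g ->] := typed_span bT x; apply: submod_sum => // s _; apply: submod_kscale => //.
  have [sY|sY] := boolP (s \in Y); last by rewrite (typed_out bT) //; case: hV.
  have [vs|vs] := boolP (le v s && le s v); last by apply: UV; rewrite (basis_below _ bT).
  have ts : le t s by apply: connect_trans tv _; case/andP: vs.
  by have := submod_act (mu t s) hV btV; rewrite (typed_act bT) // eqxx.
(* Conversely, if a maximal [U] misses [b v], then [U + b v A] is everything and contains [b u]. As
   there is no path from [v] to [u], the factor [mu u u] kills the second summand; so [b u] is in
   [U], and then [b v = b u . mu u v] is too. *)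
apply/asboolP=> U [hU Unt Umax]; apply: contraT => vU.
pose V : {pred M} := [pred x | `[< exists a, x - rmact (b v) a \in U >]].
have hV : submod_closed V.
  split=> [|a x y /asboolP[a1 x1] /asboolP[a2 y2]]; apply/asboolP.
    by exists 0; rewrite rmact0 subr0; case: hU.
  exists (a1 * a + a2); rewrite rmactDr -rmactA opprD addrACA -[a *: x]/(rmact x a) -rmactBl.
  by apply: submod_add => //; apply: submod_act.
have UV : {subset U <= V} by move=> x xU; apply/asboolP; exists 0; rewrite rmact0 subr0.
case: (Umax V hV UV) => [VU|allV].
  case/negP: vU; apply: VU; apply/asboolP; exists 1.
  by rewrite rmact1 subrr; case: hU.
have /asboolP[a ua] := allV (b u).
have buU : b u \in U.
  have := submod_act (mu u u) hU ua; rewrite rmactBl (typed_act bT) // eqxx.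
  rewrite rmact_col big1 ?subr0 // => s su; rewrite (typed_act bT) //.
  by case: eqP => [vs|_]; [rewrite vs su in vu | rewrite rmact0x kscale0x].
case/negP: vU; have := submod_act (mu u v) hU buU.
by rewrite (typed_act bT) // eqxx.
Qed.

Definition strict_up Y : {set X} := [set v in Y | [exists u in Y, le u v && ~~ le v u]].

Lemma typed_radical_mod M Y (b : X -> M) : typed Y b ->
  exists b' : X -> radical_mod M, typed (strict_up Y) b'.
Proof.
move=> bT; exists (sub_basis b (radical_closed M)).
have := typed_submod bT (radical_closed M); congr (typed _ _).
apply/setP=> v; rewrite !inE; case: (boolP (v \in Y)) => //= vY.
exact: typed_radical bT vY.
Qed.

Lemma typed_radical_layer M Y (b : X -> M) : typed Y b ->
  exists b' : X -> radical_layer M, typed (strict_up Y :\: strict_up (strict_up Y)) b'.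
Proof.
move=> /typed_radical_mod[b1 b1T].
eexists; have := typed_quotmod b1T (radical_closed (radical_mod M)).
congr (typed _ _); apply/setP=> v; rewrite in_setD [in LHS]inE andbC.
case: (boolP (v \in strict_up Y)) => [vY|_]; rewrite ?andbF ?andbT //.
by rewrite (typed_radical b1T vY) [in RHS]inE vY.
Qed.

Lemma typed_kdim M Y (b : X -> M) : typed Y b -> has_kdim M #|Y|.
Proof.
move=> bT; exists (fun i => b (enum_val i)) => x.
have coord (c : 'I_#|Y| -> K) j :
    rmact (\sum_i kscale (c i) (b (enum_val i))) (mu (enum_val j) (enum_val j)) =
    kscale (c j) (b (enum_val j)).
  rewrite rmact_suml (bigD1 j) //= big1 => [|i ij].
    by rewrite addr0 rmact_kscale (typed_act bT) ?enum_valP // eqxx.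
  rewrite rmact_kscale (typed_act bT) ?enum_valP //.
  by rewrite (inj_eq enum_val_inj) (negbTE ij) kscale0x.
have [f xE] := typed_span bT x; exists [ffun i => f (enum_val i)]; split.
  rewrite xE (bigID (mem Y)) /= [X in _ + X]big1 ?addr0 => [|v vY]; last first.
    by rewrite (typed_out bT) // kscale0x.
  by rewrite big_enum_val /=; apply: eq_bigr => i _; rewrite ffunE.
move=> c cE; apply/ffunP=> j; rewrite ffunE.
have := coord c j; rewrite -cE xE (sum_act_mu bT) ?enum_valP // => E.
apply/eqP; rewrite -subr_eq0; apply: contraT => d.
case: (typed_in bT (enum_valP j)); apply: (kscale_eq0 d).
by rewrite kscaleBl E subrr.
Qed.

(** Any nonzero vector generates, so [y = y . mu u u] does. If [y . mu u v] is nonzero it generates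
    [y] back, which requires a path from [v] to [u]. *)
Lemma simple_typed M : simple_mod M ->
  exists u, exists b : X -> M, typed [set v | le u v && le v u] b.
Proof.
case=> Mn0 Msimp; have [x xn0] : exists x : M, x <> 0.
  by apply/existsNP => h; apply: Mn0.
have [u yn0] := mod_neq0 xn0; set y := rmact x (mu u u) in yn0.
have gen (z : M) : z <> 0 -> forall x', exists a, x' = rmact z a.
  move=> zn0 x'; pose U : {pred M} := [pred x' | `[< exists a, x' = rmact z a >]].
  have hU : submod_closed U.
    split=> [|a x1 x2 /asboolP[a1 ->] /asboolP[a2 ->]]; apply/asboolP.
      by exists 0; rewrite rmact0.
    by exists (a1 * a + a2); rewrite rmactDr -rmactA.
  case: (Msimp U hU) => [U0|allU]; last exact/asboolP/allU.
  by case: zn0; apply: U0; apply/asboolP; exists 1; rewrite rmact1.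
have yE v : le u v -> rmact y (mu u v) = rmact x (mu u v).
  by move=> uv; rewrite /y rmactA mu_idl.
exists u, (fun v => if le u v then rmact y (mu u v) else 0); split=> [v|v s t|z].
- rewrite inE; case: ifPn => uv //=.
  split=> [bn0|vu b0]; last first.
    apply: yn0; have -> : y = rmact (rmact y (mu u v)) (mu v u).
      by rewrite rmactA mu_mul // eqxx /y rmactA mu_idl.
    by rewrite b0 rmact0x.
  apply: contraT => nvu; case: yn0; have [a yE'] := gen _ bn0 y.
  have -> : y = rmact y (mu u u) by rewrite /y rmactA mu_idl.
  rewrite {1}yE' rmact_col big1 // => s su; rewrite (rmactA y (mu u v)) mu_mul //.
  case: eqP => [vs|_]; last by rewrite rmact0 rmact0x kscale0x.
  by rewrite vs su in nvu.
- rewrite inE => /andP[uv vu] st; rewrite uv rmactA mu_mul //.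
  by case: eqP => [vs|_]; rewrite ?rmact0 // (connect_trans uv) ?vs.
have [a ->] := gen y yn0 z; exists (fun v => co a u v).
have -> : rmact y a = rmact y (mu u u * a) by rewrite -rmactA yE // /y.
rewrite mu_row rmact_sumr big_mkcond; apply: eq_bigr => v _.
by case: ifP => uv; rewrite ?rmact_scale // kscale0x.
Qed.

Lemma exists_max_avoiding M (B : {pred M}) (x1 : M) : submod_closed B -> x1 \notin B ->
  exists W : {pred M}, [/\ submod_closed W, x1 \notin W, {subset B <= W}
  & forall V : {pred M}, submod_closed V -> {subset W <= V} -> x1 \notin V -> {subset V <= W}].
Proof.
(* Zorn is applied to sets to which [B] is adjoined pointwise. The union of the empty chain then
   stands for [B], and every candidate contains [B]. *)
move=> hB x1B; pose add (U : M -> Prop) : {pred M} := [pred x | (x \in B) || `[< U x >]].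
pose good (U : M -> Prop) := submod_closed (add U) /\ ~ U x1.
have [|U [[hU x1U] Umax]] := @classical_sets.Zorn_bigcup M good.
  move=> F Fgood Ftot; pose UF := classical_sets.bigcup F id.
  have UFP x : x \in add UF -> x \in B \/ exists2 U, F U & x \in add U.
    case/orP=> [|/asboolP[U FU Ux]]; first by left.
    by right; exists U => //; apply/orP; right; apply/asboolP.
  have addS U x : F U -> x \in add U -> x \in add UF.
    move=> FU /orP[xB|/asboolP Ux]; apply/orP; first by left.
    by right; apply/asboolP; exists U.
  split=> [|[U FU]]; last by case: (Fgood U FU).
  split=> [|a x y /UFP xU /UFP yU]; first by apply/orP; left; case: hB.
  have BU U : F U -> {subset B <= add U} by move=> _ z zB; apply/orP; left.
  case: xU yU => [xB|[U FU xU]] [yB|[V FV yV]].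
  - by apply/orP; left; case: hB => _; apply.
  - apply: (addS V) => //; case: (Fgood V FV) => -[_ Vlin] _.
    by apply: Vlin => //; exact: (BU V FV).
  - apply: (addS U) => //; case: (Fgood U FU) => -[_ Ulin] _.
    by apply: Ulin => //; exact: (BU U FU).
  have [UV|VU] := Ftot U V FU FV.
    apply: (addS V) => //; case: (Fgood V FV) => -[_ Vlin] _; apply: Vlin => //.
    by case/orP: xU => [xB|/asboolP/UV Vx]; apply/orP; [left | right; apply/asboolP].
  apply: (addS U) => //; case: (Fgood U FU) => -[_ Ulin] _; apply: Ulin => //.
  by case/orP: yV => [yB|/asboolP/VU Uy]; apply/orP; [left | right; apply/asboolP].
exists (add U); split=> //.
- by rewrite inE negb_or x1B; apply/asboolP.
- by move=> z zB; apply/orP; left.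
move=> V hV UV x1V; apply: contrapT => nVU.
apply: (Umax (fun x => x \in V)).
  split=> [x Ux|VU]; first by apply: UV; apply/orP; right; apply/asboolP.
  by apply: nVU => x xV; apply/orP; right; apply/asboolP/VU.
have addV x : (x \in add (fun x => x \in V)) = (x \in V).
  apply/orP/idP=> [[xB|/asboolP //]|xV]; last by right; apply/asboolP.
  by apply: UV; apply/orP; left.
split; last exact/negP.
split=> [|a x y]; first by rewrite addV; case: hV.
by rewrite !addV; case: hV => _; apply.
Qed.

(** * Indecomposable projective modules *)

Section ProjectiveTyped.
Variables (P : lmodType A^c) (b : X -> P) (u : X).
Hypothesis bT : typed [set v | le u v] b.

Let uY : u \in [set v | le u v]. Proof. by rewrite inE connect0. Qed.
Let uY' v : v \in [set v | le u v] -> le u v. Proof. by rewrite inE. Qed.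

(** [P] is a copy of the right ideal [mu u u * A], so [b u] can be sent to any vector fixed by
    [mu u u]. *)
Lemma typed_cover M (y : M) : exists h : {linear P -> M},
  forall a, h (rmact (b u) a) = rmact (rmact y (mu u u)) a.
Proof.
apply: cyclic_hom; first exact: (typed_gen bT uY uY').
move=> a /(typed_ann bT _ uY uY') co0; rewrite rmactA mu_row big1 ?rmact0 // => v uv.
by rewrite co0 ?scale0r // inE.
Qed.

Lemma typed_corner (x : P) : exists c, rmact x (mu u u) = kscale c (b u).
Proof.
by have [f ->] := typed_span bT x; exists (f u); rewrite (sum_act_mu bT).
Qed.

Lemma basis_idem : rmact (b u) (mu u u) = b u.
Proof. by rewrite (typed_act bT) // eqxx. Qed.

Lemma typed_projective : projective_mod P.
Proof.
move=> N Q g f gsurj; have [n gn] := gsurj (f (b u)).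
have [h hE] := typed_cover n; exists h => x.
have [a ->] := typed_gen bT uY uY' x; rewrite hE !rmact_lin gn -rmact_lin.
by rewrite basis_idem.
Qed.

(** The vectors of [P] fixed by [mu u u] form the line of [b u]. The projection to [N1] thus
    multiplies [b u] by a scalar [c]; if [c] is zero [N1] vanishes, and otherwise [N2] does. *)
Lemma typed_indecomposable : indecomposable_mod P.
Proof.
split; first exact: (typed_nonzero bT uY).
move=> N1 N2 [f [g fK gK]].
have fact a x : f (rmact x a) = (rmact (f x).1 a, rmact (f x).2 a).
  by rewrite rmact_lin [f x in LHS]surjective_pairing.
pose n1 := (f (b u)).1; pose n2 := (f (b u)).2.
have [c cE] := typed_corner (g (n1, 0)).
have e1 : rmact (g (n1, 0)) (mu u u) = g (n1, 0).
  apply: (can_inj fK); rewrite fact gK /= rmact0x; congr (_, _).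
  by have := fact (mu u u) (b u); rewrite basis_idem => /(congr1 fst).
have E : (n1, 0) = f (kscale c (b u)) by rewrite -cE e1 gK.
have [c0|c0] := eqVneq c 0.
  left=> x; have [a aE] := typed_gen bT uY uY' (g (x, 0)).
  have := congr1 f aE; rewrite gK fact => -[-> _]; rewrite -/n1.
  have n10 : n1 = 0 by have := congr1 fst E; rewrite c0 kscale0 linear0.
  by rewrite n10 rmact0x.
right=> x; have [a aE] := typed_gen bT uY uY' (g (0, x)).
have := congr1 f aE; rewrite gK fact => -[_ ->]; rewrite -/n2.
have := congr1 snd E; rewrite kscaleE fact /= -kscaleE => /esym/(kscale_eq0 c0) E0.
by rewrite /n2 E0 rmact0x.
Qed.

Lemma split_indecomposable M (h : {linear M -> P}) : indecomposable_mod M ->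
  (forall p, exists x, h x = p) -> mod_iso M P.
Proof.
move=> [_ Mind] hsurj.
have [ide ideE] : exists f : {linear P -> P}, f =1 id by exact: exists_linear.
have [s sE] := typed_projective ide hsurj.
have hs p : h (s p) = p by rewrite sE ideE.
pose U : {pred M} := [pred x : M | h x == 0].
have hU : submod_closed U.
  split=> [|a x y /eqP hx /eqP hy]; first by rewrite inE linear0.
  by rewrite inE linearD rmact_lin hx hy rmact0x addr0.
have kU x : x - s (h x) \in U by rewrite inE linearB /= hs subrr.
pose F (x : M) : P * submod hU := (h x, Sub (x - s (h x)) (kU x)).
have [f fE] : exists f : {linear M -> (P * submod hU)%type}, f =1 F.
  apply: exists_linear => a x y; rewrite /F; congr (_, _); first by rewrite linearD rmact_lin.
  apply: val_inj; rewrite val_submod_lin !SubK.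
  have -> : s (h (rmact x a + y)) = rmact (s (h x)) a + s (h y).
    by rewrite (linearD h) rmact_lin (linearD s) rmact_lin.
  by rewrite rmactBl opprD addrACA.
have iso : mod_iso M (P * submod hU)%type.
  exists f; exists (fun p => s p.1 + val p.2) => [x|[p k]]; rewrite fE /F /=.
    by rewrite addrC subrK.
  have hk : h (val k) = 0 by apply/eqP; exact: (valP k).
  congr (_, _); first by rewrite linearD hk hs addr0.
  by apply: val_inj; rewrite SubK linearD hk hs addr0 addrC addKr.
have [P0|U0] := Mind _ _ iso; first by case: (typed_nonzero bT uY).
exists h; exists s => // x; apply/esym/eqP; rewrite -subr_eq0.
by have /(congr1 val) := U0 (Sub (x - s (h x)) (kU x)); rewrite SubK => ->.
Qed.

(* A nonzero projective [M] maps onto [P] for a suitable [u]: lift to [P] the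
   quotient of [M] by a submodule maximal among those avoiding [x1]. *)
Lemma projective_cover_iso M (x1 : M) : projective_mod M -> indecomposable_mod M ->
  rmact x1 (mu u u) = x1 -> x1 <> 0 ->
  (forall t (x : M), le t u -> rmact x (mu t t) <> 0 -> le u t) -> mod_iso M P.
Proof.
move=> Mproj Mind x1e x1n0 umin.
have BU := below_class_closed umin.
have x1B : x1 \notin below_class M u.
  by apply/negP=> /below_classP/(_ u); rewrite connect0 x1e => /(_ isT isT).
have [W [hW x1W BW Wmax]] := exists_max_avoiding BU x1B.
(* If [y] is not in [W], then [W + y A] contains [x1] by maximality. Multiplying by [mu u u] leaves
   only a scalar multiple of [y], with a nonzero scalar since [x1] is not in [W]. *)
have line (y : M) : rmact y (mu u u) = y -> exists c, y - kscale c x1 \in W.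
  move=> ye; have [yW|yW] := boolP (y \in W); first by exists 0; rewrite kscale0 subr0.
  pose V : {pred M} := [pred x | `[< exists a, x - rmact y a \in W >]].
  have hV : submod_closed V.
    split=> [|a x z /asboolP[a1 h1] /asboolP[a2 h2]]; apply/asboolP.
      by exists 0; rewrite rmact0 subr0; case: hW.
    exists (a1 * a + a2); rewrite rmactDr -rmactA opprD addrACA -[a *: x]/(rmact x a) -rmactBl.
    by apply: submod_add => //; apply: submod_act.
  have WV : {subset W <= V} by move=> x xW; apply/asboolP; exists 0; rewrite rmact0 subr0.
  have yV : y \in V by apply/asboolP; exists 1; rewrite rmact1 subrr; case: hW.
  have /asboolP[a xa] : x1 \in V.
    by apply: contraT => x1V; case/negP: yW; apply: (Wmax V).
  have := submod_act (mu u u) hW xa; rewrite rmactBl x1e rmact_col.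
  rewrite (bigD1 u) ?connect0 //= big1 => [|s /andP[su sneu]]; last first.
    by rewrite -{1}ye (rmactA y (mu u u)) mu_mul // eq_sym (negbTE sneu) rmact0 rmact0x kscale0x.
  rewrite addr0 !ye => xc; have c0 : co a u u != 0.
    by apply: contraNneq x1W => c0; move: xc; rewrite c0 kscale0 subr0.
  exists (co a u u)^-1; have := submod_opp hW (submod_kscale (co a u u)^-1 hW xc).
  by rewrite kscaleE rmactBl -!kscaleE kscaleA mulVf // kscale1 opprB.
(* [x1] generates [M / W]. Components in the class of [u] are transported to [u] and treated by
   [line]; all others lie in [below_class M u], hence in [W]. *)
have span (z : M) : exists a, z - rmact x1 a \in W.
  have /choice[at_ atE] : forall t, exists a, rmact z (mu t t) - rmact x1 a \in W.
    move=> t; have [/andP[ut tu]|tu] := boolP (le u t && le t u).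
      have ye : rmact (rmact z (mu t u)) (mu u u) = rmact z (mu t u).
        by rewrite rmactA mu_mul // eqxx.
      have [c cW] := line _ ye.
      exists (c *: mu u t); have := submod_act (mu u t) hW cW.
      by rewrite rmactBl rmactA mu_mul // eqxx rmact_kscale rmact_scale.
    exists 0; rewrite rmact0 subr0; apply: BW; apply/below_classP=> s us su.
    rewrite rmactA mu_mul //; case: eqP => [ts|_]; last by rewrite rmact0.
    by rewrite ts us su in tu.
  exists (\sum_t at_ t); rewrite {1}(mod_exp z) rmact_sumr -sumrB.
  by apply: (submod_sum hW) => t _; apply: atE.
pose Q : lmodType A^c := quotmod hW; pose p1 : Q := \pi_(quotmod hW)%qT x1.
have p1e : rmact p1 (mu u u) = p1 by rewrite -pi_quot_act x1e.
have [g gE] := typed_cover p1; rewrite p1e in gE.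
have [f fE] := exists_linear (f := fun x : M => \pi_(quotmod hW)%qT x) (pi_quot_lin hW).
have gsurj q : exists p, g p = q.
  elim/quotW: q => z; have [a za] := span z; exists (rmact (b u) a); rewrite gE.
  rewrite -pi_quot_act; apply/eqP; rewrite quotmod_piE -opprB.
  exact: submod_opp.
have [h hE] := Mproj _ _ g f gsurj.
(* The lift sends [x1] to a multiple of [b u], nonzero because [x1] survives in [M / W]. So [h] is
   onto, and it splits. *)
have [c cE] := typed_corner (h x1); rewrite -rmact_lin x1e in cE.
have c0 : c != 0.
  apply: contraNneq x1W => c0; apply/pi_quot_eq0; rewrite -fE -hE cE c0 kscale0.
  exact: linear0.
apply: (split_indecomposable (h := h) Mind) => p.
have [a ->] := typed_gen bT uY uY' p; exists (rmact x1 (c^-1 *: a)).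
by rewrite rmact_lin cE rmact_scale rmact_kscale kscaleA mulVf // kscale1.
Qed.

End ProjectiveTyped.

Lemma projective_complete M : projective_mod M -> indecomposable_mod M ->
  exists u, forall (P : lmodType A^c) (b : X -> P), typed [set v | le u v] b -> mod_iso M P.
Proof.
move=> Mproj Mind; have [Mn0 _] := Mind.
have [x xn0] : exists x : M, x <> 0 by apply/existsNP => h; apply: Mn0.
pose p u := `[< exists x : M, rmact x (mu u u) <> 0 >].
have [|u /asboolP[y yn0] umin] := @exists_minimal_le p.
  by have [u xu] := mod_neq0 xn0; exists u; apply/asboolP; exists x.
exists u => P b bT; apply: (projective_cover_iso (x1 := rmact y (mu u u)) bT) => //.
  by rewrite rmactA mu_idl.
by move=> t z tu zt; apply: umin => //; apply/asboolP; exists z.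
Qed.

Lemma mu_out u v : ~~ le u v -> mu u v = 0.
Proof.
move=> uv; apply: co_ext => s t; rewrite co0 /co /mu psiK dg_ofE; case: ifPn => // st.
case: eqP => //= su; case: eqP => //= tv; by rewrite -su -tv st in uv.
Qed.

End DigraphModules.

(** * Morita equivalence by cutting down to one vertex per class *)

Definition corner (K : fieldType) (A : algType K) (eps : A) (M : lmodType A^c) : Type :=
  {x : M | rmact x eps == x}.

Section CornerZmodule.
Variables (K : fieldType) (A : algType K) (eps : A) (M : lmodType A^c).

Let cornerP : {pred M} := [pred x | rmact x eps == x].

Fact corner_closed : zmod_closed cornerP.
Proof.
split=> [|x y]; rewrite !inE ?rmact0x //.
by move=> /eqP xe /eqP ye; rewrite rmactBl xe ye.
Qed.

HB.instance Definition _ := SubChoice.on (corner eps M).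
HB.instance Definition _ := GRing.SubChoice_isSubZmodule.Build M cornerP (corner eps M)
  corner_closed.
End CornerZmodule.

(** The quasi-inverse in coordinates, in place of a tensor product. It is used with [f u] the
    idempotent of the class of [u], so that the component at [u] lies in the corresponding corner of
    [N]. *)
Definition induced (K : fieldType) (B : algType K) (X : finType) (f : X -> B)
    (N : lmodType B^c) : Type :=
  {x : {ffun X -> N} | [forall u, rmact (x u) (f u) == x u]}.

Section InducedZmodule.
Variables (K : fieldType) (B : algType K) (X : finType) (f : X -> B) (N : lmodType B^c).

Let inducedP : {pred {ffun X -> N}} :=
  [pred x : {ffun X -> N} | [forall u, rmact (x u) (f u) == x u]].

Fact induced_closed : zmod_closed inducedP.
Proof.
split=> [|x y]; rewrite !inE; first by apply/forallP=> u; rewrite ffunE rmact0x.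
move=> /forallP xP /forallP yP; apply/forallP=> u.
by rewrite !ffunE -[_ + _]/(x u - y u) rmactBl (eqP (xP u)) (eqP (yP u)).
Qed.

HB.instance Definition _ := SubChoice.on (induced f N).
HB.instance Definition _ := GRing.SubChoice_isSubZmodule.Build {ffun X -> N} inducedP
  (induced f N) induced_closed.
End InducedZmodule.

Section Morita.
Variables (K : fieldType).
Variables (A : algType K) (X : finType) (e : rel X) (x0 : X).
Variables (phi : {lrmorphism A -> digraph_alg K e x0}) (psi : digraph_alg K e x0 -> A).
Hypotheses (phiK : cancel phi psi) (psiK : cancel psi phi).
Variables (B : algType K) (Y : finType) (e' : rel Y) (y0 : Y).
Variables (phi' : {lrmorphism B -> digraph_alg K e' y0}) (psi' : digraph_alg K e' y0 -> B).
Hypotheses (phiK' : cancel phi' psi') (psiK' : cancel psi' phi').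
Variables (s : Y -> X) (p : X -> Y).
Hypotheses (sle : forall y y', connect e (s y) (s y') = connect e' y y').
Hypotheses (sK : cancel s p).
Hypotheses (sp_le : forall x, connect e (s (p x)) x) (le_sp : forall x, connect e x (s (p x))).
Local Notation le := (connect e).
Local Notation le' := (connect e').
Local Notation coA := (co phi).
Local Notation coB := (co phi').
Local Notation muA := (@mu K A X e x0 psi).
Local Notation muB := (@mu K B Y e' y0 psi').

Lemma le_p u v : le u v = le' (p u) (p v).
Proof.
rewrite -sle; apply/idP/idP => h.
  by apply: connect_trans (le_sp v); apply: connect_trans h.
by apply: connect_trans (sp_le v); apply: connect_trans h.
Qed.

(** Embeds [B] as the matrices supported on the chosen representatives, recognised by
    [s (p u) == u]. It is multiplicative, but sends 1 to the idempotent [eps]. *)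
Definition iota (b : B) : A := psi (dg_of e x0 (fun u v =>
  if (s (p u) == u) && (s (p v) == v) then coB b (p u) (p v) else 0)).

Lemma co_iota b u v :
  coA (iota b) u v = if (s (p u) == u) && (s (p v) == v) then coB b (p u) (p v) else 0.
Proof.
rewrite /co /iota psiK dg_ofE; case: ifPn => // nuv.
by rewrite [dg_coef _ _ _]dg_coef_out ?if_same // -le_p.
Qed.

Lemma iotaM b c : iota (b * c) = iota b * iota c.
Proof.
apply: (co_ext phiK) => u v; rewrite co_iota !coM.
have [su|su] := boolP (s (p u) == u); last first.
  by rewrite [RHS]big1 // => t _; rewrite co_iota (negbTE su) mul0r.
have [sv|sv] := boolP (s (p v) == v); last first.
  by rewrite [RHS]big1 // => t _; rewrite !co_iota (negbTE sv) andbF mulr0.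
rewrite [RHS](bigID (fun t => s (p t) == t)) /= [X in _ + X]big1 ?addr0 => [|t st].
  rewrite (reindex_onto s p) /= => [|t /eqP //].
  by apply: eq_big => [y|y _]; rewrite ?co_iota sK !eqxx // su sv.
by rewrite co_iota su (negbTE st) mul0r.
Qed.

Lemma iotaD b c : iota (b + c) = iota b + iota c.
Proof.
apply: (co_ext phiK) => u v; rewrite coD !co_iota coD.
by case: ifP => // _; rewrite addr0.
Qed.

Lemma iotaZ k b : iota (k *: b) = k *: iota b.
Proof.
by apply: (co_ext phiK) => u v; rewrite coZ !co_iota coZ; case: ifP; rewrite ?mulr0.
Qed.

Lemma iota_mu y y' : iota (muB y y') = muA (s y) (s y').
Proof.
have [yy|yy] := boolP (le' y y'); last first.
  rewrite (mu_out phiK' psiK') // (mu_out phiK psiK) ?sle //; apply: (co_ext phiK) => u v.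
  by rewrite co_iota !co0 if_same.
apply: (co_ext phiK) => u v; rewrite co_iota co_mu // co_mu ?sle //.
case: ifPn => [/andP[/eqP<- /eqP<-]|]; first by rewrite !(can_eq sK) !sK.
case: (eqVneq u (s y)) => [->|//]; case: (eqVneq v (s y')) => [->|//].
by rewrite !sK !eqxx.
Qed.

Definition eps : A := iota 1.

Lemma iota_epsr b : iota b * eps = iota b.
Proof. by rewrite -iotaM mulr1. Qed.
Lemma iota_epsl b : eps * iota b = iota b.
Proof. by rewrite -iotaM mul1r. Qed.

Lemma eps_sum : eps = \sum_y muA (s y) (s y).
Proof.
rewrite /eps (sum_mu phiK' psiK'); elim/big_rec2: _ => [|y a b _ <-].
  by rewrite -(scale0r 0) iotaZ scale0r.
by rewrite iotaD iota_mu.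
Qed.

Lemma mu_eps u y : muA u (s y) * eps = muA u (s y).
Proof.
have [us|us] := boolP (le u (s y)); last by rewrite (mu_out phiK psiK) ?mul0r.
rewrite eps_sum mulr_sumr (bigD1 y) //= big1 => [|y' y'y].
  by rewrite (mu_mul phiK psiK) // eqxx addr0.
by rewrite (mu_mul phiK psiK) // (can_eq sK) eq_sym (negbTE y'y).
Qed.

Section CornerModule.
Variable M : lmodType A^c.
Local Notation cM := (corner eps M).

Fact corner_act_in (x : M) b : rmact (rmact x (iota b)) eps == rmact x (iota b).
Proof. by rewrite rmactA iota_epsr. Qed.

Definition corner_act (b : B^c) (x : cM) : cM :=
  exist _ (rmact (val x) (iota b)) (corner_act_in (val x) b).

Fact corner_actA a b (x : cM) : corner_act a (corner_act b x) = corner_act (a * b) x.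
Proof. by apply: val_inj; rewrite /= rmactA -iotaM. Qed.

Fact corner_act1 : left_id 1 corner_act.
Proof. by move=> x; apply: val_inj; apply/eqP; exact: (valP x). Qed.

Fact corner_actDr : right_distributive corner_act +%R.
Proof. by move=> a x y; apply: val_inj; rewrite /= rmactDl. Qed.

Fact corner_actDl (x : cM) : {morph corner_act^~ x : a b / a + b}.
Proof. by move=> a b; apply: val_inj; rewrite /= iotaD rmactDr. Qed.

Definition cornerL : lmodType B^c :=
  HB.pack cM (GRing.Zmodule_isLmodule.Build B^c cM
    corner_actA corner_act1 corner_actDr corner_actDl).

Definition cval (x : cornerL) : M := val (x : cM).

Lemma cval_inj : injective cval. Proof. exact: val_inj. Qed.
Lemma cval_eps x : rmact (cval x) eps = cval x. Proof. exact/eqP/(valP (x : cM)). Qed.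
Lemma cval_act x b : cval (rmact x b) = rmact (cval x) (iota b). Proof. by []. Qed.
Lemma cvalD x y : cval (x + y) = cval x + cval y. Proof. by []. Qed.
Lemma cval_kscale k x : cval (kscale k x) = kscale k (cval x).
Proof. by rewrite kscaleE cval_act iotaZ rmact_scale cval_eps. Qed.

Fact cproj_in (x : M) : rmact (rmact x eps) eps == rmact x eps.
Proof. exact: (corner_act_in x 1). Qed.
Definition cproj (x : M) : cornerL := (exist _ (rmact x eps) (cproj_in x) : cM).
Lemma cprojK x : cval (cproj x) = rmact x eps. Proof. by []. Qed.
Lemma cvalK x : cproj (cval x) = x. Proof. by apply: cval_inj; apply: cval_eps. Qed.

Lemma cprojD x y : cproj (x + y) = cproj x + cproj y.
Proof. by apply: cval_inj; rewrite cvalD !cprojK rmactDl. Qed.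

Lemma cproj_kscale k x : cproj (kscale k x) = kscale k (cproj x).
Proof. by apply: cval_inj; rewrite cval_kscale !cprojK rmact_kscale. Qed.

Lemma cproj_act x b : cproj (rmact x (iota b)) = rmact (cproj x) b.
Proof. by apply: cval_inj; rewrite cval_act !cprojK !rmactA iota_epsl iota_epsr. Qed.

(** Each idempotent [muA u u] factors through the representative of [u]. Every vector is thus
    rebuilt from corner vectors, which gives faithfulness and the formula for fullness. *)
Lemma corner_exp (x : M) :
  x = \sum_u rmact (cval (cproj (rmact x (muA u (s (p u)))))) (muA (s (p u)) u).
Proof.
rewrite {1}(mod_exp phiK psiK x); apply: eq_bigr => u _.
by rewrite cprojK !rmactA mulrA mu_eps (mu_mul phiK psiK) // eqxx.
Qed.

End CornerModule.

Implicit Types M N Q : lmodType A^c.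

Lemma corner_map M N (f : {linear M -> N}) :
  exists h : {linear cornerL M -> cornerL N}, h =1 fun x => cproj (f (cval x)).
Proof.
apply: exists_linear => b x y; apply: cval_inj.
rewrite cvalD cval_act !cprojK cvalD cval_act linearD rmact_lin.
by rewrite rmactDl !rmactA iota_epsr iota_epsl.
Qed.

Definition corner_fmap M N (f : {linear M -> N}) : {linear cornerL M -> cornerL N} :=
  projT1 (cid (corner_map f)).

Lemma corner_fmapE M N (f : {linear M -> N}) x : cval (corner_fmap f x) = f (cval x).
Proof.
by rewrite /corner_fmap; case: cid => h /= ->; rewrite cprojK -rmact_lin cval_eps.
Qed.

Fact corner_fmap_ext M N (f g : {linear M -> N}) :
  f =1 g -> corner_fmap f =1 corner_fmap g.
Proof. by move=> fg x; apply: cval_inj; rewrite !corner_fmapE fg. Qed.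

Fact corner_fmap_id M (f : {linear M -> M}) : f =1 id -> corner_fmap f =1 id.
Proof. by move=> fid x; apply: cval_inj; rewrite corner_fmapE fid. Qed.

Fact corner_fmap_comp M N Q (f : {linear M -> N}) (g : {linear N -> Q})
    (h : {linear M -> Q}) :
  h =1 g \o f -> corner_fmap h =1 corner_fmap g \o corner_fmap f.
Proof. by move=> hgf x; apply: cval_inj; rewrite /= !corner_fmapE hgf. Qed.

Definition corner_functor : modFunctor A B :=
  ModFunctor corner_fmap_ext corner_fmap_id corner_fmap_comp.

Lemma corner_faithful M N (f g : {linear M -> N}) :
  corner_fmap f =1 corner_fmap g -> f =1 g.
Proof.
move=> fg x; rewrite (corner_exp x) !linear_sum; apply: eq_bigr => u _.
by rewrite (rmact_lin f) (rmact_lin g) -(corner_fmapE f) -(corner_fmapE g) fg.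
Qed.

(* [x * muA u (s (p u))] lies in the corner, where [h] is defined; transport back
   along [muA (s (p u)) u]. *)
Lemma corner_full M N (h : {linear cornerL M -> cornerL N}) :
  exists f : {linear M -> N}, corner_fmap f =1 h.
Proof.
pose f x := \sum_u rmact (cval (h (cproj (rmact x (muA u (s (p u))))))) (muA (s (p u)) u).
have fD x y : f (x + y) = f x + f y.
  rewrite /f -big_split; apply: eq_bigr => u _.
  by rewrite rmactDl cprojD linearD cvalD rmactDl.
have fmu x u v : le u v -> f (rmact x (muA u v)) = rmact (f x) (muA u v).
  move=> uv; rewrite /f (bigD1 v) //= [X in _ + X]big1 ?addr0 => [|t tv]; last first.
    rewrite rmactA (mu_mul phiK psiK) // eq_sym (negbTE tv) rmact0.
    have -> : cproj (0 : M) = 0 by apply: cval_inj; rewrite cprojK rmact0x.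
    by rewrite linear0 rmact0x.
  rewrite rmact_suml (bigD1 u) //= [X in _ + X]big1 ?addr0 => [|t tu]; last first.
    by rewrite rmactA (mu_mul phiK psiK) // (negbTE tu) rmact0.
  have us : le u (s (p v)) by apply: connect_trans uv _.
  have ss : le (s (p u)) (s (p v)) by apply: connect_trans us.
  have sv : le (s (p u)) v by apply: connect_trans uv.
  rewrite !rmactA (mu_mul phiK psiK) // (mu_mul phiK psiK) // !eqxx.
  have -> : muA u (s (p v)) = muA u (s (p u)) * muA (s (p u)) (s (p v)).
    by rewrite (mu_mul phiK psiK) // eqxx.
  rewrite -rmactA -iota_mu cproj_act rmact_lin cval_act iota_mu rmactA.
  by rewrite (mu_mul phiK psiK) // eqxx.
have fZ x k : f (kscale k x) = kscale k (f x).
  rewrite /f kscale_sumr; apply: eq_bigr => u _.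
  by rewrite rmact_kscale cproj_kscale kscale_lin cval_kscale rmact_kscale.
have f0 : f 0 = 0 by rewrite -(kscale0x _ 0) fZ kscale0.
have fsum (J : finType) (P : pred J) (F : J -> M) :
    f (\sum_(i | P i) F i) = \sum_(i | P i) f (F i).
  by elim/big_rec2: _ => [|i x y _ <-].
have [g gE] : exists g : {linear M -> N}, g =1 f.
  apply: exists_linear => a x y; rewrite fD (alg_exp phiK psiK a) !rmact_sumr fsum.
  congr (_ + _); apply: eq_bigr => u _; rewrite !rmact_sumr fsum.
  by apply: eq_bigr => v uv; rewrite !rmact_scale fZ fmu.
exists g => x; apply: cval_inj; rewrite corner_fmapE gE.
have : cval x = \sum_y rmact (cval x) (muA (s y) (s y)).
  by rewrite -rmact_sumr -eps_sum cval_eps.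
move=> xE; rewrite xE fsum -[RHS]cval_eps eps_sum rmact_sumr; apply: eq_bigr => y _.
rewrite fmu // /f rmact_suml (bigD1 (s y)) //= [X in _ + X]big1 ?addr0 => [|t tu].
  rewrite sK !rmactA (mu_mul phiK psiK) // eqxx.
  rewrite -iota_mu cproj_act cvalK rmact_lin cval_act iota_mu rmactA.
  by rewrite (mu_mul phiK psiK) // eqxx.
by rewrite rmactA (mu_mul phiK psiK) // (negbTE tu) rmact0.
Qed.

Section InducedModule.
Variable N : lmodType B^c.
Local Notation iN := (induced (fun u => muB (p u) (p u)) N).
Implicit Types (n : N) (x : iN).

Definition ival x (u : X) : N := val x u.

Lemma ival_inj x x' : ival x =1 ival x' -> x = x'.
Proof. by move=> xx; apply: val_inj; apply/ffunP. Qed.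

Lemma ival_idem x u : rmact (ival x u) (muB (p u) (p u)) = ival x u.
Proof. exact/eqP/(forallP (valP x)). Qed.

Lemma ivalD x x' u : ival (x + x') u = ival x u + ival x' u.
Proof. by rewrite /ival ffunE. Qed.

Lemma muB_chain u v t : le u v -> le v t ->
  muB (p u) (p v) * muB (p v) (p t) = muB (p u) (p t).
Proof. by rewrite !le_p => uv vt; rewrite (mu_mul phiK' psiK') // eqxx. Qed.

Definition induced_fun (a : A) (x : iN) : {ffun X -> N} :=
  [ffun t => \sum_u kscale (coA a u t) (rmact (ival x u) (muB (p u) (p t)))].

Fact induced_in a x :
  [forall t, rmact (induced_fun a x t) (muB (p t) (p t)) == induced_fun a x t].
Proof.
apply/forallP=> t; rewrite ffunE rmact_suml; apply/eqP/eq_bigr => u _.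
rewrite rmact_kscale; have [ut|ut] := boolP (le u t); last by rewrite co_out ?kscale0.
by rewrite rmactA muB_chain.
Qed.

Definition induced_act (a : A^c) x : iN := exist _ (induced_fun a x) (induced_in a x).

Lemma ival_act a x t : ival (induced_act a x) t =
  \sum_u kscale (coA a u t) (rmact (ival x u) (muB (p u) (p t))).
Proof. by rewrite /ival ffunE. Qed.

Fact induced_actA a b x : induced_act a (induced_act b x) = induced_act (a * b) x.
Proof.
apply: ival_inj => t; rewrite !ival_act.
under eq_bigr do rewrite ival_act rmact_suml kscale_sumr.
rewrite exchange_big; apply: eq_bigr => u _; rewrite [coA _ u t]coM.
rewrite [RHS]kscaleE scaler_suml rmact_sumr; apply: eq_bigr => v _.
rewrite -[RHS]kscaleE rmact_kscale kscaleA mulrC.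
have [uv|uv] := boolP (le u v); last by rewrite (co_out _ _ uv) mul0r !kscale0.
have [vt|vt] := boolP (le v t); last by rewrite (co_out _ _ vt) mulr0 !kscale0.
by rewrite rmactA muB_chain.
Qed.

Fact induced_act1 : left_id 1 induced_act.
Proof.
move=> x; apply: ival_inj => t; rewrite ival_act (bigD1 t) //= big1 => [|u ut].
  by rewrite addr0 co1 eqxx kscale1 ival_idem.
by rewrite co1 (negbTE ut) kscale0.
Qed.

Fact induced_actDr : right_distributive induced_act +%R.
Proof.
move=> a x y; apply: ival_inj => t; rewrite ivalD !ival_act -big_split.
by apply: eq_bigr => u _; rewrite ivalD rmactDl kscaleDr.
Qed.

Fact induced_actDl x : {morph induced_act^~ x : a b / a + b}.
Proof.
move=> a b; apply: ival_inj => t; rewrite ivalD !ival_act -big_split.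
by apply: eq_bigr => u _; rewrite coD kscaleDl.
Qed.

Definition inducedL : lmodType A^c :=
  HB.pack iN (GRing.Zmodule_isLmodule.Build A^c iN
    induced_actA induced_act1 induced_actDr induced_actDl).

Lemma ival_eps x t : ival (induced_act eps x) t = if s (p t) == t then ival x t else 0.
Proof.
rewrite ival_act; case: ifPn => st; last first.
  by rewrite big1 // => u _; rewrite co_iota (negbTE st) andbF kscale0.
rewrite (bigD1 t) //= big1 => [|u ut].
  by rewrite addr0 co_iota st co1 eqxx kscale1 ival_idem.
rewrite co_iota st andbT; case: eqP => [su|]; last by rewrite kscale0.
by rewrite co1 -(can_eq sK) su (eqP st) (negbTE ut) kscale0.
Qed.

Fact spread_in n : [forall u : X, rmact ([ffun v => rmact n (muB (p v) (p v))] u)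
  (muB (p u) (p u)) == [ffun v => rmact n (muB (p v) (p v))] u].
Proof.
by apply/forallP=> u; rewrite ffunE rmactA (mu_mul phiK' psiK') // eqxx.
Qed.

Definition spread n : iN := exist _ [ffun v => rmact n (muB (p v) (p v))] (spread_in n).

Lemma ival_spread n u : ival (spread n) u = rmact n (muB (p u) (p u)).
Proof. by rewrite /ival ffunE. Qed.

(** Cutting by [eps] keeps the components at representatives only. Their sum is an element of [N],
    and [spread] recovers the components from it. *)
Lemma corner_induced_iso : mod_iso (cornerL inducedL) N.
Proof.
pose g (x : cornerL inducedL) : N := \sum_y ival (cval x) (s y).
have [h hE] : exists h : {linear cornerL inducedL -> N}, h =1 g.
  apply: exists_linear => b x x'; rewrite /g cvalD.
  under eq_bigr do rewrite ivalD.
  rewrite big_split; congr (_ + _); rewrite cval_act rmact_suml.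
  under eq_bigr do rewrite [ival _ _]ival_act.
  rewrite exchange_big /= (bigID (fun u => s (p u) == u)) /= [X in _ + X]big1 ?addr0.
    rewrite (reindex_onto s p) /= => [|u /eqP //].
    apply: eq_big => [y|y]; rewrite ?sK ?eqxx // => _.
    rewrite -[in RHS]ival_idem sK rmactA (mu_row phiK' psiK') rmact_sumr.
    rewrite [RHS]big_mkcond; apply: eq_bigr => y' _; rewrite rmact_scale co_iota !sK !eqxx.
    by case: ifPn => // yy; rewrite co_out ?kscale0.
  by move=> u /negbTE su; rewrite big1 // => y _; rewrite co_iota su kscale0.
exists h; exists (fun n => @cproj inducedL (spread n)) => [x|n]; rewrite hE /g.
  apply: cval_inj; rewrite cprojK -[RHS]cval_eps; apply: ival_inj => t.
  rewrite !ival_eps; case: ifP => // /eqP st; rewrite ival_spread rmact_suml.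
  rewrite (bigD1 (p t)) //= big1 => [|y yt].
    by rewrite addr0 st ival_idem.
  rewrite -ival_idem sK rmactA (mu_mul phiK' psiK') //.
  by rewrite (negbTE yt) rmact0.
rewrite [RHS](mod_exp phiK' psiK'); apply: eq_bigr => y _.
by rewrite cprojK [ival _ _]ival_eps sK eqxx ival_spread sK.
Qed.

End InducedModule.

Theorem morita_corner : morita_equivalent A B.
Proof.
exists corner_functor; split=> [M N k f g h hE y|M N f g|M N h|N].
- by apply: cval_inj; rewrite /= cvalD cval_kscale !corner_fmapE hE.
- exact: corner_faithful.
- exact: corner_full.
- by exists (inducedL N); apply: corner_induced_iso.
Qed.

End Morita.

(** * The digraph of the block map *)

Section BlockDigraph.
Local Open Scope group_scope.
Variables (C : coxeterSystem) (w : C).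
Implicit Types (u v : rinterval w) (J : {set cox_index C}).

Lemma Jblock_anti u v : rle (val u) (val v) -> Jblock v \subset Jblock u.
Proof.
by move=> uv; rewrite sub_Jblock ?Jblock_reduced // (rle_trans uv) ?Jblock_rle.
Qed.

(** [Jblock] grows on the way down, so every downward step is an edge. On the way up it is squeezed
    between its values at [v] and at [u]; when these agree, upward steps are edges too. *)
Lemma connect_rle u v : rle (val u) (val v) ->
  connect (Ggraph w) v u /\ (Jblock u \subset Jblock v -> connect (Ggraph w) u v).
Proof.
move En : (ell (val v) - ell (val u))%N => n; elim: n u En => [|n IH] u En uv.
  have -> : u = v by apply/val_inj/(rle_eq uv); rewrite -subn_eq0 En.
  by rewrite connect0.
have nuv : val u != val v by apply: contraPneq En => ->; rewrite subnn.
have [i ui zv] := rle_word_split uv nuv.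
pose z : rinterval w := exist _ (val u * 's_i) (rle_trans zv (valP v)).
have uz : rle (val u) (val z) by rewrite /= rle_asc.
have zn : (ell (val v) - ell (val z))%N = n by rewrite /= ell_asc // subnS En.
have [vz zvc] := IH z zn (zv : rle (val z) (val v)).
split.
  apply: connect_trans vz (connect1 _); rewrite /Ggraph /= (Jblock_anti uz) andbT.
  by apply/existsP; exists i.
move=> sub; have zvJ : Jblock v \subset Jblock z by exact: (@Jblock_anti z v).
have uzJ : Jblock u \subset Jblock z := subset_trans sub zvJ.
apply: connect_trans (zvc _); last exact: (subset_trans (Jblock_anti uz) sub).
apply: connect1; rewrite /Ggraph /= uzJ andbT.
by apply/existsP; exists i; rewrite mul_genK.
Qed.

(** Climb from [u] to the cutting point of its block, where [Jblock] has the same value, and descend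
    from there to [v]. *)
Lemma connect_Ggraph u v : connect (Ggraph w) u v = (Jblock u \subset Jblock v).
Proof.
apply/idP/idP=> [/connectP[p]|sub].
  elim: p u => [|z p IH] u /= => [_ -> //|/andP[/andP[_ uz] /IH zv] vE].
  exact: subset_trans uz (zv vE).
have Jr := Jblock_reduced u; have [JB _] := andP Jr.
pose x : rinterval w := exist _ (lquo (Jblock u) w) (rle_lquo JB).
have xJ : Jblock x = Jblock u by apply: Jblock_lquo.
have [_ ux] := connect_rle (Jblock_rle u : rle (val u) (val x)).
apply: connect_trans (ux _) _; first by rewrite xJ.
by apply: (proj1 (connect_rle _)); rewrite -sub_Jblock.
Qed.

End BlockDigraph.

(** * Application to the biHecke algebra *)

Section Assembly.
Variables (C : coxeterSystem) (K : fieldType) (w : C).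
Local Notation I := (cox_index C).
Local Notation T := (transmod K w).
Local Notation H := (HW K w).
Local Notation X := (rinterval w).
Local Notation D := (digraph_alg K (Ggraph w) (rinterval1 w)).
Implicit Types (u v : X) (J : RBL w) (a b : H).

Lemma vsvalM a b : vsval (a * b) = (vsval a : transEnd K w) * vsval b.
Proof. by []. Qed.

Lemma vsval1 : vsval (1 : H) = 1 :> transEnd K w.
Proof. by apply/eqP; rewrite -[_ == _]/(algid (biHecke K w) == 1) algid_eq1 mem_biHecke1. Qed.

(** The isomorphism takes coordinates in the basis [bvec]. It is onto because every matrix supported
    on the allowed pairs stabilises all the [antisym] spaces, hence belongs to the algebra. *)
Lemma exists_digraph_morphism : exists phi : {lrmorphism H -> D},
  bijective phi /\ forall a u v, dg_coef (phi a) u v = cf (vsval a) u v.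
Proof.
pose F (a : H) : D := dg_of (Ggraph w) (rinterval1 w) (cf (vsval a)).
have FE a u v : dg_coef (F a) u v = cf (vsval a) u v.
  rewrite dg_ofE connect_Ggraph; case: ifPn => // uv.
  have /stab_cf-> // : stab (vsval a) by rewrite -biHecke_stab; apply: valP.
have Flin : linear F.
  move=> c a b; apply: dg_coefP => u v.
  by rewrite dg_coefD dg_coefZ !FE linearP /= cfD cfZ.
have Fmul : monoid_morphism F.
  split; first by apply: dg_coefP => u v; rewrite FE vsval1 cf1 [RHS]dg_oneE.
  by move=> a b; apply: dg_coefP => u v; rewrite [RHS]dg_mulE FE vsvalM cfM;
    apply: eq_bigr => t _; rewrite !FE.
pose phi : {lrmorphism H -> D} := HB.pack F (GRing.isLinear.Build K H D *:%R F Flin)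
  (GRing.isMonoidMorphism.Build H D F Fmul).
have Finj : injective F.
  move=> a b ab; apply: val_inj; apply: cf_ext => u v; by rewrite -!FE ab.
have Fsurj (d : D) : exists a, F a = d.
  have [f fE] := exists_cf (dg_coef d).
  have fH : f \in biHecke K w.
    rewrite biHecke_stab; apply/stab_cf=> u v uv.
    by rewrite fE dg_coef_out // connect_Ggraph.
  by exists (Sub f fH); apply: dg_coefP => u v; rewrite FE /= fE.
have [G GK] := choice Fsurj.
exists phi; split; last exact: FE.
by exists G => [a|d]; [apply: Finj; exact: GK | exact: GK].
Qed.

Lemma Ppred_closed J : submod_closed (Ppred K J).
Proof.
split=> [|a x y xJ yJ]; first exact: mem0v.
apply: memvD => //; have /stabP sa : stab (vsval (a : H)).
  by rewrite -biHecke_stab; apply: valP.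
exact: (sa _ (valP J)).
Qed.


Section Modules.
Variables (phi : {lrmorphism H -> D}) (psi : D -> H).
Hypotheses (phiK : cancel phi psi) (psiK : cancel psi phi).
Hypothesis phiE : forall a u v, dg_coef (phi a) u v = cf (vsval a) u v.
Variable hP : forall J : RBL w, submod_closed (Ppred K J).
Local Notation P J := (Pmod hP J).
Local Notation S J := (Smod hP J).
Local Notation up J := [set u : X | val J \subset Jblock u].

Lemma val_Pmod_act J (x : P J) a : val (rmact x a) = ap (vsval a) (val x).
Proof. by []. Qed.

Lemma val_Pmod_kscale J (x : P J) k : val (kscale k x) = k *: (val x : T).
Proof.
rewrite kscaleE val_Pmod_act; have -> : vsval (k%:A : H) = k *: (1 : transEnd K w).
  by rewrite linearZ; congr (_ *: _); exact: vsval1.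
by rewrite apZ ap1.
Qed.

Definition Pbasis J u : P J := insubd (0 : P J) (bvec K u : transmodR K w).

Lemma bvec_in J u : (bvec K u \in antisym K w (val J)) = (val J \subset Jblock u).
Proof.
apply/idP/idP=> [/(antisym_coef _ (valP J)) h|]; last exact: bvec_antisym.
apply: contraT => /h; rewrite ginv_bvec eqxx => /eqP; by rewrite oner_eq0.
Qed.

Lemma val_Pbasis J u : val (Pbasis J u) = if u \in up J then bvec K u else 0.
Proof. by rewrite val_insubd inE -bvec_in. Qed.

Lemma bvec_nonzero u : bvec K u <> 0.
Proof.
move=> /(congr1 (fun x : T => x u)); rewrite bvec_diag ffunE => /eqP.
by rewrite oner_eq0.
Qed.

Lemma Pmod_typed J : typed psi (up J) (@Pbasis J).
Proof.
split=> [u|u s t uJ|x].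
- split=> [u0|uJ /(congr1 val)]; last by rewrite val_Pbasis uJ => /bvec_nonzero.
  by apply: contrapT => uJ; apply: u0; apply: val_inj; rewrite val_Pbasis; case: ifP uJ.
- move=> st; apply: val_inj; rewrite val_Pmod_act val_Pbasis uJ ap_bvec.
  have cfE' v : cf (vsval (mu psi s t)) u v = ((u == s) && (v == t))%:R.
    by rewrite -phiE -(co_mu psiK u v st).
  have [us|us] := eqVneq u s; last first.
    by rewrite big1 // => v _; rewrite cfE' (negbTE us) scale0r.
  rewrite (bigD1 t) //= big1 => [|v vt]; last by rewrite cfE' (negbTE vt) andbF scale0r.
  rewrite addr0 cfE' us !eqxx scale1r val_Pbasis ifT //.
  by move: uJ; rewrite !inE => uJ; apply: (subset_trans uJ); rewrite us -connect_Ggraph.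
exists (ap (ginv K w) (val x : T)); apply: val_inj; rewrite [LHS]bvec_exp.
have -> (f : X -> P J) : val (\sum_u f u) = \sum_u val (f u).
  by elim/big_rec2: _ => [|u y z _ <-].
apply: eq_bigr => u _; rewrite val_Pmod_kscale val_Pbasis inE; case: ifPn => // uJ.
by have /(antisym_coef _ (valP J))/(_ _ uJ)-> := valP x; rewrite scale0r scaler0.
Qed.


(** If [Jblock u] is [J], no larger block lies inside it, so every element of [Psum] has coordinate
    0 at [u]. *)
Lemma bvec_Psum J u : val J \subset Jblock u ->
  (bvec K u \in Psum K J) = (Jblock u != val J).
Proof.
move=> Ju; apply/idP/idP=> [/memv_sumP[f fP E]|nJ]; last first.
  pose J' : RBL w := exist _ (Jblock u) (Jblock_reduced u).
  have JJ' : val J \proper val J' by rewrite properEneq eq_sym nJ.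
  by apply: (subvP (sumv_sup J' JJ' (subvv _))); rewrite bvec_in.
apply/negP=> /eqP uJ; have := ginv_bvec K u u; rewrite eqxx E => /eqP.
rewrite /ap linear_sum sum_ffunE big1 => [|J' JJ']; first by rewrite eq_sym oner_eq0.
have /(antisym_coef _ (valP J')) := fP J' JJ'; apply.
by rewrite uJ; apply: contraL JJ' => JJ; rewrite properE JJ andbF.
Qed.

Lemma Smod_typed J : exists b : X -> S J, typed psi [set u | Jblock u == val J] b.
Proof.
have := typed_quotmod (Pmod_typed J) (@Spred_closed C K w hP J).
set Y := [set v in _ | _]; suff -> : Y = [set u | Jblock u == val J].
  by move=> bT; eexists; exact: bT.
have SE u : val J \subset Jblock u ->
    (Pbasis J u \in @Spred C K w hP J) = (Jblock u != val J).
  move=> Ju; rewrite -[LHS]/((val (Pbasis J u) : T) \in Psum K J) val_Pbasis.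
  by rewrite in_set Ju bvec_Psum.
apply/setP=> u; rewrite !in_set; apply/andP/idP => [[uJ]|/eqP uJ].
  by rewrite SE // negbK.
by rewrite SE ?uJ ?eqxx.
Qed.

Definition cut_elt J : X := exist _ (lquo (val J) w)
  (rle_lquo (proj1 (andP (valP J)))).

Lemma Jblock_cut J : Jblock (cut_elt J) = val J.
Proof. exact: (Jblock_lquo (valP J)).  Qed.

Lemma upE J : up J = [set v | connect (Ggraph w) (cut_elt J) v].
Proof. by apply/setP=> v; rewrite !inE connect_Ggraph Jblock_cut. Qed.

Lemma classE J : [set u | Jblock u == val J] =
  [set v | connect (Ggraph w) (cut_elt J) v && connect (Ggraph w) v (cut_elt J)].
Proof.
by apply/setP=> v; rewrite !inE !connect_Ggraph Jblock_cut eqEsubset andbC.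
Qed.

Lemma up_inj J J' : up J = up J' -> J = J'.
Proof.
move=> E; apply: val_inj; apply/eqP; rewrite eqEsubset.
have /setP E' := E; have := E' (cut_elt J); have := E' (cut_elt J').
by rewrite !inE !Jblock_cut !subxx => -> <-.
Qed.

Lemma Pmod_typed_le J : typed psi [set v | connect (Ggraph w) (cut_elt J) v] (@Pbasis J).
Proof. rewrite -upE; exact: Pmod_typed. Qed.

Lemma Smod_typed_le J : exists b : X -> S J, typed psi
  [set v | connect (Ggraph w) (cut_elt J) v && connect (Ggraph w) v (cut_elt J)] b.
Proof. rewrite -classE; exact: Smod_typed. Qed.

Lemma Pmod_complete : complete_representatives
  (fun M : lmodType H^c => projective_mod M /\ indecomposable_mod M) (Pmod hP).
Proof.
split=> [J|J J' iso|M [Mp Mi]].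
- split; last exact: (typed_indecomposable (Pmod_typed_le J)).
  exact: (typed_projective phiK psiK (Pmod_typed_le J)).
- exact/up_inj/(typed_iso_eq (Pmod_typed J) (Pmod_typed J')).
have [u uM] := projective_complete phiK psiK Mp Mi.
pose J : RBL w := exist _ (Jblock u) (Jblock_reduced u).
exists J; apply: (uM _ (@Pbasis J)).
have := Pmod_typed J; congr (typed _ _ _).
by apply/setP=> v; rewrite !inE connect_Ggraph.
Qed.

Lemma Smod_complete : complete_representatives (@simple_mod H^c) (Smod hP).
Proof.
split=> [J|J J' iso|M Ms].
- have [b bT] := Smod_typed_le J; apply: (typed_simple bT (u := cut_elt J)).
    by rewrite inE connect0.
  by move=> v; rewrite inE => /andP.
- have [b bT] := Smod_typed J; have [b' b'T] := Smod_typed J'.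
  have /setP/(_ (cut_elt J)) := typed_iso_eq bT b'T iso.
  by rewrite !inE Jblock_cut eqxx => /esym/eqP/val_inj.
have [u [b bT]] := simple_typed phiK psiK Ms.
pose J : RBL w := exist _ (Jblock u) (Jblock_reduced u).
have [b' b'T] := Smod_typed J; exists J.
have E : [set v | Jblock v == val J] =
    [set v | connect (Ggraph w) u v && connect (Ggraph w) v u].
  by apply/setP=> v; rewrite !inE !connect_Ggraph eqEsubset andbC.
rewrite E in b'T; apply: (typed_iso phiK psiK bT b'T (u := u)).
  by rewrite inE connect0.
by move=> v; rewrite inE => /andP[].
Qed.

Lemma Smod_kdim J : has_kdim (S J) #|[set u : X | Jblock u == val J]|.
Proof. by have [b bT] := Smod_typed J; apply: (typed_kdim bT). Qed.

Lemma cartan J J' : composition_mult (S J) (P J')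
  (cut_le (lquo (val J) w) (lquo (val J') w)).
Proof.
have [b bT] := Smod_typed_le J; rewrite cut_leP ?(valP J) ?(valP J') //.
have := typed_composition phiK psiK bT (Pmod_typed J').
by rewrite inE Jblock_cut.
Qed.

Lemma strict_upE J : strict_up (Ggraph w) (up J) = [set u | val J \proper Jblock u].
Proof.
apply/setP=> u; rewrite in_set inE; apply/andP/idP=> [[Ju /exists_inP[v]]|Ju].
  rewrite in_set in Ju; rewrite inE !connect_Ggraph => Jv /andP[vu uv].
  by rewrite properE Ju; apply: contra uv => uJ; apply: subset_trans Jv.
split; first by rewrite in_set proper_sub.
apply/exists_inP; exists (cut_elt J); first by rewrite inE Jblock_cut.
by rewrite !connect_Ggraph Jblock_cut -properE.
Qed.

Lemma strict_up2E J J' :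
  (cut_elt J' \in strict_up (Ggraph w) (up J)
     :\: strict_up (Ggraph w) (strict_up (Ggraph w) (up J)))
  = cut_cover w (lquo (val J') w) (lquo (val J) w).
Proof.
rewrite strict_upE; apply/setDP/and3P=> [[]|[JJ' nJ /forallP cov]].
  rewrite in_set Jblock_cut => JJ' h; have [sub _] := andP JJ'.
  rewrite cut_leP ?(valP J) ?(valP J') // sub; split=> //.
    by apply: contraTneq JJ' => /(lquo_inj (valP J') (valP J)) ->; rewrite properxx.
  apply/forallP=> x; apply/implyP=> /and3P[/existsP[L /andP[LB /eqP->]]].
  have [L' L'r <-] := exists_reduced_block LB; rewrite !cut_leP ?(valP J) ?(valP J') //.
  move=> L'J' JL'; have [->|nJ] := eqVneq L' (val J); first by rewrite eqxx orbT.
  have [->|nJ'] := eqVneq L' (val J'); first by rewrite eqxx.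
  case/negP: h; rewrite in_set in_set Jblock_cut JJ'; apply/exists_inP.
  exists (cut_elt (exist _ L' L'r)); first by rewrite inE Jblock_cut properEneq eq_sym nJ.
  by rewrite !connect_Ggraph !Jblock_cut -properE properEneq nJ'.
rewrite cut_leP ?(valP J) ?(valP J') // in JJ'.
have JJ : val J \proper val J'.
  by rewrite properEneq JJ' andbT; apply: contra nJ => /eqP->.
split; first by rewrite inE Jblock_cut.
rewrite in_set in_set Jblock_cut JJ; apply/negP=> /exists_inP[u].
rewrite inE !connect_Ggraph Jblock_cut -properE => Ju uJ.
have ur := Jblock_reduced u; have [uB _] := andP ur.
have := cov (lquo (Jblock u) w); rewrite !cut_leP ?(valP J) ?(valP J') //.
rewrite (proper_sub Ju) (proper_sub uJ) !andbT.
have -> /= : cut_le (lquo (Jblock u) w) w.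
  by apply/existsP; exists (Jblock u); rewrite uB eqxx.
case/orP=> /eqP.
  by move/(lquo_inj ur (valP J')) => E; rewrite E properxx in uJ.
by move/(lquo_inj ur (valP J)) => E; rewrite E properxx in Ju.
Qed.

Lemma quiver J J' : composition_mult (S J') (radical_layer (P J))
  (cut_cover w (lquo (val J') w) (lquo (val J) w)).
Proof.
have [b bT] := Smod_typed_le J'.
have [b' b'T] := typed_radical_layer phiK psiK (Pmod_typed J).
by rewrite -strict_up2E; apply: (typed_composition phiK psiK bT b'T).
Qed.

Local Notation cutr := (fun x y : cutpoints w => cut_le (val y) (val x)).

Lemma cut_block (x : cutpoints w) : exists J, lquo (val J) w = val x.
Proof.
have /existsP[L /andP[LB /eqP->]] := valP x.
by have [L' L'r <-] := exists_reduced_block LB; exists (exist _ L' L'r).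
Qed.

Definition cut_incl (x : cutpoints w) : X := exist _ (val x) (cut_le_rle (valP x)).

Lemma lquo_cut u : cut_le (lquo (Jblock u) w) w.
Proof.
have [uB _] := andP (Jblock_reduced u).
by apply/existsP; exists (Jblock u); rewrite uB eqxx.
Qed.

Definition cut_proj u : cutpoints w := exist _ (lquo (Jblock u) w) (lquo_cut u).

Lemma lquo_Jblock_cut (x : cutpoints w) : lquo (Jblock (cut_incl x)) w = val x.
Proof.
have [J Jx] := cut_block x.
by rewrite (Jblock_lquo (valP J)) /= ?Jx.
Qed.

Lemma Jblock_proj u : Jblock (cut_incl (cut_proj u)) = Jblock u.
Proof. exact: (Jblock_lquo (Jblock_reduced u)). Qed.

Lemma cut_le_block (x y : cutpoints w) :
  cutr x y = (Jblock (cut_incl x) \subset Jblock (cut_incl y)).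
Proof. by rewrite -(cut_leP (w := w)) ?Jblock_reduced // !lquo_Jblock_cut. Qed.

Lemma connect_cut (x y : cutpoints w) :
  connect cutr x y = (Jblock (cut_incl x) \subset Jblock (cut_incl y)).
Proof.
apply/idP/idP=> [/connectP[p]|xy]; last by apply: connect1; rewrite cut_le_block.
elim: p x => [|z p IH] x /= => [_ -> //|/andP[xz /IH zy] yE].
by apply: subset_trans (zy yE); rewrite -cut_le_block.
Qed.

(** Cutting points represent the classes, and [u] retracts to the cutting point of [Jblock u]. The
    order is reversed in [cutr] since [poset_alg] is the digraph algebra of the opposite relation;
    [phi'] is therefore the identity. *)
Lemma biHecke_morita : morita_equivalent H
  (poset_alg K (fun x y : cutpoints w => cut_le (val x) (val y)) (cuttop w)).
Proof.
pose B := poset_alg K (fun x y : cutpoints w => cut_le (val x) (val y)) (cuttop w).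
pose phi' : {lrmorphism B -> digraph_alg K cutr (cuttop w)} := idfun.
apply: (morita_corner phiK psiK (phi' := phi') (psi' := id)
  (fun _ => erefl) (fun _ => erefl) (s := cut_incl) (p := cut_proj)).
- by move=> x y; rewrite connect_Ggraph connect_cut.
- by move=> x; apply: val_inj; rewrite /= lquo_Jblock_cut.
- by move=> u; rewrite connect_Ggraph Jblock_proj.
- by move=> u; rewrite connect_Ggraph Jblock_proj.
Qed.

End Modules.
End Assembly.

Theorem theorem6p17 (C : coxeterSystem) (K : fieldType)
    (charK0 : [pchar K] =i pred0) (w : C) :
  exists hP : forall J : RBL w, submod_closed (Ppred K J),
    (* (1) *)
    (forall f : transEnd K w,
       (f \in biHecke K w) =
       [forall J : RBL w, (f @: antisym K w (val J) <= antisym K w (val J))%VS])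
    /\
    (* (2) *)
    [/\ forall u v : rinterval w, Jblock u \subset Jblock v ->
          exists2 f : transEnd K w, biHecke_monoid f & triangular f u v,
        forall f : rinterval w -> rinterval w -> transEnd K w,
          (forall u v : rinterval w, Jblock u \subset Jblock v ->
             biHecke_monoid (f u v) /\ triangular (f u v) u v) ->
          basis_of (biHecke K w)
            [seq f p.1 p.2 | p in Jpairs w]
      & \dim (biHecke K w) = #|Jpairs w|]
    /\
    (* (3) *)
    (exists phi : {lrmorphism HW K w -> digraph_alg K (Ggraph w) (rinterval1 w)},
       bijective phi)
    /\
    (* (4) *)
    complete_representatives
      (fun M : lmodType (HW K w)^c => projective_mod M /\ indecomposable_mod M)
      (Pmod hP)
    /\
    (* (5) *)
    (complete_representatives (@simple_mod (HW K w)^c) (Smod hP)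
     /\ forall J : RBL w,
          has_kdim (Smod hP J) #|[set u : rinterval w | Jblock u == val J]|)
    /\
    (* (6) The Cartan matrix is ([P_J' : S_J]); the quiver has
       [rad P_J / rad^2 P_J : S_J'] arrows from J to J'. *)
    [/\ morita_equivalent (HW K w)
          (poset_alg K (fun x y : cutpoints w => cut_le (val x) (val y)) (cuttop w)),
        forall J J' : RBL w,
          composition_mult (Smod hP J) (Pmod hP J')
            (cut_le (lquo (val J) w) (lquo (val J') w))
      & forall J J' : RBL w,
          composition_mult (Smod hP J') (radical_layer (Pmod hP J))
            (cut_cover w (lquo (val J') w) (lquo (val J) w))].
Proof.
have [phi [phi_bij phiE]] := exists_digraph_morphism K w.
have [psi phiK psiK] := phi_bij.
exists (@Ppred_closed C K w); split; first exact: biHecke_stab.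
split; first split; [exact: exists_triangular| |exact: dim_biHecke|].
  by move=> f fP; case: (triangular_basis fP).
split; first by exists phi.
split; first exact: (Pmod_complete phiK psiK phiE).
split; first split; [exact: (Smod_complete phiK psiK phiE)|exact: (Smod_kdim psiK phiE)|].
split; first exact: (biHecke_morita phiK psiK).
  exact: (cartan phiK psiK phiE).
exact: (quiver phiK psiK phiE).
Qed.
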